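(* Let $C\in\mathbb D_0$. Then (1) $\tau_{C^\beta}=q_C$; (2) $\bar K_C^\flat=\bar K_{C^\beta}$. Moreover $C^\beta\in\mathbb D_0$ and $(C^\beta)^\beta=C$, so $C\mapsto C^\beta$ is an involution of $\mathbb D_0$.
   Context: Fix an integer $r>1$ and constants $a_1,\dots,a_{r-2}\in\mathbb C$, and let $L_0=\partial^r-a_{r-2}\partial^{r-2}-\cdots-a_1\partial-x$, where $\partial=d/dx$. Fix a basis $f_1,\dots,f_r$ of $\ker L_0$ normalized so that $|Wr(f_1,\dots,f_r)|=1$. For a function $f$ of one variable write $\hat f(x,z)=f(x+z)$. $\mathcal S$ denotes the space of finitely supported distributions in the $z$-plane: finite linear combinations of $\delta_\lambda\circ\partial_z^j$, where $\delta_\lambda$ evaluates its argument at $z=\lambda$; applied to a function of $(x,z)$ such a distribution acts in $z$ and yields a function of $x$. $\mathbb D$ is the set of finite-dimensional subspaces $C\subset\mathcal S$ having a basis $c_i=\delta_{\lambda_i}\circ(\partial_z+\gamma_i)$, $i=1,\dots,n$ ($n\ge1$), with $\lambda_i$ pairwise distinct and $\gamma_i\in\mathbb C$; $q_C(z):=\prod_{i=1}^n(z-\lambda_i)$. For $C\in\mathbb D$ put $N=rn$, let $\phi_1,\dots,\phi_N$ be the functions $c_i(\hat f_j)$, and let $\bar K_C$ be the operator $u\mapsto\kappa\,|Wr(\phi_1,\dots,\phi_N,u)|$ with $\kappa$ the nonzero constant making the coefficient of $\partial^N$ a monic polynomial; this coefficient, a monic polynomial of degree $n$, is denoted $\tau_C(x)$.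 $Wr(v_1,\dots,v_m)$ is the matrix with first row $(v_1,\dots,v_m)$ and each subsequent row the derivative of the previous. $\mathbb D_0:=\{C\in\mathbb D:\tau_C\text{ has distinct roots}\}$. $\flat$ is the unique $\mathbb C$-linear anti-automorphism of the Weyl algebra $\mathbb C[x]\langle\partial\rangle$ with $x^\flat=L_0$, $\partial^\flat=\partial$ (equivalently $T(x,\partial_x)\hat f(x,z)=T^\flat(z,\partial_z)\hat f(x,z)$ for all $f\in\ker L_0$). $C^\beta:=\{c\in\mathcal S: c(\hat f)\in\ker\bar K_C^\flat\text{ for all }f\in\ker L_0\}$. *)

(* Defs.v *)
From mathcomp Require Import all_boot all_order all_algebra.
From mathcomp Require Import complex.
From mathcomp Require Import all_classical all_reals all_analysis.
Import numFieldNormedType.Exports.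
Set Implicit Arguments. Unset Strict Implicit. Unset Printing Implicit Defensive.
Import Order.TTheory GRing.Theory Num.Theory.
Local Open Scope ring_scope.
Local Open Scope complex_scope.

Section Bispectral.
Variable R : realType.
Local Notation C := (R[i]).

Definition entire (f : C -> C) : Prop :=
  forall z : C, derivable (f : C^o -> C^o) z 1.

Definition dn (k : nat) (f : C -> C) : C -> C := derive1n k (f : C^o -> C^o).

Definition L0 (r : nat) (a : nat -> C) (u : C -> C) : C -> C :=
  fun x => dn r u x - \sum_(1 <= k < r.-1) a k * dn k u x - x * u x.

Definition kerL0 (r : nat) (a : nat -> C) (f : C -> C) : Prop :=
  entire f /\ forall x, L0 r a f x = 0.

Definition wrmx (m : nat) (v : 'I_m -> C -> C) (x : C) : 'M[C]_m :=
  \matrix_(i < m, j < m) dn i (v j) x.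

Definition wext (m : nat) (v : 'I_m -> C -> C) (u : C -> C) : 'I_m.+1 -> C -> C :=
  fun k => match unlift ord_max k with Some k' => v k' | None => u end.

Definition hat (f : C -> C) : C -> C -> C := fun x z => f (x + z).

(* An element of the space S of finitely supported distributions
   sum_l delta_l o p_l(d_z) is encoded by the map l |-> p_l (a polynomial in d_z);
   it must have finite support. *)
Definition Selt := C -> {poly C}.
Definition suppS (c : Selt) : set C := [set l | c l != 0].
Definition finS (c : Selt) : Prop := finite_set (suppS c).

Definition dapply (c : Selt) (g : C -> C) : C :=
  (\sum_(l \in suppS c) \sum_(j < size (c l)) (c l)`_j * dn j g l)%R.

Definition basicS (l g : C) : Selt :=
  fun mu => if mu == l then 'X + g%:P else 0.

Definition Dspace (n : nat) (lam gam : 'I_n -> C) : set Selt :=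
  [set c | exists al : 'I_n -> C,
     c = fun mu => \sum_(i < n) al i *: basicS (lam i) (gam i) mu].

Definition qCpoly (n : nat) (lam : 'I_n -> C) : {poly C} :=
  \prod_(i < n) ('X - (lam i)%:P).

Definition phiN (r : nat) (fb : 'I_r -> C -> C) (n : nat) (lam gam : 'I_n -> C)
  : 'I_#|{: 'I_n * 'I_r}| -> C -> C :=
  fun k x => let ij := enum_val k in
    dapply (basicS (lam ij.1) (gam ij.1)) (hat (fb ij.2) x).

Definition Kbar (m : nat) (kappa : C) (v : 'I_m -> C -> C) (u : C -> C) : C -> C :=
  fun x => kappa * \det (wrmx (wext v u) x).

(* kappa normalizes the coefficient of d^N (= kappa |Wr(phi)|) to the monic
   polynomial tau *)
Definition is_tau (m : nat) (v : 'I_m -> C -> C) (kappa : C) (tau : {poly C}) : Prop :=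
  kappa != 0 /\ tau \is monic /\ forall x, kappa * \det (wrmx v x) = tau.[x].

Definition distinct_roots (p : {poly C}) : Prop :=
  exists2 s : seq C, uniq s & p = \prod_(x <- s) ('X - x%:P).

(* Weyl algebra elements in normal form  sum_k W_k(x) d^k *)
Definition weyl := seq {poly C}.

Definition wact (W : weyl) (u : C -> C) : C -> C :=
  fun x => \sum_(k < size W) (W`_k).[x] * dn k u x.

Definition polyL0 (r : nat) (a : nat -> C) (p : {poly C}) (u : C -> C) : C -> C :=
  fun x => \sum_(i < size p) p`_i * iter i (L0 r a) u x.

(* action of W^flat: flat is the anti-automorphism with x |-> L0, d |-> d, so
   (sum_k W_k(x) d^k)^flat = sum_k d^k o W_k(L0) *)
Definition wflat_act (r : nat) (a : nat -> C) (W : weyl) (u : C -> C) : C -> C :=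
  fun x => \sum_(k < size W) dn k (polyL0 r a W`_k u) x.

Definition represents (W : weyl) (K : (C -> C) -> (C -> C)) : Prop :=
  forall u, entire u -> wact W u = K u.

Definition Cbeta (r : nat) (a : nat -> C) (fb : 'I_r -> C -> C)
  (n : nat) (lam gam : 'I_n -> C) (kappa : C) : set Selt :=
  [set c | finS c /\ exists W : weyl,
      represents W (Kbar kappa (phiN fb lam gam)) /\
      forall f, kerL0 r a f ->
        wflat_act r a W (fun x => dapply c (hat f x)) = (fun _ => 0)].

Definition inD0 (r : nat) (fb : 'I_r -> C -> C) (D : set Selt) : Prop :=
  exists n (lam gam : 'I_n -> C) (kappa : C) (tau : {poly C}),
    [/\ (0 < n)%N, injective lam, D = Dspace lam gam,
        is_tau (phiN fb lam gam) kappa tau & distinct_roots tau].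

End Bispectral.

(* Main.v *)
Require Import Defs.
From mathcomp Require Import all_boot all_order all_algebra.
From mathcomp Require Import complex.
From mathcomp Require Import all_classical all_reals all_analysis.
From mathcomp Require Import ring lra zify.
From HB Require Import structures.
Import numFieldNormedType.Exports.
Import Order.TTheory GRing.Theory Num.Theory.
Local Open Scope ring_scope.
Local Open Scope complex_scope.
Set Implicit Arguments. Unset Strict Implicit. Unset Printing Implicit Defensive.

(* The two operators are written down explicitly.  With [Lam = diag lam], let [Y] be the
   Calogero-Moser matrix, whose off-diagonal entries are [1 / (lam_i - lam_j)] and whose diagonal
   encodes [gam], let [A(d) = L_0 + x] and [M(x) = x + Lam - A(- Y)].  The vector
   [g = adj (M) 1] and its images [g_b] under polynomials in [Y] give
     T = tau_0(x) q(L_0) - \sum_(j, b) g_(j, b)(x) d^b h_j(L_0),  tau_0 = det M,  h_j = q / (x - lam_j),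
   and [S = T^flat] is obtained by exchanging [x] and [L_0].  The choice of the [g_b] makes every
   functional of [C] annihilate the image of [S], hence [T] kills the functions [c_i (hat f_j)];
   the rank one relation M Y - Y M = 1 1^T - 1 shows that the subleading coefficient of [T] is
   [- tau_0'], and that of [S] is [- q'].  By Abel's formula the Wronskians are then constant
   multiples of [tau_0] and [q], so [T] and [S] are the operators attached to [C] and to the space
   of functionals annihilating the image of [T].  At a simple root of [tau_0] that space is a line
   spanned by some [d + gam'], and elsewhere it is zero, which identifies it with [C^beta].

   The functions are only assumed complex differentiable once, so that their derivatives exist to
   all orders has to be proved: Goursat's theorem on triangles provides primitives, and Cauchy's
   formula on a square applied to a primitive provides three further derivatives. *)

(** * Integrals along segments *)

(** The determinant defining Kbar_C has entire coefficients, of which only the leading one is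
    assumed to be polynomial, while flat makes sense only for polynomial coefficients; hence T is
    built first and compared with the determinant afterwards. Its shape is dictated by flat: since
    L_0^flat = x, flat sends g(x) d^b h(L_0) to h(x) d^b g(L_0), so the ansatz is stable. As b < r
    and deg h_j = n - 1, the correction terms have order below r n. The matrix Y records what
    becomes of delta_(lam_i) o (d + gam_i) when it is composed with h_j, and the g_b are the
    coefficients of the quotient of A(d) - A(- Y) by d + Y, applied to g.

    Abel's formula alone would allow the second Wronskian to vanish identically; this is excluded by
    the independence of the functions c_i (hat f_j), which is seen on jets at a single point.
    Distinct roots enter twice: a solution of t' E = t E' is a multiple of t because one linear
    factor after another can be divided out, and at a root of tau the derivative of the Wronskian is
    nonzero, which leaves exactly one value of gam'. *)

Lemma is_derive_epsP (K : numFieldType) (f : K -> K) (x l : K) :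
  is_derive x (1 : K^o) (f : K^o -> K^o) l <->
  forall e : K, 0 < e -> exists2 d : K, 0 < d &
    forall h, `|h| < d -> `|f (x + h) - f x - h * l| <= e * `|h|.
Proof.
pose q (h : K^o) : K^o := h^-1 *: (f (h *: (1 : K^o) + x) - f x).
have qE h : h != 0 -> `|f (x + h) - f x - h * l| = `|l - q h| * `|h|.
  move=> h0; rewrite -normrM distrC; congr (`|_|).
  rewrite /q /GRing.scale/= mulr1 mulrBl [h^-1 * _]mulrC mulfVK// (addrC h x).
  by rewrite mulrC opprD opprK [RHS]addrC; ring.
split=> [[dv dl] e e0|H].
  have : (q h @[h --> (0 : K^o)^'] --> (l : K^o))%classic.
    by have := dv; rewrite /derivable => /cvg_lim; rewrite -dl; exact.
  move=> /cvgrPdist_le /(_ _ e0).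
  move=> /nbhs_ballP[d /= d0 hd]; exists d => // h hh.
  have [->|h0] := eqVneq h 0; first by rewrite addr0 subrr mul0r subrr normr0 mulr0.
  rewrite qE// ler_wpM2r//; apply: hd => //.
  by rewrite /ball/= sub0r normrN.
have : (q h @[h --> (0 : K^o)^'] --> (l : K^o))%classic.
  apply/cvgrPdist_le => e e0; have [d d0 hd] := H e e0.
  apply/nbhs_ballP; exists d => // h /=.
  rewrite /ball/= sub0r normrN => hh h0.
  have hp : 0 < `|h| by rewrite normr_gt0.
  by rewrite -(ler_pM2r hp) -qE//; exact: hd.
by move=> ql; split; [apply/cvg_ex; exists l | apply: cvg_lim].
Qed.

Section ComplexAnalysis.
Variable R : realType.
Local Notation C := (R[i]).
Local Notation Re := (@complex.Re _).
Local Notation Im := (@complex.Im _).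
Implicit Types (z w : C) (e d t : R).

Definition cnorm (z : C) : R := Normc.normc z.

Lemma normE z : `|z| = (cnorm z)%:C.
Proof. by case: z. Qed.

Lemma cnorm_ge0 z : 0 <= cnorm z.
Proof. by case: z => a b; rewrite /cnorm/= sqrtr_ge0. Qed.
#[local] Hint Extern 0 (is_true (_ <= cnorm _)) => solve [apply: cnorm_ge0] : core.

Lemma cnorm0 : cnorm 0 = 0. Proof. exact: Normc.normc0. Qed.
Lemma cnorm1 : cnorm 1 = 1. Proof. exact: Normc.normc1. Qed.
Lemma cnormM z w : cnorm (z * w) = cnorm z * cnorm w. Proof. exact: Normc.normcM. Qed.
Lemma cnormV z : cnorm z^-1 = (cnorm z)^-1. Proof. exact: Normc.normcV. Qed.
Lemma cnormD z w : cnorm (z + w) <= cnorm z + cnorm w. Proof. exact: le_normcD. Qed.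
Lemma cnormN z : cnorm (- z) = cnorm z. Proof. by case: z => a b; rewrite /cnorm/= !sqrrN. Qed.
Lemma cnormB z w : cnorm (z - w) <= cnorm z + cnorm w. Proof. by rewrite -(cnormN w); exact: cnormD. Qed.
Lemma cnorm_distC z w : cnorm (z - w) = cnorm (w - z). Proof. by rewrite -cnormN opprB. Qed.
Lemma cnorm_triangle z w v : cnorm (z - v) <= cnorm (z - w) + cnorm (w - v).
Proof. by rewrite (_ : z - v = (z - w) + (w - v)) ?cnormD//; ring. Qed.
Lemma cnorm_eq0 z : cnorm z = 0 -> z = 0. Proof. exact: Normc.eq0_normc. Qed.
Lemma cnorm_gt0 z : z != 0 -> 0 < cnorm z.
Proof. by move=> z0; rewrite lt_neqAle cnorm_ge0 andbT eq_sym; apply: contra z0 => /eqP/cnorm_eq0->. Qed.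

Lemma cnorm_real t : cnorm (t%:C) = `|t|.
Proof. by rewrite /cnorm/= expr0n/= addr0 sqrtr_sqr. Qed.

Lemma cnorm_ge_Re z : `|Re z| <= cnorm z.
Proof. by have := normc_ge_Re z; rewrite normE lecR. Qed.

Lemma cnorm_ge_Im z : `|Im z| <= cnorm z.
Proof.
case: z => a b /=; rewrite /cnorm/= -(sqrtr_sqr b) ler_wsqrtr//.
by rewrite lerDr sqr_ge0.
Qed.

Lemma cnorm_le z : cnorm z <= `|Re z| + `|Im z|.
Proof.
case: z => a b; have := cnormD (a%:C) (0 +i* b); rewrite cnorm_real.
have -> : cnorm (0 +i* b) = `|b| by rewrite /cnorm/= expr0n/= add0r sqrtr_sqr.
by simpc.
Qed.

Lemma ReB z w : Re (z - w) = Re z - Re w. Proof. by case: z; case: w. Qed.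
Lemma ImB z w : Im (z - w) = Im z - Im w. Proof. by case: z; case: w. Qed.
Lemma ReZ t z : Re (t%:C * z) = t * Re z. Proof. by case: z => a b /=; ring. Qed.
Lemma ImZ t z : Im (t%:C * z) = t * Im z. Proof. by case: z => a b /=; ring. Qed.

(** Errors are measured by the real number [cnorm], so that estimates take place in the totally
    ordered field [R] and not in the partial order of [C]. *)
Definition cdiff (F : C -> C) z (l : C) :=
  forall e, 0 < e -> exists2 d, 0 < d &
    forall h : C, cnorm h < d -> cnorm (F (z + h) - F z - h * l) <= e * cnorm h.

Definition rdiff (G : R -> C) t (l : C) :=
  forall e, 0 < e -> exists2 d, 0 < d &
    forall h : R, `|h| < d -> cnorm (G (t + h) - G t - h%:C * l) <= e * `|h|.

Lemma cdiffP (F : C -> C) z l :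
  is_derive (z : C^o) (1 : C^o) (F : C^o -> C^o) l <-> cdiff F z l.
Proof.
rewrite is_derive_epsP; split=> H e e0.
  have [|d d0 hd] := H e%:C; first by rewrite ltcR.
  have dE : d = (Re d)%:C by rewrite RRe_real// gtr0_real.
  rewrite dE ltcR in d0; exists (Re d) => // h hh.
  by have := hd h; rewrite dE !normE -rmorphM/= ltcR lecR; exact.
have eE : e = (Re e)%:C by rewrite RRe_real// gtr0_real.
have [|d d0 hd] := H (Re e); first by move: e0; rewrite eE ltcR.
exists d%:C; first by rewrite ltcR.
by move=> h; rewrite eE !normE -rmorphM/= ltcR lecR; exact: hd.
Qed.

Lemma rdiff_Re (G : R -> C) t l : rdiff G t l ->
  is_derive t (1 : R^o) (fun s => Re (G s) : R^o) (Re l).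
Proof.
move=> H; apply/is_derive_epsP => e e0; have [d d0 hd] := H e e0.
exists d => // h /hd; apply: le_trans.
by apply: le_trans (cnorm_ge_Re _); rewrite !ReB ReZ.
Qed.

Lemma rdiff_Im (G : R -> C) t l : rdiff G t l ->
  is_derive t (1 : R^o) (fun s => Im (G s) : R^o) (Im l).
Proof.
move=> H; apply/is_derive_epsP => e e0; have [d d0 hd] := H e e0.
exists d => // h /hd; apply: le_trans.
by apply: le_trans (cnorm_ge_Im _); rewrite !ImB ImZ.
Qed.

Lemma rdiff_comp (g1 g2 : R -> R) t (l1 l2 : R) :
  is_derive t (1 : R^o) (g1 : R^o -> R^o) l1 -> is_derive t (1 : R^o) (g2 : R^o -> R^o) l2 ->
  rdiff (fun s => g1 s +i* g2 s) t (l1 +i* l2).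
Proof.
move=> /is_derive_epsP H1 /is_derive_epsP H2 e e0.
have e20 : 0 < e / 2 by lra.
have [d1 d10 h1] := H1 _ e20; have [d2 d20 h2] := H2 _ e20.
exists (Num.min d1 d2); first by rewrite lt_min d10.
move=> h; rewrite lt_min => /andP[/h1 k1 /h2 k2].
apply: (le_trans (cnorm_le _)); rewrite !ReB !ImB ReZ ImZ /=; lra.
Qed.

Lemma rdiffD (G H : R -> C) t l m : rdiff G t l -> rdiff H t m ->
  rdiff (fun s => G s + H s) t (l + m).
Proof.
move=> H1 H2 e e0; have e20 : 0 < e / 2 by lra.
have [d1 d10 h1] := H1 _ e20; have [d2 d20 h2] := H2 _ e20.
exists (Num.min d1 d2); first by rewrite lt_min d10.
move=> h; rewrite lt_min => /andP[/h1 k1 /h2 k2].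
have -> : G (t + h) + H (t + h) - (G t + H t) - h%:C * (l + m) =
  (G (t + h) - G t - h%:C * l) + (H (t + h) - H t - h%:C * m) by ring.
apply: (le_trans (cnormD _ _)); lra.
Qed.

Lemma rdiffZ (G : R -> C) t l c : rdiff G t l -> rdiff (fun s => c * G s) t (c * l).
Proof.
move=> H e e0; have c0 := cnorm_ge0 c.
have [d d0 hd] := H (e / (cnorm c + 1)) (divr_gt0 e0 (ltr_wpDl c0 ltr01)).
exists d => // h /hd k.
have -> : c * G (t + h) - c * G t - h%:C * (c * l) = c * (G (t + h) - G t - h%:C * l) by ring.
rewrite cnormM; apply: (le_trans (ler_wpM2l c0 k)).
rewrite !mulrA ler_wpM2r// ler_pdivrMr; last by lra.
by rewrite mulrDr mulr1 mulrC lerDl ltW.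
Qed.

Lemma rdiff_aff (G : R -> C) (al be t : R) l : rdiff G (al + be * t) l ->
  rdiff (fun s => G (al + be * s)) t (be%:C * l).
Proof.
move=> H e e0; have c0 := normr_ge0 be.
have b1 : 0 < `|be| + 1 by lra.
have [d d0 hd] := H (e / (`|be| + 1)) (divr_gt0 e0 b1).
exists (d / (`|be| + 1)); first exact: divr_gt0.
move=> h; rewrite ltr_pdivlMr// => hh.
have h0 := normr_ge0 h.
have : `|be * h| < d by rewrite normrM; apply: le_lt_trans hh; nra.
move=> /hd; rewrite -[al + _ + _]addrA -mulrDr.
have -> : h%:C * (be%:C * l) = (be * h)%:C * l by rewrite rmorphM/=; ring.
move=> /le_trans; apply; rewrite normrM mulrA ler_wpM2r// mulrAC ler_pdivrMr//.
by rewrite mulrDr mulr1 lerDl ltW.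
Qed.

Lemma rdiff_line (F : C -> C) (a b : C) t l : cdiff F (a + t%:C * b) l ->
  rdiff (fun s => F (a + s%:C * b)) t (b * l).
Proof.
move=> H e e0; have c0 := cnorm_ge0 b.
have b1 : 0 < cnorm b + 1 by lra.
have [d d0 hd] := H (e / (cnorm b + 1)) (divr_gt0 e0 b1).
exists (d / (cnorm b + 1)); first exact: divr_gt0.
move=> h; rewrite ltr_pdivlMr// => hh.
have h0 := normr_ge0 h.
have hE : cnorm (h%:C * b) = `|h| * cnorm b by rewrite cnormM cnorm_real.
have : cnorm (h%:C * b) < d by rewrite hE; apply: le_lt_trans hh; nra.
move=> /hd; rewrite hE -[a + _ + _]addrA -mulrDl -rmorphD/= [h%:C * (b * l)]mulrA.
move=> /le_trans; apply; rewrite [_ * cnorm b]mulrC mulrA ler_wpM2r// mulrAC ler_pdivrMr//.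
by rewrite mulrDr mulr1 lerDl ltW.
Qed.

Lemma is_derive_cont (f : R -> R) t l : is_derive t (1 : R^o) (f : R^o -> R^o) l ->
  (continuous_at (t : R^o) (f : R^o -> R^o))%classic.
Proof.
by move=> [dv _]; apply: differentiable_continuous; apply/derivable1_diffP.
Qed.

Lemma MVT01 (f df : R -> R) :
  (forall t, 0 <= t <= 1 -> is_derive t (1 : R^o) (f : R^o -> R^o) (df t)) ->
  exists2 t, 0 <= t <= 1 & f 1 - f 0 = df t.
Proof.
move=> H; have [||c c01 E] := @MVT_segment R f df 0 1 ler01.
- by move=> x; rewrite in_itv/= => /andP[/ltW a /ltW b]; apply: H; rewrite a b.
- apply: continuous_in_subspaceT => x; rewrite inE/= in_itv/= => x01.
  exact: is_derive_cont (H x x01).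
by exists c; [move: c01; rewrite in_itv | rewrite E subr0 mulr1].
Qed.

(** The mean value theorem gives different points for the real and the imaginary part, whence the
    factor 2. All later constants inherit it; their size is irrelevant. *)
Lemma rdiff_bound (G g : R -> C) M :
  (forall t, 0 <= t <= 1 -> rdiff G t (g t)) ->
  (forall t, 0 <= t <= 1 -> cnorm (g t) <= M) -> cnorm (G 1 - G 0) <= 2 * M.
Proof.
move=> H HM.
have [t1 t101 E1] := @MVT01 (Re \o G) (Re \o g) (fun t tt => rdiff_Re (H t tt)).
have [t2 t201 E2] := @MVT01 (Im \o G) (Im \o g) (fun t tt => rdiff_Im (H t tt)).
apply: (le_trans (cnorm_le _)); move: E1 E2; rewrite /= ReB ImB => -> ->.
have := HM _ t101; have := HM _ t201; have := cnorm_ge_Re (g t1); have := cnorm_ge_Im (g t2); lra.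
Qed.

(* The interval ]-1, 2[ is mapped into itself by [t / 2], [(1 + t) / 2] and [1 - t]. *)
Definition is_int01 (g : R -> C) (v : C) := exists2 G : R -> C,
  (forall t, -1 < t < 2 -> rdiff G t (g t)) & v = G 1 - G 0.

Lemma is_int01_bound g v M : is_int01 g v -> (forall t, 0 <= t <= 1 -> cnorm (g t) <= M) -> cnorm v <= 2 * M.
Proof.
move=> [G HG ->] HM; apply: rdiff_bound HM => t /andP[a b]; apply: HG; lra.
Qed.

Lemma is_int01D g h v w : is_int01 g v -> is_int01 h w -> is_int01 (fun t => g t + h t) (v + w).
Proof.
move=> [G HG ->] [H HH ->]; exists (fun t => G t + H t); last by ring.
by move=> t tt; apply: rdiffD; [exact: HG|exact: HH].
Qed.

Lemma is_int01Z g v c : is_int01 g v -> is_int01 (fun t => c * g t) (c * v).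
Proof.
move=> [G HG ->]; exists (fun t => c * G t); last by ring.
by move=> t tt; apply: rdiffZ; exact: HG.
Qed.

Lemma is_int01B g h v w : is_int01 g v -> is_int01 h w -> is_int01 (fun t => g t - h t) (v - w).
Proof.
move=> hv /(is_int01Z (-1)) hw; have := is_int01D hv hw; rewrite mulN1r.
by under eq_fun do rewrite mulN1r.
Qed.

Lemma is_int01_uniq g v w : is_int01 g v -> is_int01 g w -> v = w.
Proof.
move=> hv hw; apply/eqP; rewrite -subr_eq0; apply/eqP; apply: cnorm_eq0.
apply/eqP; rewrite eq_le cnorm_ge0 andbT.
have := is_int01_bound (M := 0) (is_int01B hv hw); rewrite mulr0; apply=> t _.
by rewrite subrr cnorm0.
Qed.

Lemma is_int01_rev g v : is_int01 g v -> is_int01 (fun t => g (1 + (-1) * t)) v.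
Proof.
move=> [G HG ->]; exists (fun t => -1 * G (1 + (-1) * t)).
  move=> t tt; have -> : g (1 + (-1) * t) = -1 * ((-1)%:C * g (1 + (-1) * t)).
    by rewrite rmorphN1 !mulrA mulrNN mulr1 mul1r.
  by apply: rdiffZ; apply: rdiff_aff; apply: HG; lra.
rewrite !mulr1 mulr0 addr0 subrr; ring.
Qed.

Lemma is_int01_half g v1 v2 : is_int01 (fun t => g (0 + 2^-1 * t)) v1 ->
  is_int01 (fun t => g (2^-1 + 2^-1 * t)) v2 -> forall v, is_int01 g v -> v = 2^-1 * (v1 + v2).
Proof.
move=> h1 h2 v [G HG ->].
have k1 : is_int01 (fun t => g (0 + 2^-1 * t)) (2 * (G 2^-1 - G 0)).
  exists (fun t => 2 * G (0 + 2^-1 * t)); last by rewrite mulr1 mulr0 !add0r; ring.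
  move=> t tt; have -> : g (0 + 2^-1 * t) = 2 * ((2^-1)%:C * g (0 + 2^-1 * t)).
    by rewrite mulrA fmorphV/= rmorph_nat divff ?mul1r ?pnatr_eq0.
  by apply: rdiffZ; apply: rdiff_aff; apply: HG; lra.
have k2 : is_int01 (fun t => g (2^-1 + 2^-1 * t)) (2 * (G 1 - G 2^-1)).
  exists (fun t => 2 * G (2^-1 + 2^-1 * t)).
    move=> t tt; have -> : g (2^-1 + 2^-1 * t) = 2 * ((2^-1)%:C * g (2^-1 + 2^-1 * t)).
      by rewrite mulrA fmorphV/= rmorph_nat divff ?mul1r ?pnatr_eq0.
    by apply: rdiffZ; apply: rdiff_aff; apply: HG; lra.
  have -> : 2^-1 + 2^-1 * 1 = 1 :> R by lra.
  by rewrite mulr0 addr0; ring.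
rewrite (is_int01_uniq h1 k1) (is_int01_uniq h2 k2) -mulrDr mulrA mulVf ?pnatr_eq0// mul1r.
by ring.
Qed.

Definition rcont (g : R -> C) := forall t e, 0 < e -> exists2 d, 0 < d &
  forall h : R, `|h| < d -> cnorm (g (t + h) - g t) <= e.

(** The integral is handled through primitives throughout; Lebesgue integration, started at -1 so
    that [0, 1] is interior, serves only to produce one. *)
Lemma is_int01_ex g : rcont g -> exists v, is_int01 g v.
Proof.
move=> cg.
have prim (f : R -> R) : continuous (f : R^o -> R^o) ->
    exists F : R -> R, forall t, -1 < t < 2 -> is_derive t (1 : R^o) (F : R^o -> R^o) (f t).
  move=> cf; exists (fun x => \int[lebesgue_measure]_(t in `[-1, x]) f t)%R.
  move=> t /andP[t1 t2]; have [|||dv E] := @continuous_FTC1 R f (BLeft (-1)) t 2 t2.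
  - apply: continuous_compact_integrable; first exact: segment_compact.
    exact: continuous_subspaceT.
  - by rewrite /Order.lt/=.
  - exact: cf.
  by split=> //; rewrite -derive1E.
have cRe : continuous ((fun t => Re (g t)) : R^o -> R^o).
  move=> t; apply/cvgrPdist_le => e e0; have [d d0 hd] := cg t e e0.
  apply/nbhs_ballP; exists d => // s /=; rewrite /ball/= => hs.
  have := hd (s - t); rewrite [t + _]addrC subrK distrC => /(_ hs); apply: le_trans.
  by rewrite cnorm_distC -ReB; exact: cnorm_ge_Re.
have cIm : continuous ((fun t => Im (g t)) : R^o -> R^o).
  move=> t; apply/cvgrPdist_le => e e0; have [d d0 hd] := cg t e e0.
  apply/nbhs_ballP; exists d => // s /=; rewrite /ball/= => hs.
  have := hd (s - t); rewrite [t + _]addrC subrK distrC => /(_ hs); apply: le_trans.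
  by rewrite cnorm_distC -ImB; exact: cnorm_ge_Im.
have [F1 H1] := prim _ cRe; have [F2 H2] := prim _ cIm.
exists ((F1 1 +i* F2 1) - (F1 0 +i* F2 0)); exists (fun s => F1 s +i* F2 s) => // t tt.
by have := rdiff_comp (H1 t tt) (H2 t tt); case: (g t).
Qed.

Definition int01 (g : R -> C) : C := xget 0 [set v | is_int01 g v].

Lemma int01E g v : is_int01 g v -> int01 g = v.
Proof. by move=> hv; apply: (is_int01_uniq (g := g)) => //; exact: (xgetPex 0 (ex_intro (fun v => is_int01 g v) v hv)). Qed.

Lemma int01P g : rcont g -> is_int01 g (int01 g).
Proof. by move=> /is_int01_ex[v hv]; rewrite (int01E hv). Qed.

End ComplexAnalysis.

(** * Goursat's theorem *)

Section Goursat.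
Variable R : realType.
Local Notation C := (R[i]).
Local Notation Re := (@complex.Re _).
Local Notation Im := (@complex.Im _).
Implicit Types (z w a b c : C) (e d t : R).
#[local] Hint Extern 0 (is_true (_ <= cnorm _)) => solve [apply: cnorm_ge0] : core.

Definition ccont (f : C -> C) := forall z e, 0 < e -> exists2 d, 0 < d &
  forall h, cnorm h < d -> cnorm (f (z + h) - f z) <= e.

Lemma cdiff_cont (f : C -> C) z l : cdiff f z l -> forall e, 0 < e -> exists2 d, 0 < d &
  forall h, cnorm h < d -> cnorm (f (z + h) - f z) <= e.
Proof.
move=> H e e0; have [d d0 hd] := H 1 ltr01.
have l0 := cnorm_ge0 l; have l1 : 0 < cnorm l + 1 by lra.
exists (Num.min d (e / (cnorm l + 1))); first by rewrite lt_min d0 divr_gt0.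
move=> h; rewrite lt_min ltr_pdivlMr// => /andP[/hd k1 k2].
have -> : f (z + h) - f z = (f (z + h) - f z - h * l) + h * l by ring.
apply: (le_trans (cnormD _ _)); rewrite cnormM; have := cnorm_ge0 h; lra.
Qed.

Definition line a b (t : R) : C := a + t%:C * (b - a).

Lemma ccont_line (f : C -> C) a b : ccont f -> rcont (fun t => f (line a b t)).
Proof.
move=> cf t e e0; have [d d0 hd] := cf (line a b t) e e0.
have c0 := cnorm_ge0 (b - a); have b1 : 0 < cnorm (b - a) + 1 by lra.
exists (d / (cnorm (b - a) + 1)); first exact: divr_gt0.
move=> h; rewrite ltr_pdivlMr// => hh; have h0 := normr_ge0 h.
have := hd (h%:C * (b - a)); rewrite cnormM cnorm_real /line rmorphD/= mulrDl addrA; apply.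
by apply: le_lt_trans hh; nra.
Qed.

Definition segint (f : C -> C) a b := (b - a) * int01 (fun t => f (line a b t)).

Lemma segint_prim (F f : C -> C) a b :
  (forall t, -1 < t < 2 -> cdiff F (line a b t) (f (line a b t))) ->
  a != b -> segint f a b = F b - F a.
Proof.
move=> HF ab; have ba : b - a != 0 by rewrite subr_eq0 eq_sym.
have h : is_int01 (fun t => f (line a b t)) ((b - a)^-1 * (F b - F a)).
  exists (fun t => (b - a)^-1 * F (line a b t)).
    move=> t tt; rewrite -[X in rdiff _ _ X](mulKf ba); apply: rdiffZ.
    exact: (rdiff_line (HF t tt)).
  by rewrite /line mul1r mul0r addr0 [a + _]addrC subrK; ring.
by rewrite /segint (int01E h) mulrA mulfV ?mul1r.
Qed.

Lemma segint_FTC (F f : C -> C) a b : (forall z, cdiff F z (f z)) -> segint f a b = F b - F a.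
Proof.
move=> H; have [->|] := eqVneq a b; first by rewrite /segint !subrr mul0r.
by apply: segint_prim => t _.
Qed.

Lemma segint_rev f a b : ccont f -> segint f b a = - segint f a b.
Proof.
move=> cf; rewrite /segint -mulNr opprB; congr (_ * _).
have h := is_int01_rev (int01P (ccont_line (a) (b) cf)).
rewrite -(int01E h); congr (int01 _); apply/funext => t.
by rewrite /line !(rmorphD, rmorphM, rmorphN, rmorph1)/=; congr (f _); ring.
Qed.

Lemma segint_mid f a b : ccont f -> segint f a b = segint f a ((a + b) / 2) + segint f ((a + b) / 2) b.
Proof.
move=> cf; have i2 : (2^-1 : C) + 2^-1 = 1 by field.
have h := int01P (ccont_line (a) (b) cf).
have h1 := int01P (ccont_line (a) ((a + b) / 2) cf).
have h2 := int01P (ccont_line ((a + b) / 2) (b) cf).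
have E1 : (fun t => f (line a ((a + b) / 2) t)) = (fun t => f (line a b (0 + 2^-1 * t))).
  apply/funext => t; rewrite /line !(rmorphD, rmorphM, rmorph0, fmorphV, rmorph_nat)/=.
  by congr (f _); field.
have E2 : (fun t => f (line ((a + b) / 2) b t)) = (fun t => f (line a b (2^-1 + 2^-1 * t))).
  apply/funext => t; rewrite /line !(rmorphD, rmorphM, rmorph0, fmorphV, rmorph_nat)/=.
  by congr (f _); field.
move: h1 h2; rewrite {1}E1 {1}E2 => h1 h2.
by rewrite /segint (is_int01_half h1 h2 h); field.
Qed.

Lemma segint_bound f a b M : rcont (fun t => f (line a b t)) ->
  (forall t, 0 <= t <= 1 -> cnorm (f (line a b t)) <= M) ->
  cnorm (segint f a b) <= 2 * M * cnorm (b - a).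
Proof.
move=> cf HM; rewrite /segint cnormM mulrC ler_wpM2r//.
exact: is_int01_bound (int01P cf) HM.
Qed.

Lemma segintB f g a b : rcont (fun t => f (line a b t)) -> rcont (fun t => g (line a b t)) ->
  segint (fun z => f z - g z) a b = segint f a b - segint g a b.
Proof.
by move=> cf cg; rewrite /segint (int01E (is_int01B (int01P cf) (int01P cg))) mulrBr.
Qed.

Lemma rcontB (g h : R -> C) : rcont g -> rcont h -> rcont (fun t => g t - h t).
Proof.
move=> cg ch t e e0; have e20 : 0 < e / 2 by lra.
have [d1 d10 h1] := cg t _ e20; have [d2 d20 h2] := ch t _ e20.
exists (Num.min d1 d2); first by rewrite lt_min d10.
move=> s; rewrite lt_min => /andP[/h1 k1 /h2 k2].
have -> : g (t + s) - h (t + s) - (g t - h t) = (g (t + s) - g t) - (h (t + s) - h t) by ring.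
by apply: (le_trans (cnormB _ _)); lra.
Qed.

Lemma cdiff_quad (al be p z : C) :
  cdiff (fun w => al * w + be * (w - p) ^+ 2) z (al + 2 * be * (z - p)).
Proof.
move=> e e0; have c0 := cnorm_ge0 be; have b1 : 0 < cnorm be + 1 by lra.
exists (e / (cnorm be + 1)); first exact: divr_gt0.
move=> h; rewrite ltr_pdivlMr// => hh; have h0 := cnorm_ge0 h.
rewrite [X in cnorm X](_ : _ = be * h * h); last by ring.
by rewrite !cnormM ler_wpM2r//; nra.
Qed.

Lemma ccont_aff (al be p : C) : ccont (fun w => al + be * (w - p)).
Proof.
move=> z e e0; have c0 := cnorm_ge0 be; have b1 : 0 < cnorm be + 1 by lra.
exists (e / (cnorm be + 1)); first exact: divr_gt0.
move=> h; rewrite ltr_pdivlMr// => hh; have h0 := cnorm_ge0 h.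
rewrite [X in cnorm X](_ : _ = be * h); last by ring.
by rewrite !cnormM; nra.
Qed.

Let perim (T : C * C * C) := cnorm (T.1.2 - T.1.1) + cnorm (T.2 - T.1.2) + cnorm (T.1.1 - T.2).
Definition triint f (T : C * C * C) := segint f T.1.1 T.1.2 + segint f T.1.2 T.2 + segint f T.2 T.1.1.

Let cnorm_half : cnorm (2^-1 : C) = 2^-1.
Proof. by rewrite cnormV -(rmorph_nat (real_complex R)) cnorm_real ger0_norm. Qed.

(** The last clause controls the first vertex: together with the halving of the perimeters it makes
    these vertices converge to the point where differentiability is used. *)
Lemma goursat_step f (T : C * C * C) : ccont f -> exists T',
  [/\ perim T' = perim T / 2, cnorm (triint f T) <= 4 * cnorm (triint f T') & cnorm (T'.1.1 - T.1.1) <= perim T].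
Proof.
case: T => [[a b] c] cf.
set mab := (a + b) / 2; set mbc := (b + c) / 2; set mca := (c + a) / 2.
have i2 : (2^-1 : C) + 2^-1 = 1 by field.
have E : triint f (a, b, c) = triint f (a, mab, mca) + triint f (b, mbc, mab) + triint f (c, mca, mbc)
   + triint f (mab, mbc, mca).
  rewrite /triint /= (segint_mid _ _ cf) -/mab (segint_mid b c cf) -/mbc (segint_mid c a cf) -/mca.
  rewrite (segint_rev mab mbc cf) (segint_rev mbc mca cf) (segint_rev mca mab cf) ; ring.
have Nhalf (x y z w : C) : x - y = (z - w) * 2^-1 -> cnorm (x - y) = cnorm (z - w) * 2^-1.
  by move=> ->; rewrite cnormM cnorm_half.
have Nab := cnorm_ge0 (b - a); have Nbc := cnorm_ge0 (c - b); have Nca := cnorm_ge0 (a - c).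
have Ne4 : cnorm (triint f (a, b, c)) <= cnorm (triint f (a, mab, mca)) + cnorm (triint f (b, mbc, mab)) +
   cnorm (triint f (c, mca, mbc)) + cnorm (triint f (mab, mbc, mca)).
  rewrite E; do 3! (apply: (le_trans (cnormD _ _)); rewrite lerD2r); exact: lexx.
have [h1|h1] := leP (cnorm (triint f (a, b, c))) (4 * cnorm (triint f (a, mab, mca))).
  exists (a, mab, mca); rewrite /perim/=; split=> //.
    rewrite (Nhalf mab a b a) 1?(Nhalf mca mab c b) 1?(Nhalf a mca a c) /mab /mbc /mca; 
      [lra|by field..].
  by rewrite subrr cnorm0; lra.
have [h2|h2] := leP (cnorm (triint f (a, b, c))) (4 * cnorm (triint f (b, mbc, mab))).
  exists (b, mbc, mab); rewrite /perim/=; split=> //; last lra.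
  rewrite (Nhalf mbc b c b) 1?(Nhalf mab mbc a c) 1?(Nhalf b mab b a) /mab /mbc /mca; 
      [lra|by field..].
have [h3|h3] := leP (cnorm (triint f (a, b, c))) (4 * cnorm (triint f (c, mca, mbc))).
  exists (c, mca, mbc); rewrite /perim/=; split=> //; last by rewrite (cnorm_distC c a); lra.
  rewrite (Nhalf mca c a c) 1?(Nhalf mbc mca b a) 1?(Nhalf c mbc c b) /mab /mbc /mca; 
      [lra|by field..].
(* Each corner triangle now carries less than a quarter of the integral, so the medial one carries
   more than a quarter. *)
exists (mab, mbc, mca); rewrite /perim/=; split; last 1 first.
- by rewrite (Nhalf mab a b a) /mab; [lra|by field].
- rewrite (Nhalf mbc mab c a) 1?(Nhalf mca mbc a b) 1?(Nhalf mab mca b c) /mab /mbc /mca; 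
      [rewrite (cnorm_distC c a) (cnorm_distC a b) (cnorm_distC b c); lra|by field..].
- lra.
Qed.

(** The intervals of radius 2 del_n around u_n are nested, because a step of length del_n is exactly
    what the halved radius gives up. The limit is the supremum of their left ends. *)
Lemma nested_limit (u : nat -> R) (del : nat -> R) :
  (forall n, `|u n.+1 - u n| <= del n) -> (forall n, del n.+1 = del n / 2) ->
  exists p, forall n, `|u n - p| <= 2 * del n.
Proof.
move=> Hu Hd.
have d0 n : 0 <= del n by apply: le_trans (Hu n).
have mono n m : (n <= m)%N -> u n - 2 * del n <= u m - 2 * del m
                              /\ u m + 2 * del m <= u n + 2 * del n.
  elim: m => [|m IH]; first by rewrite leqn0 => /eqP->.
  rewrite leq_eqVlt => /predU1P[->|/IH[h1 h2]]; first by [].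
  have := Hu m; rewrite ler_norml Hd => /andP[k1 k2]; lra.
have HS n m : u n - 2 * del n <= u m + 2 * del m.
  have [nm|mn] := leqP n m.
    have [h1 h2] := mono _ _ nm; have := d0 m; lra.
  have [h1 h2] := mono _ _ (ltnW mn); have := d0 n; lra.
pose S := [set x | exists n, x = u n - 2 * del n]%classic.
have Sup : has_sup S.
  split; first by exists (u 0 - 2 * del 0), 0%N.
  by exists (u 0 + 2 * del 0) => x [n ->]; exact: HS.
exists (sup S) => n; rewrite ler_norml; apply/andP; split.
  have : sup S <= u n + 2 * del n by apply: sup_le_ub; [case: Sup|move=> x [m ->]; exact: HS].
  lra.
have : u n - 2 * del n <= sup S by apply: ub_le_sup; [case: Sup|exists n].
lra.
Qed.

Lemma goursat f : (forall z, exists l, cdiff f z l) -> forall T, triint f T = 0.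
Proof.
move=> df T0.
have cf : ccont f by move=> z e e0; have [l hl] := df z; exact: cdiff_cont hl e e0.
have [nx Hnx] := choice (fun T => goursat_step T cf).
pose s n := iter n nx T0.
have sP n : perim (s n.+1) = perim (s n) / 2 by have [] := Hnx (s n).
have sD n : cnorm (triint f T0) <= 4 ^+ n * cnorm (triint f (s n)).
  elim: n => [|n IH]; first by rewrite mul1r.
  have [_ h _] := Hnx (s n); apply: (le_trans IH).
  by rewrite exprSr -mulrA ler_wpM2l// exprn_ge0.
have sA n : cnorm ((s n.+1).1.1 - (s n).1.1) <= perim (s n) by have [] := Hnx (s n).
have sPE n : perim (s n) = perim T0 / 2 ^+ n.
  elim: n => [|n IH]; first by rewrite expr0 divr1.
  by rewrite sP IH exprSr invfM mulrA.
have [p1 H1] := @nested_limit (fun n => Re (s n).1.1) (fun n => perim (s n))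
  (fun n => le_trans (le_trans (eq_ind _ (fun x => `|x| <= _) (cnorm_ge_Re _) _ (ReB _ _)) (lexx _)) (sA n)) sP.
have [p2 H2] := @nested_limit (fun n => Im (s n).1.1) (fun n => perim (s n))
  (fun n => le_trans (le_trans (eq_ind _ (fun x => `|x| <= _) (cnorm_ge_Im _) _ (ImB _ _)) (lexx _)) (sA n)) sP.
pose p := p1 +i* p2.
have Hp n : cnorm ((s n).1.1 - p) <= 4 * perim (s n).
  apply: (le_trans (cnorm_le _)); rewrite ReB ImB /=; have := H1 n; have := H2 n; lra.
have P0 (T : (C * C * C)%type) : 0 <= perim T by rewrite /perim !addr_ge0.
apply: cnorm_eq0; apply/eqP; rewrite eq_le cnorm_ge0 andbT leNgt; apply/negP => eta0.
have [l hl] := df p.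
set eta := cnorm (triint f T0) in eta0.
(* The argument ends with eta <= 12 e perim^2, which this choice contradicts; the added 1 covers a
   triangle of perimeter zero. *)
pose e := eta / (12 * perim T0 ^+ 2 + 1).
have q1 : 0 < 12 * perim T0 ^+ 2 + 1 by have := sqr_ge0 (perim T0); lra.
have e0 : 0 < e by apply: divr_gt0.
have [d d0 hd] := hl e e0.
have [n hn] : exists n, 6 * perim (s n) < d.
  pose x := 6 * perim T0 / d; exists (Num.bound x).
  rewrite sPE mulrA ltr_pdivrMr ?exprn_gt0// [d * _]mulrC -ltr_pdivrMr//.
  have x0 : 0 <= x by rewrite divr_ge0 ?(ltW d0)// mulr_ge0.
  apply: (lt_trans (archi_boundP x0)); rewrite -natrX ltr_nat.
  exact: ltn_expl.
(* The affine approximation at [p] has a primitive, so it can be subtracted from [f] without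
   changing the integral. *)
have aff0 : triint (fun w => f p + l * (w - p)) (s n) = 0.
  have E a b : segint (fun w => f p + l * (w - p)) a b =
     (fun w => f p * w + l / 2 * (w - p) ^+ 2) b - (fun w => f p * w + l / 2 * (w - p) ^+ 2) a.
    apply: (@segint_FTC (fun w => f p * w + l / 2 * (w - p) ^+ 2)) => z; have := cdiff_quad (f p) (l / 2) p z.
    by rewrite (_ : 2 * (l / 2) = l) //; field.
  by rewrite /triint !E; ring.
have caff := ccont_aff (f p) l p.
have key : cnorm (triint f (s n)) <= 12 * e * perim (s n) ^+ 2.
  rewrite -[triint f (s n)]subr0 -aff0.
  move: hn (Hp n) (P0 (s n)); case: (s n) => [[a b] c]; rewrite /triint/= => hn Ha PP.
  set Q := perim (a, b, c) in hn Ha PP *.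
  have QE : Q = cnorm (b - a) + cnorm (c - b) + cnorm (a - c) by [].
  have Nab := cnorm_ge0 (b - a); have Nbc := cnorm_ge0 (c - b); have Nca := cnorm_ge0 (a - c).
  have side x y : cnorm (x - a) <= Q -> cnorm (y - x) <= Q ->
     cnorm (segint f x y - segint (fun w => f p + l * (w - p)) x y) <= 12 * e * Q * cnorm (y - x).
    move=> hx hy; have c1 := ccont_line (x) (y) cf.
    have c2 := ccont_line (x) (y) caff.
    rewrite -(segintB c1 c2).
    have -> : 12 * e * Q * cnorm (y - x) = 2 * (e * (6 * Q)) * cnorm (y - x) by ring.
    apply: segint_bound; first exact: rcontB c1 c2.
    move=> t /andP[t0 t1]; set w := line x y t.
    (* One perimeter along the side, one from [a] to the start of the side, four from [a] to [p]. *)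
    have Nw : cnorm (w - p) <= 6 * Q.
      have -> : w - p = t%:C * (y - x) + ((x - a) + (a - p)) by rewrite /w /line; ring.
      apply: (le_trans (cnormD _ _)); have := cnormD (x - a) (a - p); rewrite cnormM cnorm_real ger0_norm//.
      by have := cnorm_ge0 (y - x); nra.
    have := hd (w - p); rewrite [p + _]addrC subrK => /(_ (le_lt_trans Nw hn)).
    rewrite (_ : f w - f p - (w - p) * l = f w - (f p + l * (w - p))); last by ring.
    by move=> /le_trans; apply; rewrite ler_wpM2l// ltW.
  have s1 : cnorm (a - a) <= Q by rewrite subrr cnorm0.
  have h1 := side a b s1 ltac:(lra).
  have h2 := side b c ltac:(lra) ltac:(lra).
  have h3 := side c a ltac:(rewrite cnorm_distC; lra) ltac:(lra).
  rewrite [X in cnorm X](_ : _ = (segint f a b - segint (fun w => f p + l * (w - p)) a b) +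
    (segint f b c - segint (fun w => f p + l * (w - p)) b c) +
    (segint f c a - segint (fun w => f p + l * (w - p)) c a)); last by ring.
  apply: (le_trans (cnormD _ _)); have := cnormD (segint f a b - segint (fun w => f p + l * (w - p)) a b) (segint f b c - segint (fun w => f p + l * (w - p)) b c).
  have -> : 12 * e * Q ^+ 2 = 12 * e * Q * cnorm (b - a) + 12 * e * Q * cnorm (c - b) + 12 * e * Q * cnorm (a - c).
    by rewrite -!mulrDr -QE; ring.
  lra.
have := sD n; rewrite -/eta => /le_trans /(_ (ler_wpM2l (exprn_ge0 n (ltW (ltr0n _ 4))) key)).
rewrite sPE => hh.
have e2 : (2 ^+ n : R) != 0 by rewrite expf_neq0.
have : eta <= 12 * perim T0 ^+ 2 * e.
  apply: (le_trans hh); rewrite (_ : 4 = 2 ^+ 2 :> R); last by ring.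
  by rewrite -exprM mulnC exprM; rewrite le_eqVlt; apply/orP; left; apply/eqP; field.
rewrite /e mulrCA -ler_pdivrMl// mulVf ?gt_eqF// ler_pdivlMr//; lra.
Qed.

(** Goursat on the triangle 0, z, z + h turns the increment of the integral from 0 into the integral
    over a short segment, where f is nearly constant. *)
Lemma has_primitive f : (forall z, exists l, cdiff f z l) ->
  exists F, forall z, cdiff F z (f z).
Proof.
move=> df; have cf : ccont f by move=> z e e0; have [l hl] := df z; exact: cdiff_cont hl e e0.
exists (fun z => segint f 0 z) => z e e0.
have [d d0 hd] := cf z (e / 2) ltac:(lra).
exists d => // h hh.
have E : segint f 0 (z + h) - segint f 0 z = segint f z (z + h).
  have := goursat df (0, z, z + h); rewrite /triint/= (segint_rev 0 (z + h) cf) => E.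
  by apply/eqP; rewrite -subr_eq0 -oppr_eq0; apply/eqP; rewrite -[RHS]E; ring.
have E2 : h * f z = segint (fun=> f z) z (z + h).
  rewrite (@segint_FTC (fun w => f z * w + 0 * (w - 0) ^+ 2)); first by ring.
  by move=> w; have := cdiff_quad (f z) 0 0 w; rewrite mulr0 mul0r addr0.
have c2 : rcont (fun t => (fun=> f z) (line z (z + h) t)).
  by move=> t e' e'0; exists 1 => // h' _; rewrite subrr cnorm0 ltW.
have c1 := ccont_line (z) (z + h) cf.
rewrite E E2 -(segintB c1 c2).
have -> : e * cnorm h = 2 * (e / 2) * cnorm (z + h - z) by rewrite [z + h]addrC addrK; field.
apply: segint_bound; first exact: rcontB.
move=> t /andP[t0 t1]; rewrite /line [z + h]addrC addrK; apply: hd.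
by rewrite cnormM cnorm_real ger0_norm//; apply: le_lt_trans hh; rewrite ler_piMl.
Qed.

End Goursat.

(** * Cauchy's formula and smoothness *)

Section Cauchy.
Variable R : realType.
Local Notation C := (R[i]).
Local Notation Re := (@complex.Re _).
Local Notation Im := (@complex.Im _).
Implicit Types (z w a b c : C) (e d t : R).
#[local] Hint Extern 0 (is_true (_ <= cnorm _)) => solve [apply: cnorm_ge0] : core.

Definition cdf (f : C -> C) z := derivable (f : C^o -> C^o) z 1.

Lemma cdfP f z : cdf f z <-> exists l, cdiff f z l.
Proof.
split=> [/derivableP h|[l /cdiffP[]//]].
by exists ('D_1 (f : C^o -> C^o) z); apply/cdiffP.
Qed.

Lemma cdiff_cdf f z l : cdiff f z l -> cdf f z.
Proof. by move=> h; apply/cdfP; exists l. Qed.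

Lemma cdiff_uniq f z l m : cdiff f z l -> cdiff f z m -> l = m.
Proof. by move=> /cdiffP h1 /cdiffP h2; rewrite -(@derive_val _ _ _ _ _ _ _ h1) -(@derive_val _ _ _ _ _ _ _ h2). Qed.

Lemma cdiff_loc (f g : C -> C) z l d : 0 < d ->
  (forall h, cnorm h < d -> f (z + h) = g (z + h)) -> cdiff f z l -> cdiff g z l.
Proof.
move=> d0 E H e e0; have [d' d'0 hd] := H e e0.
exists (Num.min d d'); first by rewrite lt_min d0.
move=> h; rewrite lt_min => /andP[h1 /hd]; rewrite -(E h h1).
by rewrite -[z in g z]addr0 -E ?cnorm0// addr0.
Qed.

Lemma cdfM f g z : cdf f z -> cdf g z -> cdf (fun w => f w * g w) z.
Proof. exact: derivableM. Qed.

Lemma cdfD f g z : cdf f z -> cdf g z -> cdf (fun w => f w + g w) z.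
Proof. exact: derivableD. Qed.

Lemma cdfB f g z : cdf f z -> cdf g z -> cdf (fun w => f w - g w) z.
Proof. exact: derivableB. Qed.

Lemma cdf_cst c z : cdf (fun=> c) z.
Proof. exact: derivable_cst. Qed.

Lemma cdf_id z : cdf id z.
Proof. exact: derivable_id. Qed.

Lemma cdfV f z : f z != 0 -> cdf f z -> cdf (fun w => (f w)^-1) z.
Proof. exact: derivableV. Qed.

Lemma cdfX f k z : cdf f z -> cdf (fun w => f w ^+ k) z.
Proof.
move=> hf; elim: k => [|k IH]; first exact: cdf_cst.
by under eq_fun do rewrite exprS; apply: cdfM; [exact: hf|exact: IH].
Qed.

Lemma cdf_shift f z s : cdf f (s + z) -> cdf (fun w => f (s + w)) z.
Proof.
move=> /cdfP[l hl]; apply/cdfP; exists l => e e0; have [d d0 hd] := hl e e0.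
by exists d => // h /hd; rewrite addrA.
Qed.

Lemma rcont_cdf (g : C -> C) a b : (forall t, cdf g (line a b t)) ->
  rcont (fun t => g (line a b t)).
Proof.
move=> H t e e0; have [l hl] := (cdfP _ _).1 (H t).
have [d d0 hd] := cdiff_cont hl e0.
have c0 := cnorm_ge0 (b - a); have b1 : 0 < cnorm (b - a) + 1 by lra.
exists (d / (cnorm (b - a) + 1)); first exact: divr_gt0.
move=> h; rewrite ltr_pdivlMr// => hh; have h0 := normr_ge0 h.
have := hd (h%:C * (b - a)); rewrite cnormM cnorm_real /line rmorphD/= mulrDl addrA; apply.
by apply: le_lt_trans hh; nra.
Qed.

Lemma is_int01_cst c : is_int01 (fun=> c : C) c.
Proof.
exists (fun t => c * (0 + t%:C * 1) + 0 * (0 + t%:C * 1 - 0) ^+ 2).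
  move=> t _; have := cdiff_quad c 0 0 (0 + t%:C * 1).
  by rewrite mulr0 mul0r addr0 => /rdiff_line; rewrite mul1r.
by rewrite rmorph1 rmorph0; ring.
Qed.

Lemma is_int01_lin c : is_int01 (fun t => t%:C * c : C) (c / 2).
Proof.
exists (fun t => 0 * (0 + t%:C * 1) + (c / 2) * (0 + t%:C * 1 - 0) ^+ 2).
  move=> t _; have := cdiff_quad 0 (c / 2) 0 (0 + t%:C * 1).
  rewrite [X in cdiff _ _ X](_ : _ = t%:C * c); last by field.
  by move=> /rdiff_line; rewrite mul1r.
by rewrite rmorph1 rmorph0; field.
Qed.

Lemma cdf_ccont f : (forall z, cdf f z) -> ccont f.
Proof. by move=> H z e e0; have [l hl] := (cdfP _ _).1 (H z); have [d d0 hd] := cdiff_cont hl e0; exists d. Qed.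

(* Only the second derivative of [F] at [z0] is needed to see that the difference quotient is
   differentiable at [z0]; this avoids Goursat's theorem with an exceptional point. *)
Lemma division F f z0 : (forall z, cdiff F z (f z)) -> (forall z, cdf f z) ->
  exists2 g, (forall z, cdf g z) & forall w, F w = F z0 + (w - z0) * g w.
Proof.
move=> HF Hf; have cf := cdf_ccont Hf.
pose g w := int01 (fun t => f (line z0 w t)).
have gE w : F w = F z0 + (w - z0) * g w.
  by rewrite -/(segint f z0 w) (segint_FTC _ _ HF); ring.
exists g; last exact: gE.
move=> w; have [->|wz] := eqVneq w z0.
  have [f0 hf0] := (cdfP _ _).1 (Hf z0).
  apply/cdfP; exists (f0 / 2) => e e0; have [|d d0 hd] := hf0 (e / 2); first by lra.
  exists d => // h hh.
  have h1 := int01P (ccont_line z0 (z0 + h) cf).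
  have E0 : g z0 = f z0.
    rewrite /g (_ : (fun t => _) = (fun=> f z0)) ?(int01E (is_int01_cst _))//.
    by apply/funext => t; rewrite /line subrr mulr0 addr0.
  have h2 := is_int01B (is_int01B h1 (is_int01_cst (f z0))) (is_int01_lin (h * f0)).
  rewrite E0 (mulrA h) (_ : e * cnorm h = 2 * (e / 2 * cnorm h)); last by field.
  apply: (is_int01_bound h2) => t /andP[t0 t1].
  rewrite /line [z0 + h]addrC addrK.
  have Nt : cnorm (t%:C * h) <= cnorm h by rewrite cnormM cnorm_real ger0_norm// ler_piMl.
  have := hd (t%:C * h) (le_lt_trans Nt hh); rewrite -(mulrA t%:C) => /le_trans; apply.
  by rewrite ler_wpM2l// divr_ge0 ?(ltW e0).
have wz' : w - z0 != 0 by rewrite subr_eq0.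
have /cdfP[l hl] : cdf (fun w => (F w - F z0) * (w - z0)^-1) w.
  apply: cdfM; first by apply: cdfB; [exact: cdiff_cdf (HF w)|exact: cdf_cst].
  by apply: cdfV; [exact: wz'|apply: cdfB; [exact: cdf_id|exact: cdf_cst]].
apply/cdfP; exists l; apply: (cdiff_loc (cnorm_gt0 wz')) hl => h hh.
have hz : w + h - z0 != 0.
  apply/eqP => E; have : h = - (w - z0) by rewrite -[LHS]subr0 -E; ring.
  by move=> hE; move: hh; rewrite hE cnormN ltxx.
by rewrite gE [F z0 + _]addrC addrK mulrAC mulfV ?mul1r.
Qed.

(** * Contour integrals over the square with vertices 1 - i, 1 + i, -1 + i, -1 - i *)

Definition v0 : C := 1 -i* 1.
Definition v1 : C := 1 +i* 1.
Definition v2 : C := (-1) +i* 1.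
Definition v3 : C := (-1) -i* 1.

Definition Qint (h : C -> C) := segint h v0 v1 + segint h v1 v2 + segint h v2 v3 + segint h v3 v0.

Definition isside a b := [\/ a = v0 /\ b = v1, a = v1 /\ b = v2, a = v2 /\ b = v3 | a = v3 /\ b = v0].

Lemma side_far a b t z : isside a b -> cnorm z < 2^-1 -> 2^-1 <= cnorm (line a b t - z).
Proof.
have HRe w : 2^-1 <= `|Re w| -> 2^-1 <= cnorm w by move=> /le_trans; apply; exact: cnorm_ge_Re.
have HIm w : 2^-1 <= `|Im w| -> 2^-1 <= cnorm w by move=> /le_trans; apply; exact: cnorm_ge_Im.
move=> H hz; have := cnorm_ge_Re z; have := cnorm_ge_Im z; case: z hz => x y /= hz hy hx.
have {}hx : `|x| < 2^-1 by exact: le_lt_trans hz.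
have {}hy : `|y| < 2^-1 by exact: le_lt_trans hz.
move: hx hy; rewrite !ltr_norml => /andP[x1 x2] /andP[y1 y2].
case: H => -[-> ->].
- by apply: HRe; rewrite /line/=; apply: le_trans (ler_norm _); lra.
- by apply: HIm; rewrite /line/=; apply: le_trans (ler_norm _); lra.
- by apply: HRe; rewrite /line/= -normrN; apply: le_trans (ler_norm _); lra.
- by apply: HIm; rewrite /line/= -normrN; apply: le_trans (ler_norm _); lra.
Qed.

Lemma side_neq a b : isside a b -> a != b.
Proof.
have i0 : (1 == -1 :> R) = false by apply/negbTE/eqP; lra.
have i1 : (-1 == 1 :> R) = false by apply/negbTE/eqP; lra.
by case=> -[-> ->]; rewrite eq_complex /= ?eqxx ?i0 ?i1 ?andbF.
Qed.

Lemma side_len a b : isside a b -> cnorm (b - a) <= 4.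
Proof.
case=> -[-> ->]; apply: (le_trans (cnorm_le _)); rewrite /=.
- rewrite subrr normr0 opprK add0r ger0_norm; lra.
- rewrite subrr normr0 addr0 -normrN ger0_norm; lra.
- rewrite subrr normr0 add0r -normrN ger0_norm; lra.
- rewrite subrr normr0 addr0 opprK ger0_norm; lra.
Qed.

Lemma Qint_eq h1 h2 : (forall a b, isside a b -> segint h1 a b = segint h2 a b) -> Qint h1 = Qint h2.
Proof.
by move=> H; rewrite /Qint !H //; [apply: Or44|apply: Or43|apply: Or42|apply: Or41].
Qed.

Definition regular_on_sides (h : C -> C) := forall a b, isside a b -> forall t, cdf h (line a b t).

Lemma QintB h1 h2 : regular_on_sides h1 -> regular_on_sides h2 ->
  Qint (fun w => h1 w - h2 w) = Qint h1 - Qint h2.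
Proof.
move=> H1 H2; have S a b : isside a b -> segint (fun w => h1 w - h2 w) a b = segint h1 a b - segint h2 a b.
  by move=> ab; rewrite segintB//; apply: rcont_cdf => t; [apply: H1|apply: H2].
rewrite /Qint !S //; [ring|apply: Or44|apply: Or43|apply: Or42|apply: Or41]; by [].
Qed.

Lemma QintZ c h : regular_on_sides h -> Qint (fun w => c * h w) = c * Qint h.
Proof.
move=> H; have S a b : isside a b -> segint (fun w => c * h w) a b = c * segint h a b.
  move=> ab; have k := int01P (rcont_cdf (H _ _ ab)).
  by rewrite /segint (int01E (is_int01Z c k)); ring.
rewrite /Qint !S //; [ring|apply: Or44|apply: Or43|apply: Or42|apply: Or41]; by [].
Qed.

(** 32 is the product of the four sides, the factor 2 of [segint_bound] and the crude bound 4 on the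
    length of a side. *)
Lemma Qint_bound h M : regular_on_sides h ->
  (forall a b, isside a b -> forall t, 0 <= t <= 1 -> cnorm (h (line a b t)) <= M) ->
  cnorm (Qint h) <= 32 * M.
Proof.
move=> H HM; have S a b : isside a b -> cnorm (segint h a b) <= 8 * M.
  move=> ab; apply: (le_trans (segint_bound (rcont_cdf (H _ _ ab)) (HM _ _ ab))).
  have M0 : 0 <= M by apply: le_trans (HM _ _ ab 0 _) => //; rewrite lexx ler01.
  by have := side_len ab; nra.
have s1 := S _ _ (Or41 _ _ _ (conj erefl erefl)).
have s2 := S _ _ (Or42 _ _ _ (conj erefl erefl)).
have s3 := S _ _ (Or43 _ _ _ (conj erefl erefl)).
have s4 := S _ _ (Or44 _ _ _ (conj erefl erefl)).
rewrite /Qint; have := cnormD (segint h v0 v1) (segint h v1 v2).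
have := cnormD (segint h v0 v1 + segint h v1 v2) (segint h v2 v3).
have := cnormD (segint h v0 v1 + segint h v1 v2 + segint h v2 v3) (segint h v3 v0).
lra.
Qed.

Lemma Qint0 G h : (forall a b, isside a b -> forall t, cdiff G (line a b t) (h (line a b t))) ->
  Qint h = 0.
Proof.
move=> H; have S a b : isside a b -> segint h a b = G b - G a.
  by move=> ab; rewrite (segint_prim (fun t _ => H _ _ ab t) (side_neq ab)).
rewrite /Qint !S //; [ring|apply: Or44|apply: Or43|apply: Or42|apply: Or41]; by [].
Qed.

(** Meant for u = 1 / (w - z - h) and v = 1 / (w - z), which satisfy u - v = h u v and are bounded
    by 2 when w is at distance at least 1/2. The quadratic remainder is uniform in w, which permits
    differentiation under the integral sign. *)
Lemma pow_est k : exists2 K : R, 0 <= K & forall u v h : C, cnorm u <= 2 -> cnorm v <= 2 ->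
  u - v = h * u * v -> cnorm (u ^+ k - v ^+ k - k%:R * h * v ^+ k.+1) <= K * cnorm h ^+ 2.
Proof.
elim: k => [|k [K K0 IH]].
  exists 0 => // u v h _ _ _; rewrite !expr0 subrr mul0r mul0r subrr cnorm0 mul0r//.
exists (2 * K + k.+1%:R * 2 ^+ k.+3) => [|u v h Nu Nv E].
  by rewrite addr_ge0// mulr_ge0// exprn_ge0.
have -> : u ^+ k.+1 - v ^+ k.+1 - k.+1%:R * h * v ^+ k.+2 =
  u * (u ^+ k - v ^+ k - k%:R * h * v ^+ k.+1) + (k.+1%:R * h * v ^+ k.+2 * (h * u)).
  have -> : k.+1%:R * h * v ^+ k.+2 * (h * u) = k.+1%:R * h * v ^+ k.+1 * (u - v) by rewrite E exprS; ring.
  have E2 : h * v ^+ k.+1 * u = v ^+ k * (u - v) by rewrite E exprS; ring.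
  have E3 : k.+1%:R * h * v ^+ k.+1 * (u - v) = k%:R * h * v ^+ k.+1 * u + v ^+ k * (u - v)
     - k.+1%:R * h * v ^+ k.+2.
    by rewrite -E2 !exprS -natr1; ring.
  by rewrite E3 !exprS -natr1; ring.
apply: (le_trans (cnormD _ _)); rewrite (cnormM u) (cnormM (_ * h * _)) (cnormM (_ * h)) (cnormM _ h) (cnormM h) mulrDl lerD//.
  apply: le_trans (ler_wpM2r (cnorm_ge0 _) Nu) _; rewrite -[2 * K * _]mulrA ler_wpM2l//; exact: IH.
have NX w m : cnorm (w ^+ m) = cnorm w ^+ m by elim: m => [|m IHm]; rewrite ?expr0 ?cnorm1// !exprS cnormM IHm.
have Nn m : cnorm (m%:R : C) = m%:R.
  have -> : (m%:R : C) = (m%:R)%:C by rewrite rmorph_nat.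
  by rewrite cnorm_real ger0_norm.
rewrite NX Nn; have vb : cnorm v ^+ k.+2 <= 2 ^+ k.+2 by rewrite lerXn2r// nnegrE.
have -> : k.+1%:R * cnorm h * cnorm v ^+ k.+2 * (cnorm h * cnorm u) = (k.+1%:R * (cnorm h) ^+ 2) * (cnorm v ^+ k.+2 * cnorm u) by ring.
have -> : k.+1%:R * 2 ^+ k.+3 * cnorm h ^+ 2 = (k.+1%:R * (cnorm h) ^+ 2) * (2 ^+ k.+2 * 2) :> R by rewrite [2 ^+ k.+3]exprSr; ring.
apply: ler_wpM2l; first by rewrite mulr_ge0 ?exprn_ge0.
by apply: ler_pM => //; exact: exprn_ge0.
Qed.

Definition Phi (h : C -> C) k z := Qint (fun w => h w * (w - z)^-1 ^+ k).

Lemma reg_ker h k z : (forall z, cdf h z) -> cnorm z < 2^-1 ->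
  regular_on_sides (fun w => h w * (w - z)^-1 ^+ k).
Proof.
move=> H hz a b ab t; apply: cdfM; first exact: H.
apply: cdfX; apply: cdfV; last first.
  by apply: cdfB; [exact: cdf_id|exact: cdf_cst].
apply/eqP => E; have := side_far t ab hz; rewrite E cnorm0; lra.
Qed.

Lemma bounded_on_sides h : (forall z, cdf h z) -> exists2 M, 0 <= M &
  forall a b, isside a b -> forall t, 0 <= t <= 1 -> cnorm (h (line a b t)) <= M.
Proof.
move=> H; have S a b : exists2 M, 0 <= M & forall t, 0 <= t <= 1 -> cnorm (h (line a b t)) <= M.
  have ch := rcont_cdf (fun t => H (line a b t)).
  have [||c c01 hc] := @EVT_max R (fun t => cnorm (h (line a b t))) 0 1.
  - exact: ler01.
  - apply: continuous_subspaceT => t; apply/cvgrPdist_le => e e0.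
    have [d d0 hd] := ch t e e0; apply/nbhs_ballP; exists d => // s /=; rewrite /ball/= => hs.
    have := hd (s - t); rewrite [t + _]addrC subrK distrC => /(_ hs); apply: le_trans.
    have T1 := cnorm_triangle (h (line a b s)) (h (line a b t)) 0.
    have T2 := cnorm_triangle (h (line a b t)) (h (line a b s)) 0.
    rewrite !subr0 in T1 T2; rewrite (cnorm_distC (h (line a b t))) in T2.
    rewrite ler_norml; apply/andP; split; lra.
  by exists (cnorm (h (line a b c))) => // t t01; apply: hc; rewrite in_itv.
have [M1 p1 H1] := S v0 v1; have [M2 p2 H2] := S v1 v2.
have [M3 p3 H3] := S v2 v3; have [M4 p4 H4] := S v3 v0.
exists (M1 + M2 + M3 + M4); first by lra.
by move=> a b [] [-> ->] t tt; [have := H1 t tt|have := H2 t tt|have := H3 t tt|have := H4 t tt]; lra.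
Qed.

Lemma Phi_diff h k z : (forall z, cdf h z) -> cnorm z < 2^-1 ->
  cdiff (Phi h k) z (k%:R * Phi h k.+1 z).
Proof.
move=> H hz; have [M M0 HM] := bounded_on_sides H; have [K K0 HK] := pow_est k.
move=> e e0; have q : 0 < 32 * (M * K) + 1 by have := mulr_ge0 M0 K0; lra.
exists (Num.min (2^-1 - cnorm z) (e / (32 * (M * K) + 1))).
  by rewrite lt_min subr_gt0 hz divr_gt0.
move=> s; rewrite lt_min ltr_pdivlMr// => /andP[s1 s2].
have hzs : cnorm (z + s) < 2^-1 by apply: le_lt_trans (cnormD _ _) _; lra.
have r1 := @reg_ker h k _ H hzs; have r2 := @reg_ker h k _ H hz.
have r3 := @reg_ker h k.+1 _ H hz.
have r12 : regular_on_sides (fun w => h w * (w - (z + s))^-1 ^+ k - h w * (w - z)^-1 ^+ k).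
  by move=> a b ab t; apply: cdfB; [exact: r1|exact: r2].
have r3' : regular_on_sides (fun w => (s * k%:R) * (h w * (w - z)^-1 ^+ k.+1)).
  by move=> a b ab t; apply: cdfM; [exact: cdf_cst|exact: r3].
rewrite mulrA /Phi -(QintZ _ r3) -(QintB r1 r2) -(QintB r12 r3').
apply: (le_trans (@Qint_bound _ (M * (K * cnorm s ^+ 2)) _ _)).
- by move=> a b ab t; apply: cdfB; [exact: r12|exact: r3'].
- move=> a b ab t tt; set w := line a b t.
  have f1 := side_far t ab hz; have f2 := side_far t ab hzs.
  have n1 : w - z != 0 by apply/eqP => E; rewrite -/w E cnorm0 in f1; lra.
  have n2 : w - (z + s) != 0 by apply/eqP => E; rewrite -/w E cnorm0 in f2; lra.
  rewrite (_ : _ - _ = h w * ((w - (z + s))^-1 ^+ k - (w - z)^-1 ^+ k - k%:R * s * (w - z)^-1 ^+ k.+1)); last by ring.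
  have inv2 (x : C) : 2^-1 <= cnorm x -> cnorm x^-1 <= 2.
    move=> hx; rewrite cnormV -[leRHS]invrK lef_pV2//; rewrite posrE; lra.
  rewrite cnormM ler_pM//; first exact: HM.
  by apply: HK; [exact: inv2|exact: inv2|field; rewrite n1 n2].
have := cnorm_ge0 s; nra.
Qed.

(** The quotient (F(w) - F(z)) / (w - z) extends to an everywhere differentiable function, which has
    a primitive and therefore integral zero. The integral of 1 / (w - z) is left unevaluated: it
    only has to be constant and nonzero. *)
Lemma cauchy_formula F f z : (forall w, cdiff F w (f w)) -> (forall w, cdf f w) ->
  cnorm z < 2^-1 -> Phi F 1 z = F z * Phi (fun=> 1) 1 z.
Proof.
move=> HF Hf hz; have HF' w : cdf F w := cdiff_cdf (HF w).
have [g Hg gE] := division z HF Hf.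
have [G HG] := has_primitive (fun w => (cdfP _ _).1 (Hg w)).
have r1 := @reg_ker F 1 _ HF' hz; have r2 := @reg_ker (fun=> 1) 1 _ (fun w => @cdf_cst 1 w) hz.
have r3 : regular_on_sides (fun w => F z * (1 * (w - z)^-1 ^+ 1)).
  by move=> a b ab t; apply: cdfM; [exact: cdf_cst|exact: r2].
apply/eqP; rewrite -subr_eq0 /Phi -(QintZ _ r2) -(QintB r1 r3).
rewrite -(@Qint0 G g) => [|a b ab t]; last exact: HG.
apply/eqP; apply: Qint_eq => a b ab; rewrite /segint; congr (_ * int01 _); apply/funext => t.
set w := line a b t; have n1 : w - z != 0.
  by apply/eqP => E; have := side_far t ab hz; rewrite -/w E cnorm0; lra.
by rewrite (gE w) expr1 mul1r -mulrBl [F z + _]addrC addrK mulrAC mulfV ?mul1r.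
Qed.

Lemma cdiff_inv z p : z - p != 0 -> cdiff (fun w => - (w - p)^-1) z ((z - p)^-1 ^+ 2).
Proof.
move=> zp e e0; have r0 := cnorm_gt0 zp; set r := cnorm (z - p) in r0.
exists (Num.min (r / 2) (e * r ^+ 3 / 2)).
  by rewrite lt_min divr_gt0//= divr_gt0// mulr_gt0// exprn_gt0.
move=> h; rewrite lt_min => /andP[h1 h2].
have T : cnorm (z - p) <= cnorm (z + h - p) + cnorm h.
  by rewrite (_ : z - p = (z + h - p) - h); [exact: cnormB|ring].
have hr : r / 2 <= cnorm (z + h - p) by rewrite -/r in T; lra.
have zh : z + h - p != 0 by apply/eqP => E; move: hr; rewrite E cnorm0; lra.
have -> : - (z + h - p)^-1 - - (z - p)^-1 - h * (z - p)^-1 ^+ 2 =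
   - (h * (h * ((z + h - p)^-1 * ((z - p)^-1 * (z - p)^-1)))) by field; rewrite zh zp.
rewrite cnormN (cnormM h) mulrC ler_wpM2r// (cnormM h) (cnormM _^-1) (cnormM _^-1) !cnormV -/r.
have {}hr : (cnorm (z + h - p))^-1 <= 2 / r.
  by rewrite -[2 / r]invrK lef_pV2 ?posrE ?invf_div// ?divr_gt0//; lra.
have -> : e = (e * r ^+ 3 / 2) * (2 / r * (r^-1 / r)).
  by field; rewrite gt_eqF.
apply: ler_pM => //; [|exact: ltW|].
  by rewrite !mulr_ge0 ?invr_ge0 ?(ltW r0).
by rewrite ler_wpM2r// divr_ge0 ?invr_ge0 ?(ltW r0).
Qed.

Lemma cdiffZ F z l c : cdiff F z l -> cdiff (fun w => c * F w) z (c * l).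
Proof.
move=> H e e0; have c0 := cnorm_ge0 c.
have [d d0 hd] := H (e / (cnorm c + 1)) (divr_gt0 e0 (ltr_wpDl c0 ltr01)).
exists d => // h /hd k.
have -> : c * F (z + h) - c * F z - h * (c * l) = c * (F (z + h) - F z - h * l) by ring.
rewrite cnormM; apply: (le_trans (ler_wpM2l c0 k)).
rewrite !mulrA ler_wpM2r// ler_pdivrMr; last by lra.
by rewrite mulrDr mulr1 mulrC lerDl ltW.
Qed.

Lemma cdiff0_line F a b : (forall t, 0 <= t <= 1 -> cdiff F (line a b t) 0) -> F b = F a.
Proof.
move=> H; have := @rdiff_bound R (fun t => F (a + t%:C * (b - a))) (fun=> (b - a) * 0) 0.
rewrite mulr0 rmorph1 rmorph0 mul1r mul0r addr0 [a + _]addrC subrK.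
move=> /(_ (fun t tt => eq_ind _ (rdiff _ t) (rdiff_line (H t tt)) _ (mulr0 _))) hh.
have {}hh : cnorm (F b - F a) <= 0 by rewrite -[leRHS](mulr0 2); apply: hh => t _; rewrite cnorm0.
by apply/eqP; rewrite -subr_eq0; apply/eqP/cnorm_eq0/eqP; rewrite eq_le hh cnorm_ge0.
Qed.

(** The derivative in z is the integral of (w - z)^-2, which has the primitive - (w - z)^-1 along
    the sides. *)
Lemma winding_const z : cnorm z < 2^-1 -> Phi (fun=> 1) 1 z = Phi (fun=> 1) 1 0.
Proof.
move=> hz; apply: cdiff0_line => t /andP[t0 t1].
have hw : cnorm (line 0 z t) < 2^-1.
  apply: le_lt_trans hz; rewrite /line add0r subr0 cnormM cnorm_real ger0_norm// ler_piMl//.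
have := @Phi_diff (fun=> 1) 1 _ (fun w => @cdf_cst 1 w) hw.
rewrite mul1r (_ : Phi _ 2 _ = 0)//.
apply: (@Qint0 (fun w => - (w - line 0 z t)^-1)) => a b ab s; rewrite mul1r.
by apply: cdiff_inv; apply/eqP => E; have := side_far s ab hw; rewrite E cnorm0; lra.
Qed.

(** Multiplication by i permutes the sides cyclically and preserves dw / w, so the integral is four
    times that over the right side, where Re (1 / w) > 0. If the latter were zero, the mean value
    theorem would produce a zero of Re (1 / w). *)
Lemma winding_neq0 : Phi (fun=> 1) 1 0 != 0.
Proof.
have h0 : cnorm (0 : C) < 2^-1 by rewrite cnorm0; lra.
pose h w : C := 1 * (w - 0)^-1 ^+ 1.
have r2 : regular_on_sides h := @reg_ker (fun=> 1) 1 _ (fun w => @cdf_cst 1 w) h0.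
have i0 : ('i : C) != 0 by rewrite eq_complex /= oner_eq0 andbF.
have rot a b : isside a b -> segint h ('i * a) ('i * b) = segint h a b.
  move=> ab; have k := int01P (rcont_cdf (r2 _ _ ab)).
  rewrite /segint (_ : (fun t => h (line ('i * a) ('i * b) t)) = (fun t => 'i^-1 * h (line a b t))).
    by rewrite (int01E (is_int01Z _ k)); field.
  apply/funext => t; rewrite /h !subr0 !mul1r !expr1 -invfM; congr (_^-1).
  by rewrite /line; ring.
have E1 : v1 = 'i * v0 by rewrite /v0 /v1; apply/eqP; rewrite eq_complex /=; apply/andP; split; apply/eqP; ring.
have E2 : v2 = 'i * v1 by rewrite /v2 /v1; apply/eqP; rewrite eq_complex /=; apply/andP; split; apply/eqP; ring.
have E3 : v3 = 'i * v2 by rewrite /v2 /v3; apply/eqP; rewrite eq_complex /=; apply/andP; split; apply/eqP; ring.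
have E4 : v0 = 'i * v3 by rewrite /v0 /v3; apply/eqP; rewrite eq_complex /=; apply/andP; split; apply/eqP; ring.
have I2 : segint h v1 v2 = segint h v0 v1 by rewrite -(rot v0 v1 (Or41 _ _ _ (conj erefl erefl))) -E1 -E2.
have I3 : segint h v2 v3 = segint h v1 v2 by rewrite -(rot v1 v2 (Or42 _ _ _ (conj erefl erefl))) -E2 -E3.
have I4 : segint h v3 v0 = segint h v2 v3 by rewrite -(rot v2 v3 (Or43 _ _ _ (conj erefl erefl))) -E3 -E4.
rewrite /Phi -/h /Qint I4 I3 I2.
have -> : segint h v0 v1 + segint h v0 v1 + segint h v0 v1 + segint h v0 v1 = 4 * segint h v0 v1 by ring.
rewrite mulf_neq0 ?pnatr_eq0//.
have s01 : isside v0 v1 by apply: Or41.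
rewrite /segint mulf_neq0//; first by rewrite subr_eq0 eq_sym (side_neq s01).
have [G HG ->] := int01P (rcont_cdf (r2 _ _ s01)).
apply/eqP => E0.
have HG' t : 0 <= t <= 1 -> rdiff G t (h (line v0 v1 t)) by move=> /andP[a b]; apply: HG; lra.
have [t t01 E] := @MVT01 _ (Re \o G) (Re \o (fun t => h (line v0 v1 t))) (fun t tt => rdiff_Re (HG' t tt)).
have Hpos : 0 < Re (h (line v0 v1 t)).
  rewrite /h subr0 mul1r expr1.
  have -> : line v0 v1 t = 1 +i* (2 * t - 1).
    by apply/eqP; rewrite eq_complex /=; apply/andP; split; apply/eqP; ring.
  by rewrite /= divr_gt0// expr1n ltr_pwDl// sqr_ge0.
by move: Hpos; rewrite -[Re (h _)]E /= -ReB E0 ltxx.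
Qed.

(** Cauchy's formula is available only for a function whose derivative is known to be
    differentiable, hence for a primitive F of f and not yet for f. Two derivatives of the kernel
    then express df near 0 as a contour integral, and a third one exists. *)
Lemma smooth_at0 f df : (forall z, cdiff f z (df z)) -> cdf df 0.
Proof.
move=> Hf; have Hf' w : cdf f w := cdiff_cdf (Hf w).
have [F HF] := has_primitive (fun w => (cdfP _ _).1 (Hf' w)).
have HF' w : cdf F w := cdiff_cdf (HF w).
pose k := (Phi (fun=> 1) 1 0 : C)^-1.
have loc (A B A' B' : C -> C) : (forall z, cnorm z < 2^-1 -> A z = B z) ->
    (forall z, cnorm z < 2^-1 -> cdiff B z (B' z)) -> (forall z, cdiff A z (A' z)) ->
    forall z, cnorm z < 2^-1 -> A' z = B' z.
  move=> AB HB HA z hz; apply: (cdiff_uniq (HA z)).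
  have d0 : 0 < 2^-1 - cnorm z by lra.
  apply: (cdiff_loc d0) (HB z hz) => s hs; rewrite AB//.
  by apply: le_lt_trans (cnormD _ _) _; lra.
have c1 z : cnorm z < 2^-1 -> F z = k * Phi F 1 z.
  move=> hz; rewrite (cauchy_formula HF Hf' hz) (winding_const hz) mulrC -mulrA mulfV ?mulr1//.
  exact: winding_neq0.
have d1 z : cnorm z < 2^-1 -> cdiff (fun z => k * Phi F 1 z) z (k * (1%:R * Phi F 2 z)).
  by move=> hz; apply: cdiffZ; apply: Phi_diff hz.
have c2 := loc _ _ _ _ c1 d1 HF.
have d2 z : cnorm z < 2^-1 -> cdiff (fun z => k * (1%:R * Phi F 2 z)) z (k * (1%:R * (2%:R * Phi F 3 z))).
  by move=> hz; do 2! apply: cdiffZ; apply: Phi_diff hz.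
have c3 := loc _ _ _ _ c2 d2 Hf.
have h0 : cnorm (0 : C) < 2^-1 by rewrite cnorm0; lra.
apply/cdfP; exists (k * (1%:R * (2%:R * (3%:R * Phi F 4 0)))).
have d0 : 0 < 2^-1 :> R by lra.
apply: (cdiff_loc d0 (f := fun z => k * (1%:R * (2%:R * Phi F 3 z)))) => [h hh|].
  by rewrite add0r c3.
by do 3! apply: cdiffZ; apply: Phi_diff h0.
Qed.

(** * Entire functions are closed under derivation and under division by a linear factor *)

Lemma dnS k (f : C -> C) : dn k.+1 f = dn 1 (dn k f).
Proof. by []. Qed.

Lemma dn_cdiff (f : C -> C) : entire f -> forall z, cdiff f z (dn 1 f z).
Proof.
move=> Hf z; apply/cdiffP; rewrite /dn derive1n1 derive1E.
by apply: derivableP; exact: Hf.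
Qed.

Lemma cdiff_shift f z s l : cdiff f (s + z) l -> cdiff (fun w => f (s + w)) z l.
Proof. by move=> hl e e0; have [d d0 hd] := hl e e0; exists d => // h /hd; rewrite addrA. Qed.

Lemma entire_dn1 (f : C -> C) : entire f -> entire (dn 1 f).
Proof.
move=> Hf z; have H := dn_cdiff Hf.
have /cdfP[l hl] := @smooth_at0 (fun w => f (z + w)) (fun w => dn 1 f (z + w))
  (fun w => cdiff_shift (H (z + w))).
apply/cdfP; exists l => e e0; have [d d0 hd] := hl e e0.
exists d; first exact: d0.
by move=> h /hd; rewrite (add0r h) (addr0 z); apply.
Qed.

Lemma entire_division (f : C -> C) p : entire f -> f p = 0 ->
  exists2 g, entire g & forall w, f w = (w - p) * g w.
Proof.
move=> Hf fp; have [g Hg E] := division p (dn_cdiff Hf) (entire_dn1 Hf).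
by exists g; [exact: Hg|move=> w; rewrite E fp add0r].
Qed.

Lemma dn1_eq0_const (f : C -> C) : entire f -> (forall z, dn 1 f z = 0) -> forall z, f z = f 0.
Proof.
move=> Hf H z; apply: cdiff0_line => t _.
by have := dn_cdiff Hf (line 0 z t); rewrite H.
Qed.

Lemma entire_eq (f g : C -> C) p : entire f -> entire g ->
  (forall z, z != p -> f z = g z) -> f = g.
Proof.
move=> Hf Hg H; apply/funext => z; have [->|/H//] := eqVneq z p.
apply/eqP; rewrite -subr_eq0; apply/eqP/cnorm_eq0/eqP; rewrite eq_le cnorm_ge0 andbT.
apply/ler_addgt0Pr => e e0; rewrite add0r.
have [d1 d10 h1] := (@cdf_ccont _ Hf p (e / 2)) (divr_gt0 e0 (ltr0n R 2)).
have [d2 d20 h2] := (@cdf_ccont _ Hg p (e / 2)) (divr_gt0 e0 (ltr0n R 2)).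
pose d := Num.min d1 d2 / 2; have m0 : 0 < Num.min d1 d2 by rewrite lt_min d10.
have dd : `|d| < Num.min d1 d2 by rewrite /d ger0_norm; lra.
have k1 := h1 d%:C; have k2 := h2 d%:C; rewrite !cnorm_real in k1 k2.
move: dd; rewrite lt_min => /andP[/k1 {}k1 /k2 {}k2].
have E : f (p + d%:C) = g (p + d%:C).
  apply: H; rewrite -subr_eq0 [p + _]addrC addrK; apply/eqP => -[] dE.
  have mE : Num.min d1 d2 = 2 * d by rewrite /d; field.
  by move: m0; rewrite mE dE mulr0 ltxx.
rewrite (_ : f p - g p = (g (p + d%:C) - g p) - (f (p + d%:C) - f p)); last by rewrite E; ring.
by apply: le_trans (cnormB _ _) _; lra.
Qed.

End Cauchy.

(** * Operators in normal form *)

Section PolynomialsInEndomorphism.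
Variables (K : fieldType) (V : lmodType K).
Implicit Types (T D S : {linear V -> V}) (p q : {poly K}) (u v : V).

Lemma iter_linear T n a u v : iter n T (a *: u + v) = a *: iter n T u + iter n T v.
Proof. by elim: n => //= n ->; rewrite linearP. Qed.

Definition polact (T : V -> V) p u := \sum_(i < size p) p`_i *: iter i T u.

Lemma polactE (T : V -> V) n p u : (size p <= n)%N -> polact T p u = \sum_(i < n) p`_i *: iter i T u.
Proof.
move=> pn; rewrite /polact -(subnKC pn) big_split_ord /= [X in _ + X]big1 ?addr0// => i _.
by rewrite nth_default ?scale0r// leq_addr.
Qed.

Lemma polactD (T : V -> V) p q u : polact T (p + q) u = polact T p u + polact T q u.
Proof.
rewrite (polactE _ _ (size_polyD p q)) (polactE _ _ (leq_maxl (size p) (size q))).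
rewrite (polactE _ _ (leq_maxr (size p) (size q))) -big_split/=.
by apply: eq_bigr => i _; rewrite coefD scalerDl.
Qed.

Lemma polactZ (T : V -> V) c p u : polact T (c *: p) u = c *: polact T p u.
Proof.
rewrite (polactE _ _ (size_scale_leq c p)) /polact scaler_sumr.
by apply: eq_bigr => i _; rewrite coefZ scalerA.
Qed.

Lemma polact0 (T : V -> V) u : polact T 0 u = 0.
Proof. by rewrite /polact size_poly0 big_ord0. Qed.

Lemma polactN (T : V -> V) p u : polact T (- p) u = - polact T p u.
Proof. by rewrite -[- p]scaleN1r polactZ scaleN1r. Qed.

Lemma polactB (T : V -> V) p q u : polact T (p - q) u = polact T p u - polact T q u.
Proof. by rewrite polactD polactN. Qed.

Lemma polact_sum (T : V -> V) I (s : seq I) (P : pred I) (F : I -> {poly K}) u :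
  polact T (\sum_(i <- s | P i) F i) u = \sum_(i <- s | P i) polact T (F i) u.
Proof. by apply: (big_morph (fun p => polact T p u)) => [p q|]; rewrite ?polactD ?polact0. Qed.

Lemma polactC (T : V -> V) c u : polact T c%:P u = c *: u.
Proof. by rewrite (polactE _ _ (size_polyC_leq1 c)) big_ord1 coefC. Qed.

Lemma polact1 (T : V -> V) u : polact T 1 u = u.
Proof. by rewrite -[1]/(1%:P) polactC scale1r. Qed.

Lemma polactMX T p u : polact T (p * 'X) u = T (polact T p u).
Proof.
have s : (size (p * 'X)%R <= (size p).+1)%N.
  by apply: leq_trans (size_polyMleq _ _) _; rewrite size_polyX addn2.
rewrite (polactE _ _ s) big_ord_recl coefMX/= scale0r add0r /polact linear_sum.
by apply: eq_bigr => i _; rewrite coefMX/= linearZ.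
Qed.

Lemma polactX T u : polact T 'X u = T u.
Proof. by rewrite -['X]mul1r polactMX polact1. Qed.

Lemma polactM T p q u : polact T (p * q) u = polact T p (polact T q u).
Proof.
elim/poly_ind: p => [|p c IH]; first by rewrite mul0r !polact0.
by rewrite mulrDl !polactD mul_polyC polactZ polactC -mulrA ['X * q]mulrC mulrA !polactMX IH.
Qed.

Lemma polact_is_linear T p : linear (polact T p).
Proof.
move=> a u v; rewrite /polact scaler_sumr -big_split/=; apply: eq_bigr => i _.
by rewrite iter_linear scalerDr !scalerA mulrC.
Qed.

Lemma polact_comm T S p u : (forall v, T (S v) = S (T v) + v) ->
  polact T p (S u) = S (polact T p u) + polact T p^`() u.
Proof.
move=> TS; elim/poly_ind: p => [|p c IH]; first by rewrite deriv0 !polact0 raddf0 addr0.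
rewrite derivD derivM derivX derivC addr0 mulr1 !polactD !polactMX !polactC IH !raddfD/= TS linearZ/=.
by rewrite -!addrA; congr (_ + _); rewrite addrA addrC; congr (_ + _); exact: addrC.
Qed.

End PolynomialsInEndomorphism.

HB.instance Definition _ (K : fieldType) (V : lmodType K) (T : {linear V -> V}) (p : {poly K}) :=
  GRing.isLinear.Build K V V *:%R (polact T p) (@polact_is_linear K V T p).

Lemma polact_intertwine (K : fieldType) (U V : lmodType K) (S : U -> U) (T : V -> V)
  (h : {linear U -> V}) p u : (forall v, h (S v) = T (h v)) ->
  h (polact S p u) = polact T p (h u).
Proof.
move=> H; rewrite /polact linear_sum; apply: eq_bigr => i _; rewrite linearZ/=; congr (_ *: _).
by elim: (nat_of_ord i) => //= n IH; rewrite H IH.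
Qed.

Section LOperator.
Variables (K : fieldType) (r : nat) (a : nat -> K).

(** A(D) - S, with the multiplication by x left as a parameter [S]: for S = x this is L_0, and for S
    = L_0 it is x again ([Lop_L0e]). *)
Definition Lop (V : lmodType K) (D S : V -> V) (u : V) : V :=
  iter r D u - \sum_(1 <= k < r.-1) a k *: iter k D u - S u.

Lemma Lop_is_linear (V : lmodType K) (D S : {linear V -> V}) : linear (Lop D S).
Proof.
move=> c u v; have E : \sum_(1 <= k < r.-1) a k *: iter k D (c *: u + v) =
  c *: (\sum_(1 <= k < r.-1) a k *: iter k D u) + \sum_(1 <= k < r.-1) a k *: iter k D v.
  rewrite scaler_sumr -big_split/=; apply: eq_bigr => k _.
  by rewrite iter_linear scalerDr !scalerA mulrC.
rewrite /Lop iter_linear linearP E !scalerBr !opprD !addrA; congr (_ + _).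
by rewrite [LHS](ACl (1*3*5*2*4)%AC).
Qed.
HB.instance Definition _ (V : lmodType K) (D S : {linear V -> V}) :=
  GRing.isLinear.Build K V V *:%R (Lop D S) (@Lop_is_linear V D S).

Local Notation W := {poly {poly K}}.
Implicit Types (w : W).

(** In [W] the outer variable stands for d, the inner one for x, with coefficients on the left. The
    ring product of [W] is not the composition of operators; [nfD], [nfL] and [nfpol p] are the left
    compositions with d, L_0 and p(L_0). *)
Definition nfD w : W := w * 'X + map_poly deriv w.

Lemma coef_nfD w k : (nfD w)`_k = (if k == 0 then 0 else w`_k.-1) + (w`_k)^`().
Proof. by rewrite coefD coefMX coef_map_id0 ?deriv0. Qed.

Definition nfL w : W := iter r nfD w - \sum_(1 <= k < r.-1) (a k)%:P *: iter k nfD w - 'X *: w.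

Definition nfpol (p : {poly K}) w : W := \sum_(i < size p) (p`_i)%:P *: iter i nfL w.

Section Act.
Variables (V : lmodType K) (D L : {linear V -> V}).
Hypothesis LD : forall u, L (D u) = D (L u) + u.

(* The formula of [wflat_act]. For [D], [L] the derivation and [L_0] on entire functions it is
   the action of [w^flat]; for [D = mulX] and [L = dX l] on symbols [p] of point functionals
   [delta_l o p(d)] it is right composition with [w]. *)
Definition ract w u := \sum_(k < size w) iter k D (polact L w`_k u).

Lemma ractE n w u : (size w <= n)%N -> ract w u = \sum_(k < n) iter k D (polact L w`_k u).
Proof.
move=> pn; rewrite /ract -(subnKC pn) big_split_ord /= [X in _ + X]big1 ?addr0// => i _.
rewrite nth_default ?leq_addr// polact0.
by elim: (_ + _)%N => //= k ->; rewrite raddf0.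
Qed.

Let iterD k u v : iter k D (u + v) = iter k D u + iter k D v.
Proof. by have := iter_linear D k 1 u v; rewrite !scale1r. Qed.
Let iterZ k c u : iter k D (c *: u) = c *: iter k D u.
Proof.
have i0 : iter k D 0 = 0 by elim: k => //= k ->; rewrite raddf0.
by have := iter_linear D k c u 0; rewrite !addr0 i0 addr0.
Qed.

Lemma ractD w1 w2 u : ract (w1 + w2) u = ract w1 u + ract w2 u.
Proof.
rewrite (ractE _ (size_polyD w1 w2)) (ractE _ (leq_maxl (size w1) (size w2))).
rewrite (ractE _ (leq_maxr (size w1) (size w2))) -big_split/=.
by apply: eq_bigr => i _; rewrite coefD polactD iterD.
Qed.

Lemma ract0 u : ract 0 u = 0. Proof. by rewrite /ract size_poly0 big_ord0. Qed.

Lemma ractZ p w u : ract (p *: w) u = ract w (polact L p u).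
Proof.
rewrite (ractE _ (size_scale_leq p w)) /ract; apply: eq_bigr => i _.
by rewrite coefZ mulrC polactM.
Qed.

Lemma ract_is_linear w : linear (ract w).
Proof.
move=> c u v; rewrite /ract scaler_sumr -big_split/=; apply: eq_bigr => i _.
by rewrite linearP iterD iterZ.
Qed.
HB.instance Definition _ w := GRing.isLinear.Build K V V *:%R (ract w) (ract_is_linear w).

Lemma ractN w u : ract (- w) u = - ract w u.
Proof. by rewrite -[- w]scaleN1r ractZ -polyCN polactC scaleN1r raddfN. Qed.

Lemma ractB w1 w2 u : ract (w1 - w2) u = ract w1 u - ract w2 u.
Proof. by rewrite ractD ractN. Qed.

Lemma ract_sum I (s : seq I) (P : pred I) (F : I -> W) u :
  ract (\sum_(i <- s | P i) F i) u = \sum_(i <- s | P i) ract (F i) u.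
Proof. by apply: (big_morph (fun p => ract p u)) => [p q|]; rewrite ?ractD ?ract0. Qed.

Lemma ractZC c w u : ract (c%:P *: w) u = c *: ract w u.
Proof. by rewrite ractZ polactC linearZ. Qed.

Lemma ract1 u : ract 1 u = u.
Proof. by rewrite /ract size_poly1 big_ord1 coefC/= polact1. Qed.

(** [ract] reverses composition: the factor d on the left of w is the first to act. The hypothesis
    [LD] is the image of d x - x d = 1 under this reversal. *)
Lemma ract_nfD w u : ract (nfD w) u = ract w (D u).
Proof.
have s : (size (nfD w) <= (size w).+1)%N.
  rewrite (leq_trans (size_polyD _ _))// geq_max (leq_trans (size_polyMleq _ _)) ?size_polyX ?addn2//=.
  by rewrite (leq_trans (size_poly _ _)).
rewrite (ractE _ s) (ractE _ (leqnn _)).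
under [RHS]eq_bigr do rewrite (polact_comm _ _ LD) iterD -iterSr.
under [LHS]eq_bigr do rewrite coef_nfD polactD iterD.
rewrite !big_split/= big_ord_recl/= polact0 add0r; congr (_ + _).
by rewrite big_ord_recr/= nth_default// deriv0 polact0 [iter _ _ _](_ : _ = 0) ?addr0//;
  elim: (size w) => //= k ->; rewrite raddf0.
Qed.

Lemma ract_iter_nfD k w u : ract (iter k nfD w) u = ract w (iter k D u).
Proof. by elim: k u => //= k IH u; rewrite ract_nfD IH -iterS iterSr. Qed.

Lemma ract_nfL w u : ract (nfL w) u = ract w (Lop D L u).
Proof.
rewrite /nfL !ractB ract_sum ract_iter_nfD ractZ polactX /Lop !raddfB/=; congr (_ - _ - _).
rewrite linear_sum; apply: eq_bigr => k _.
by rewrite ractZC ract_iter_nfD linearZ.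
Qed.

Lemma ract_nfpol p w u : ract (nfpol p w) u = ract w (polact (Lop D L) p u).
Proof.
have H i v : ract (iter i nfL w) v = ract w (iter i (Lop D L) v).
  by elim: i v => //= i IH v; rewrite ract_nfL IH -iterS iterSr.
by rewrite /nfpol ract_sum /polact linear_sum; apply: eq_bigr => i _; rewrite ractZC H linearZ.
Qed.

Lemma ract_term g b h u : ract (g *: iter b nfD (nfpol h 1)) u = polact (Lop D L) h (iter b D (polact L g u)).
Proof. by rewrite ractZ ract_iter_nfD ract_nfpol ract1. Qed.

End Act.

Lemma ract_intertwine (U V : lmodType K) (D1 L1 : {linear U -> U}) (D2 L2 : {linear V -> V})
  (h : {linear U -> V}) w u : 
  (forall v, h (D1 v) = D2 (h v)) -> (forall v, h (L1 v) = L2 (h v)) ->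
  h (ract D1 L1 w u) = ract D2 L2 w (h u).
Proof.
move=> HD HL; rewrite /ract linear_sum; apply: eq_bigr => i _.
rewrite -(polact_intertwine _ _ HL).
by move: (polact L1 _ u) => v; elim: (nat_of_ord i) => //= n IH; rewrite HD IH.
Qed.

(** * Order, leading and subleading coefficient of polynomials in L_0 *)

Hypothesis hr : (1 < r)%N.

(** The zero subleading coefficient is the point: L_0 has no term d^(r-1), so polynomials in L_0
    contribute nothing one order below the top, and the subleading coefficients of T and S come from
    the terms with b = r - 1 alone. *)
Definition lead (t : nat) (al : K) w :=
  [/\ (size w <= t.+1)%N, w`_t = al%:P & (0 < t)%N -> w`_t.-1 = 0].

Lemma lead_nfD t al w : lead t al w -> lead t.+1 al (nfD w).
Proof.
move=> [s c d]; split=> [||_].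
- apply/leq_sizeP => j jt; rewrite coef_nfD !nth_default ?deriv0 ?addr0; last 2 first.
  + by rewrite (leq_trans s)// ltnW.
  + by rewrite (leq_trans s)//; case: j jt.
  by case: eqP.
- by rewrite coef_nfD/= c (nth_default 0 s) deriv0 addr0.
- rewrite coef_nfD c derivC addr0; case: (t) d => //= n d; exact: d.
Qed.

Lemma lead_iter_nfD b t al w : lead t al w -> lead (b + t) al (iter b nfD w).
Proof. by elim: b => //= b IH h; apply: lead_nfD; exact: IH. Qed.

Lemma leadZ t al c w : lead t al w -> lead t (c * al) (c%:P *: w).
Proof.
move=> [s e d]; split=> [||t0]; first by rewrite (leq_trans (size_scale_leq _ _)).
  by rewrite coefZ e -polyCM.
by rewrite coefZ (d t0) mulr0.
Qed.

Lemma leadD t al be w1 w2 : lead t al w1 -> lead t be w2 -> lead t (al + be) (w1 + w2).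
Proof.
move=> [s1 e1 d1] [s2 e2 d2]; split=> [||t0].
- by rewrite (leq_trans (size_polyD _ _))// geq_max s1.
- by rewrite coefD e1 e2 -polyCD.
- by rewrite coefD d1// d2// addr0.
Qed.

Lemma lead_small t w : (size w <= t.-1)%N -> lead t 0 w.
Proof.
move=> s; split=> [||t0].
- by rewrite (leq_trans s)// (leq_trans (leq_pred _)).
- by rewrite nth_default// (leq_trans s)// leq_pred.
- by rewrite nth_default.
Qed.

Lemma lead_sum t I (s : seq I) (P : pred I) (al : I -> K) (F : I -> W) :
  (forall i, P i -> lead t (al i) (F i)) ->
  lead t (\sum_(i <- s | P i) al i) (\sum_(i <- s | P i) F i).
Proof.
move=> H; apply: (big_ind2 (fun x y => lead t x y)) => //.
- by apply: lead_small; rewrite size_poly0.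
- by move=> x1 x2 y1 y2 h1 h2; have := leadD h1 h2.
Qed.

Lemma lead_nfL t al w : lead t al w -> lead (r + t) al (nfL w).
Proof.
move=> h; rewrite /nfL -[al]addr0 -[al + 0]addr0; case: (h) => s e d.
apply: leadD; first apply: leadD; first exact: lead_iter_nfD.
  apply: lead_small; rewrite size_polyN.
  apply: (leq_trans (size_sum _ _ _)); apply/bigmax_leqP_seq => k.
  rewrite mem_index_iota => /andP[k1 k2] _; rewrite (leq_trans (size_scale_leq _ _))//.
  have [s' _ _] := lead_iter_nfD k h; apply: leq_trans s' _; lia.
apply: lead_small; rewrite size_polyN (leq_trans (size_scale_leq _ _))// (leq_trans s)//.
lia.
Qed.

Lemma lead1 : lead 0 1 (1 : W).
Proof. by split=> //; rewrite ?size_poly1 ?coefC. Qed.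

Lemma lead_nfpol k (p : {poly K}) : (size p <= k.+1)%N -> lead (r * k) p`_k (nfpol p 1).
Proof.
move=> sp; have H i : lead (r * i) 1 (iter i nfL 1).
  by elim: i => [|i IH]; [rewrite muln0; exact: lead1|rewrite mulnS; exact: lead_nfL].
rewrite /nfpol -[p`_k](_ : \sum_(i < size p) (p`_i *+ (i == k :> nat)) = _).
  apply: lead_sum => i _; have [->|ik] := eqVneq (i : nat) k.
    by rewrite -[X in lead _ X _]mulr1; exact: leadZ.
  rewrite mulr0n; apply: lead_small; rewrite (leq_trans (size_scale_leq _ _))//.
  have [s _ _] := H i; apply: leq_trans s _.
  have : (i < k)%N by rewrite ltn_neqAle ik -ltnS (leq_trans (ltn_ord i)).
  nia.
have [kp|kp] := ltnP k (size p).
  rewrite (bigD1 (Ordinal kp))//= eqxx big1 ?addr0// => i /eqP ne.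
  by case: eqP => // e; case: ne; apply: val_inj.
rewrite nth_default// big1// => i _; case: eqP => // e.
by move: (ltn_ord i); rewrite e ltnNge kp.
Qed.

End LOperator.

(** * Wronskians *)

Section Derivation.
Variables (A : comNzRingType) (D : {additive A -> A}).
Hypothesis DM : forall u v, D (u * v) = D u * v + u * D v.

Lemma deriv_one : D 1 = 0.
Proof.
have := DM 1 1; rewrite !mulr1 !mul1r => /(congr1 (fun x => x - D 1)).
by rewrite subrr addrK.
Qed.

Lemma deriv_sign (b : bool) x : D ((-1) ^+ b * x) = (-1) ^+ b * D x.
Proof. by case: b; rewrite ?expr0 ?expr1 ?mul1r ?mulN1r ?raddfN. Qed.

(** An abstract derivation is used because these rules are needed both for polynomials (q and the
    determinant of M) and for Wronskians of entire functions. *)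
Lemma deriv_prod n (F : 'I_n -> A) :
  D (\prod_i F i) = \sum_i \prod_k (if k == i then D (F k) else F k).
Proof.
elim: n F => [|n IH] F; first by rewrite !big_ord0 deriv_one.
rewrite big_ord_recl DM big_ord_recl IH [in RHS]big_ord_recl /= mulr_sumr; congr (_ + _).
apply: eq_bigr => i _; rewrite big_ord_recl /=; congr (_ * _).
Qed.

Lemma deriv_det n (M : 'M[A]_n) :
  D (\det M) = \sum_i \det (\matrix_(k, j) if k == i then D (M k j) else M k j).
Proof.
rewrite /determinant raddf_sum exchange_big /=; apply: eq_bigr => s _.
rewrite deriv_sign deriv_prod mulr_sumr; apply: eq_bigr => i _; congr (_ * _).
by apply: eq_bigr => k _; rewrite mxE.
Qed.

Definition Wr m (f : 'I_m -> A) : 'M[A]_m := \matrix_(i, j) iter i D (f j).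

Definition Wrlast m (f : 'I_m.+1 -> A) : 'M[A]_m.+1 :=
  \matrix_(i, j) if i == ord_max then iter m.+1 D (f j) else iter i D (f j).

(** Differentiating any row but the last one repeats the row below it. *)
Lemma deriv_det_Wr m (f : 'I_m.+1 -> A) : D (\det (Wr f)) = \det (Wrlast f).
Proof.
rewrite deriv_det (bigD1 ord_max)//= big1 ?addr0 => [|i im].
  congr (\det _); apply/matrixP => i j; rewrite !mxE.
  by case: eqVneq => // ->.
have im' : (i.+1 < m.+1)%N.
  by rewrite ltnS ltn_neqAle -ltnS ltn_ord andbT; apply: contra im => /eqP e; apply/eqP/val_inj.
apply: (@determinant_alternate _ _ _ i (Ordinal im')).
  by apply/eqP => /(congr1 val)/= e; lia.
move=> j; rewrite !mxE eqxx /=; case: eqP => // /(congr1 val)/= e; lia.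
Qed.

Section LinearRelation.
Variables (m : nat) (f : 'I_m.+1 -> A) (t : nat -> A).
Hypothesis tf : forall j, \sum_(k < m.+2) t k * iter k D (f j) = 0.

(** Abel's formula without division: the relation writes the row of top derivatives, times -
    t_(m+1), as a row of coefficients times the Wronskian matrix. Multiplying by the adjugate and
    reading the last coordinate is Cramer's rule. *)
Lemma det_Wrlast : t m * \det (Wr f) = - (t m.+1 * \det (Wrlast f)).
Proof.
pose v : 'rV[A]_m.+1 := \row_k t k.
have E : v *m Wr f = - t m.+1 *: \row_j iter m.+1 D (f j).
  apply/rowP => j; rewrite !mxE; apply/eqP; rewrite -subr_eq0 mulNr opprK; apply/eqP.
  rewrite -[RHS](tf j) [in RHS]big_ord_recr/=; congr (_ + _).
  by apply: eq_bigr => k _; rewrite !mxE.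
have := congr1 (fun w : 'rV_m.+1 => (w *m \adj (Wr f)) 0 ord_max) E.
rewrite -mulmxA mul_mx_adj mul_mx_scalar mxE mxE mulrC => ->.
rewrite -scalemxAl mxE mulNr; congr (- (_ * _)).
rewrite (expand_det_row _ ord_max) mxE; apply: eq_bigr => j _; rewrite !mxE eqxx.
congr (_ * _); rewrite /cofactor; congr (_ * \det _); apply/matrixP => i k; rewrite !mxE.
by case: eqP => // e; have := neq_lift ord_max i; rewrite e eqxx.
Qed.
End LinearRelation.

Definition ext m (f : 'I_m -> A) (u : A) : 'I_m.+1 -> A :=
  fun k => if unlift ord_max k is Some k' then f k' else u.

(** The same device identifies an operator of order m that kills all f_j with u |-> Wr(f, u), up to
    the two leading coefficients. *)
Lemma det_Wr_ext m (f : 'I_m -> A) (t : nat -> A) u :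
  (forall j, \sum_(k < m.+1) t k * iter k D (f j) = 0) ->
  t m * \det (Wr (ext f u)) = (\sum_(k < m.+1) t k * iter k D u) * \det (Wr f).
Proof.
move=> tf; pose v : 'rV[A]_m.+1 := \row_k t k.
have E : v *m Wr (ext f u) = (\sum_(k < m.+1) t k * iter k D u) *: delta_mx 0 ord_max.
  apply/rowP => j; rewrite !mxE eqxx /=.
  under eq_bigr do rewrite !mxE.
  rewrite /ext; case: unliftP => [j' ->|->]; last by rewrite eqxx mulr1.
  by rewrite tf eq_sym (negbTE (neq_lift _ _)) mulr0.
have := congr1 (fun w : 'rV_m.+1 => (w *m \adj (Wr (ext f u))) 0 ord_max) E.
rewrite -mulmxA mul_mx_adj mul_mx_scalar mxE mxE mulrC => ->.
rewrite -scalemxAl mxE; congr (_ * _).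
rewrite mxE (bigD1 ord_max)//= big1 ?addr0 => [|j jm]; last by rewrite !mxE (negbTE jm) andbF mul0r.
rewrite !mxE !eqxx mul1r /cofactor addnn -signr_odd odd_double mul1r; congr (\det _).
by apply/matrixP => i j; rewrite !mxE /ext liftK lift_max.
Qed.

End Derivation.

(** * The Calogero-Moser construction *)

Section PointModule.
Variable K : fieldType.
Implicit Types (l c : K) (p q : {poly K}).

Definition mulX p : {poly K} := 'X * p.
Lemma mulX_is_linear : linear mulX.
Proof. by move=> c p q; rewrite /mulX mulrDr scalerAr. Qed.
HB.instance Definition _ := GRing.isLinear.Build K {poly K} {poly K} *:%R mulX mulX_is_linear.

(* [delta_l o p(d) o x = delta_l o (dX l p)(d)]. *)
Definition dX l p := l *: p + p^`().
Lemma dX_is_linear l : linear (dX l).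
Proof.
by move=> c p q; rewrite /dX derivD derivZ !scalerDr !scalerA (mulrC l) addrACA.
Qed.
HB.instance Definition _ l := GRing.isLinear.Build K {poly K} {poly K} *:%R (dX l) (dX_is_linear l).

Lemma dX_mulX l p : dX l (mulX p) = mulX (dX l p) + p.
Proof.
by rewrite /dX /mulX derivM derivX mul1r mulrDr scalerAr -addrA (addrC p).
Qed.

Lemma iter_mulX k p : iter k mulX p = 'X^k * p.
Proof. by elim: k => [|k IH]; rewrite ?mul1r//= IH /mulX exprS mulrA. Qed.

Lemma polact_dX_const l q c : polact (dX l) q c%:P = (q.[l] * c)%:P.
Proof.
elim/poly_ind: q => [|q d IH]; first by rewrite polact0 horner0 mul0r.
rewrite polactD polactMX polactC IH /= /dX derivC addr0 -!mul_polyC -!polyCM -polyCD !hornerE.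
by congr (_%:P); rewrite /=; ring.
Qed.

Lemma polact_dX_deg1 l q c : polact (dX l) q ('X + c%:P) = q.[l] *: ('X + c%:P) + (q^`().[l])%:P.
Proof.
elim/poly_ind: q => [|q d IH]; first by rewrite polact0 deriv0 !horner0 scale0r addr0.
rewrite polactD polactMX polactC IH /= /dX !(derivD, derivZ, derivM, derivX, derivC) !hornerE.
by rewrite -!mul_polyC !(rmorphD, rmorphM)/= ?addr0; ring.
Qed.

Lemma polact_dX_exp l k p : polact (dX l) (('X - l%:P) ^+ k) p = p^`(k).
Proof.
elim: k p => [|k IH] p; first by rewrite polact1.
by rewrite exprSr polactM polactB polactX polactC /dX addrAC subrr add0r IH derivSn.
Qed.

(** Since [dX l] is l + d/dX, the operator q(dX l) expands as q(l) + q'(l) d/dX + ..., and only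
    these two terms reach the two top degrees. *)
Lemma polact_dX_lead l q p d : (size p <= d.+1)%N ->
  [/\ (size (polact (dX l) q p) <= d.+1)%N,
      (polact (dX l) q p)`_d = q.[l] * p`_d &
      (0 < d)%N -> (polact (dX l) q p)`_d.-1 = q.[l] * p`_d.-1 + q^`().[l] * (p`_d *+ d)].
Proof.
move=> sp; elim/poly_ind: q => [|q c [s e1 e2]].
  by rewrite polact0 deriv0 !horner0 !mul0r addr0 !coef0 size_poly0.
rewrite polactD polactMX polactC /= {1 3 5}/dX !(derivD, derivM, derivX, derivC) !hornerE; split.
- rewrite (leq_trans (size_polyD _ _))// geq_max (leq_trans (size_scale_leq _ _))// andbT.
  rewrite (leq_trans (size_polyD _ _))// geq_max (leq_trans (size_scale_leq _ _))//=.
  by rewrite (leq_trans (size_poly _ _))// (leq_trans (leq_pred _)).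
- rewrite !coefD !coefZ coef_deriv e1 (nth_default 0 s) ?mul0rn ?addr0.
  by ring.
- case: d sp s e1 e2 => // d sp s e1 /(_ isT) e2 _.
  by rewrite !coefD !coefZ coef_deriv e2 e1 /= ?addr0; ring.
Qed.

End PointModule.

Section CalogeroMoser.
Variables (K : fieldType) (r : nat) (a : nat -> K) (n' : nat).
Local Notation n := n'.+1.
Local Notation nfD := (@nfD K).
Variables (lam gam : 'I_n -> K).
Hypotheses (hr : (1 < r)%N) (lamI : injective lam).

Definition qpol : {poly K} := \prod_(i < n) ('X - (lam i)%:P).
Definition hpol j : {poly K} := \prod_(i < n | i != j) ('X - (lam i)%:P).

Lemma qpolE j : qpol = hpol j * ('X - (lam j)%:P).
Proof. by rewrite /qpol (bigD1 j)//= mulrC. Qed.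

Lemma qpol_root i : qpol.[lam i] = 0.
Proof. by rewrite (qpolE i) !hornerE subrr mulr0. Qed.

Lemma hpol_neq0 i : (hpol i).[lam i] != 0.
Proof.
rewrite horner_prod; apply/prodf_neq0 => j ji; rewrite !hornerE subr_eq0 (inj_eq lamI).
by rewrite eq_sym.
Qed.

Lemma qpol_deriv : qpol^`() = \sum_j hpol j.
Proof.
rewrite /qpol (@deriv_prod _ _ (@derivM K)); apply: eq_bigr => j _.
rewrite (bigD1 j)//= eqxx derivXsubC mul1r; apply: eq_bigr => i ij.
by rewrite (negbTE ij).
Qed.

Lemma hpol_root i j : j != i -> (hpol j).[lam i] = 0.
Proof. by move=> ji; rewrite /hpol (bigD1 i) 1?eq_sym//= !hornerE subrr mul0r. Qed.

Lemma qpol_deriv_root i : qpol^`().[lam i] = (hpol i).[lam i].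
Proof.
rewrite qpol_deriv horner_sum (bigD1 i)//= big1 ?addr0// => j; exact: hpol_root.
Qed.

Lemma hpol_deriv_root i j : j != i ->
  (hpol j)^`().[lam i] = (hpol i).[lam i] / (lam i - lam j).
Proof.
move=> ji; have := congr1 (fun p => p^`().[lam i]) (qpolE j).
rewrite /= qpol_deriv_root derivM derivXsubC mulr1 !hornerE (hpol_root ji) addr0 => ->.
by rewrite mulfK// subr_eq0 (inj_eq lamI) eq_sym.
Qed.

Lemma size_hpol j : size (hpol j) = n.
Proof.
rewrite /hpol size_prod => [|i _]; last by rewrite polyXsubC_eq0.
under eq_bigr do rewrite size_XsubC.
have := cardC1 j; rewrite card_ord => H.
by rewrite sum_nat_const H /=; lia.
Qed.

Lemma hpol_monic j : (hpol j) \is monic.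
Proof. by apply: monic_prod => i _; exact: monicXsubC. Qed.

Lemma qpol_monic : qpol \is monic.
Proof. by apply: monic_prod => i _; exact: monicXsubC. Qed.

Lemma size_qpol : size qpol = n.+1.
Proof. by rewrite /qpol size_prod_XsubC /index_enum -enumT size_enum_ord. Qed.

(* [Ymx], [Emx], [Bmx] and [gvec] solve the linear system which says that the point functionals
   [delta_(lam i) o (d + gam i)] annihilate the image of [Scm] (see [gpol_pred], [gpol_zero]). *)
Definition Ymx : 'M[K]_n := \matrix_(i, j)
  if i == j then gam i + (hpol i)^`().[lam i] / (hpol i).[lam i] else (lam i - lam j)^-1.

Definition acoef b := if (0 < b < r.-1)%N then a b else 0.

(** Horner's scheme for A at - Y: with E_b = [Emx b] one has A(d) - A(- Y) = (d + Y) \sum_(b < r)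
    d^b E_b, and in particular - Y E_0 = A(- Y), so that [Bmx] is Lam - A(- Y). *)
Fixpoint emx k : 'M[K]_n :=
  if k is k'.+1 then - (Ymx *m emx k') - (acoef (r.-1 - k'))%:M else 1%:M.

Definition Emx b := emx (r.-1 - b).
Definition Bmx := diag_mx (\row_i lam i) + Ymx *m Emx 0.
Definition Mmx : 'M[{poly K}]_n := 'X%:M + map_mx polyC Bmx.
Definition tau0 := \det Mmx.
Definition gvec : 'cV[{poly K}]_n := \adj Mmx *m const_mx 1.
Definition gpol j b := (map_mx polyC (Emx b) *m gvec) j 0.

Lemma emx_comm k : Ymx *m emx k = emx k *m Ymx.
Proof.
elim: k => [|k IH]; first by rewrite /= mulmx1 mul1mx.
by rewrite /= mulmxBr mulmxBl mulmxN mulNmx scalar_mxC {1}IH mulmxA.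
Qed.

Lemma tau0_char : tau0 = char_poly (- Bmx).
Proof. by rewrite /tau0 /char_poly /char_poly_mx map_mxN opprK. Qed.

Lemma tau0_monic : tau0 \is monic.
Proof. by rewrite tau0_char char_poly_monic. Qed.

Lemma size_tau0 : size tau0 = n.+1.
Proof. by rewrite tau0_char size_char_poly. Qed.

Lemma gvecE i : 'X * gvec i 0 + \sum_j (Bmx i j)%:P * gvec j 0 = tau0.
Proof.
have : Mmx *m gvec = tau0 *: const_mx 1 by rewrite mulmxA mul_mx_adj mul_scalar_mx.
move=> /(congr1 (fun m : 'cV_n => m i 0)); rewrite mulmxDl mul_scalar_mx !mxE mulr1 => <-.
by congr (_ + _); apply: eq_bigr => j _; rewrite !mxE.
Qed.

(** Descending induction on k from beyond all degrees: [gvecE] in degree k + 1 expresses the k-th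
    coefficients through those of index k + 1, and the determinant has degree n. *)
Lemma gvec_coef k i : (n <= k)%N -> (gvec i 0)`_k = 0.
Proof.
pose m := \max_i size (gvec i 0%R).
have H d : forall k i, (n <= k)%N -> (m <= k + d)%N -> (gvec i 0)`_k = 0.
  elim: d => [|d IH] {}k {}i nk mk.
    rewrite addn0 in mk; rewrite nth_default//; apply: leq_trans mk.
    exact: (@leq_bigmax _ (fun i => size (gvec i 0%R))).
  have := congr1 (fun p : {poly K} => p`_k.+1) (gvecE i).
  rewrite /= coefD coefXM/= coef_sum big1 ?addr0 => [->|j _].
    by rewrite nth_default// size_tau0.
  rewrite coefCM IH ?mulr0 //; lia.
by move=> nk; apply: (H m) => //; rewrite leq_addl.
Qed.

Lemma size_gvec i : (size (gvec i 0%R) <= n)%N.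
Proof. by apply/leq_sizeP => k nk; rewrite gvec_coef. Qed.

Lemma gvec_lead i : (gvec i 0)`_n' = 1.
Proof.
have := congr1 (fun p : {poly K} => p`_n) (gvecE i).
rewrite /= coefD coefXM/= coef_sum big1 ?addr0 => [->|j _].
  by have /monicP := tau0_monic; rewrite /lead_coef size_tau0.
by rewrite coefCM gvec_coef ?mulr0.
Qed.

Lemma size_gpol j b : (size (gpol j b) <= n)%N.
Proof.
rewrite /gpol mxE (leq_trans (size_sum _ _ _))//; apply/bigmax_leqP => i _.
by rewrite mxE mul_polyC (leq_trans (size_scale_leq _ _))// size_gvec.
Qed.

Lemma gpol_top j : gpol j r.-1 = gvec j 0.
Proof. by rewrite /gpol /Emx subnn map_mx1 mul1mx. Qed.

Lemma Ygpol i b : \sum_j (Ymx i j)%:P * gpol j b = (map_mx polyC (Ymx *m Emx b) *m gvec) i 0.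
Proof.
rewrite map_mxM -mulmxA [RHS]mxE; apply: eq_bigr => j _.
by rewrite [X in _ = X * _]mxE.
Qed.

Lemma gpol_pred i b : (0 < b < r)%N ->
  \sum_j (Ymx i j)%:P * gpol j b + gpol i b.-1 + (acoef b)%:P * gvec i 0 = 0.
Proof.
move=> /andP[b0 br]; rewrite Ygpol.
have -> : gpol i b.-1 = (map_mx polyC (- (Ymx *m Emx b) - (acoef b)%:M) *m gvec) i 0.
  rewrite /gpol /Emx (_ : (r.-1 - b.-1)%N = (r.-1 - b).+1); last by lia.
  by rewrite /= (_ : (r.-1 - (r.-1 - b))%N = b)//; lia.
rewrite map_mxB map_mxN map_scalar_mx mulmxBl mulNmx mul_scalar_mx !mxE.
by ring.
Qed.

Lemma gpol_zero i : \sum_j (Ymx i j)%:P * gpol j 0 + ('X + (lam i)%:P) * gvec i 0 = tau0.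
Proof.
have E : \sum_j (Bmx i j)%:P * gvec j 0 =
  (lam i)%:P * gvec i 0 + (map_mx polyC (Ymx *m Emx 0) *m gvec) i 0.
  transitivity ((map_mx polyC Bmx *m gvec) i 0).
    by rewrite [RHS]mxE; apply: eq_bigr => j _; rewrite [X in _ = X * _]mxE.
  rewrite /Bmx map_mxD mulmxDl [LHS]mxE; congr (_ + _).
  by rewrite map_diag_mx mul_diag_mx !mxE.
by rewrite Ygpol -(gvecE i) E; ring.
Qed.

Lemma comm_diag_Y : diag_mx (\row_i lam i) *m Ymx - Ymx *m diag_mx (\row_i lam i) =
  const_mx 1 - 1%:M.
Proof.
apply/matrixP => i j; rewrite mul_diag_mx mul_mx_diag !mxE.
case: eqVneq => [->|ij]; first by rewrite mulrC !subrr.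
rewrite subr0 mulrC -mulrBr mulVf// subr_eq0 (inj_eq lamI)//.
Qed.

(* With M = x + B, the rank one matrix 1 1^T equals 1 + [M, Y], and tr (adj M [M, Y]) = 0. *)
Lemma sum_gvec : \sum_j gvec j 0 = tau0^`().
Proof.
pose P := map_mx (polyC : K -> {poly K}) Ymx.
have E : (const_mx 1 : 'M[{poly K}]_n) = 1%:M + (Mmx *m P - P *m Mmx).
  have -> : Mmx *m P - P *m Mmx = map_mx polyC (const_mx 1 - 1%:M).
    rewrite -comm_diag_Y /Mmx mulmxDl mulmxDr scalar_mxC opprD addrACA subrr add0r.
    rewrite -!map_mxM -map_mxB /Bmx mulmxDl mulmxDr; congr (map_mx _ _).
    by rewrite opprD addrACA -mulmxA -emx_comm subrr addr0.
  by rewrite map_mxB map_mx1 map_const_mx addrC subrK.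
have trE : \sum_j gvec j 0 = \tr (\adj Mmx *m const_mx 1).
  apply: eq_bigr => j _; rewrite !mxE; apply: eq_bigr => k _; by rewrite !mxE.
rewrite trE E mulmxDr mulmx1 mulmxBr raddfD raddfB /= !mulmxA mul_adj_mx.
rewrite [\tr (\adj _ *m _ *m _)]mxtrace_mulC mulmxA mul_mx_adj subrr addr0.
rewrite /tau0 (@deriv_det _ _ (@derivM K)); apply: eq_bigr => i _; rewrite mxE.
rewrite (expand_det_row _ i) (bigD1 i)//= big1 ?addr0 => [|j ji].
  rewrite !mxE !eqxx derivD derivX derivC addr0 mul1r /cofactor; congr (_ * \det _).
  apply/matrixP => k j; rewrite !mxE; have := neq_lift i k; rewrite eq_sym => /negbTE->.
  by [].
by rewrite !mxE eqxx eq_sym (negbTE ji) mulr0n add0r derivC mul0r.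
Qed.

(** * The operators T and S, their top coefficients, and the functionals annihilating the image of
    S *)

Definition Tcm : {poly {poly K}} := tau0 *: nfpol r a qpol 1
  - \sum_(b < r) \sum_(j < n) gpol j b *: iter b nfD (nfpol r a (hpol j) 1).
Definition Scm : {poly {poly K}} := qpol *: nfpol r a tau0 1
  - \sum_(b < r) \sum_(j < n) hpol j *: iter b nfD (nfpol r a (gpol j b) 1).

(** The pattern of the operator u |-> kappa Wr(f_1, ..., f_N, u) with kappa Wr(f) = t: its two top
    coefficients are t and - t'. *)
Definition is_top (N : nat) (t : {poly K}) (w : {poly {poly K}}) :=
  [/\ (size w <= N.+1)%N, w`_N = t & w`_N.-1 = - t^`()].

(** One statement for both operators, since T and S differ by exchanging (tau_0, g) with (q, h). *)
Lemma is_top_cm (t q : {poly K}) (g h : 'I_r -> 'I_n -> {poly K}) :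
  size q = n.+1 -> q \is monic -> (forall b j, (size (h b j) <= n)%N) ->
  (forall (b : 'I_r) j, b = r.-1 :> nat -> (h b j)`_n' = 1) ->
  (forall b : 'I_r, b = r.-1 :> nat -> \sum_j g b j = t^`()) ->
  is_top (r * n) t (t *: nfpol r a q 1
     - \sum_(b < r) \sum_(j < n) g b j *: iter b nfD (nfpol r a (h b j) 1)).
Proof.
move=> sq mq sh lh gt.
have [s1 e1 d1] : lead (r * n) 1 (nfpol r a q 1).
  have -> : 1 = q`_n by have /monicP := mq; rewrite /lead_coef sq.
  by apply: lead_nfpol => //; rewrite sq.
have H (b : 'I_r) j : lead (b + r * n') (h b j)`_n' (iter b nfD (nfpol r a (h b j) 1)).
  by apply: lead_iter_nfD; apply: lead_nfpol.
have N0 : (0 < r * n)%N by rewrite muln_gt0; lia.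
have sz (b : 'I_r) j : (size (g b j *: iter b nfD (nfpol r a (h b j) 1)) <= r * n)%N.
  have [s _ _] := H b j; rewrite (leq_trans (size_scale_leq _ _))// (leq_trans s)//.
  by have := ltn_ord b; rewrite mulnS; lia.
have szS : (size (\sum_(b < r) \sum_(j < n) g b j *: iter b nfD (nfpol r a (h b j) 1))%R <= r * n)%N.
  apply: (leq_trans (size_sum _ _ _)); apply/bigmax_leqP => b _.
  by apply: (leq_trans (size_sum _ _ _)); apply/bigmax_leqP => j _.
have cf (b : 'I_r) j : (g b j *: iter b nfD (nfpol r a (h b j) 1))`_((r * n).-1) =
    if b == r.-1 :> nat then g b j else 0.
  have [s e _] := H b j; case: eqP => [eb|nb].
    rewrite coefZ (_ : (r * n).-1 = (b + r * n')%N) ?e ?lh ?mulr1//.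
    by rewrite eb mulnS; lia.
  by rewrite nth_default// (leq_trans (size_scale_leq _ _))// (leq_trans s)//;
     have := ltn_ord b; rewrite mulnS; lia.
split.
- rewrite (leq_trans (size_polyD _ _))// size_polyN geq_max (leq_trans (size_scale_leq _ _))//=.
  by rewrite (leq_trans szS).
- by rewrite coefB coefZ e1 (nth_default _ szS) subr0 mulr1.
- rewrite coefB coefZ d1// mulr0 sub0r coef_sum; congr (- _).
  have rr : (r.-1 < r)%N by lia.
  rewrite (bigD1 (Ordinal rr))//= [X in _ + X]big1 ?addr0.
    rewrite coef_sum -(gt (Ordinal rr))//; apply: eq_bigr => j _.
    by rewrite (cf (Ordinal rr)) eqxx.
  move=> b nb; rewrite coef_sum big1// => j _; rewrite cf.
  by case: eqP => // e; case/eqP: nb; apply: val_inj.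
Qed.

Lemma Tcm_top : is_top (r * n) tau0 Tcm.
Proof.
apply: (is_top_cm (g := fun b j => gpol j b) (h := fun b j => hpol j)).
- exact: size_qpol.
- exact: qpol_monic.
- by move=> b j; rewrite size_hpol.
- by move=> b j _; have /monicP := hpol_monic j; rewrite /lead_coef size_hpol.
- by move=> b ->; rewrite -sum_gvec; apply: eq_bigr => j _; rewrite gpol_top.
Qed.

Lemma Scm_top : is_top (r * n) qpol Scm.
Proof.
apply: (is_top_cm (g := fun b j => hpol j) (h := fun b j => gpol j b)).
- exact: size_tau0.
- exact: tau0_monic.
- by move=> b j; rewrite size_gpol.
- by move=> b j ->; rewrite gpol_top gvec_lead.
- by move=> b _; rewrite qpol_deriv.
Qed.

(** Eliminates the one power of d that exceeds r - 1: d^r = L_0 + x + \sum_k a_k d^k, and x becomes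
    lam_i under the evaluation at lam_i. *)
Lemma polact_Xr i (g : {poly K}) (RR := Lop r a (@mulX K) (dX (lam i))) :
  polact RR g 'X^r = polact RR (g * ('X + (lam i)%:P)) 1
    + \sum_(b < r.-1) acoef b.+1 *: polact RR g 'X^(b.+1).
Proof.
have XrE : 'X^r = RR 1 + (lam i)%:P + \sum_(1 <= k < r.-1) a k *: 'X^k.
  rewrite /RR /Lop !iter_mulX mulr1 /dX derivC addr0 -mul_polyC mulr1.
  under eq_bigr do rewrite iter_mulX mulr1.
  by rewrite subrK subrK.
have key (T : {linear {poly K} -> {poly K}}) :
    'X^r = T 1 + (lam i)%:P + \sum_(1 <= k < r.-1) a k *: 'X^k ->
    polact T g 'X^r = polact T (g * ('X + (lam i)%:P)) 1
    + \sum_(b < r.-1) acoef b.+1 *: polact T g 'X^(b.+1).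
  move=> ->; rewrite linearD linear_sum /= polactM polactD polactX polactC alg_polyC; congr (_ + _).
  rewrite /acoef; case: (r) hr => [//|[//|r'']] _ /=.
  rewrite big_add1 big_mkord [RHS]big_ord_recr /= ltnn scale0r addr0.
  by apply: eq_bigr => b _; rewrite linearZ/= ltnS ltn_ord.
exact: key XrE.
Qed.

(** Put k = h_i(lam_i). Composed with q, the functional delta_(lam_i) o (d + gam_i) becomes k
    delta_(lam_i); composed with h_j it becomes k delta_(lam_i) o ([i = j] d + Y_ij). After the
    reduction of d^r, the coefficients of d^b cancel by [gpol_pred] for 0 < b < r and by [gpol_zero]
    for b = 0. *)
Lemma Scm_kills i : ract (@mulX K) (dX (lam i)) Scm ('X + (gam i)%:P) = 0.
Proof.
have LD := dX_mulX (lam i).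
pose RR := Lop r a (@mulX K) (dX (lam i)); pose k := (hpol i).[lam i].
have k0 : k != 0 := hpol_neq0 i.
have E0 : polact (dX (lam i)) qpol ('X + (gam i)%:P) = k *: 1.
  by rewrite polact_dX_deg1 qpol_root scale0r add0r qpol_deriv_root alg_polyC.
have Ej j : polact (dX (lam i)) (hpol j) ('X + (gam i)%:P) =
    k *: ((if j == i then 'X else 0) + (Ymx i j)%:P).
  rewrite polact_dX_deg1 /Ymx mxE; have [->|ji] := eqVneq j i.
    rewrite -/k; set d := _^`().[_].
    have dk : d = k * (d / k) by rewrite mulrC mulfVK.
    by rewrite polyCD -!mul_polyC {1}dk polyCM; ring.
  rewrite hpol_root// scale0r !add0r hpol_deriv_root//.
  by rewrite -mul_polyC -polyCM.
have term b j : ract (@mulX K) (dX (lam i)) (hpol j *: iter b nfD (nfpol r a (gpol j b) 1)) ('X + (gam i)%:P)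
   = k *: (polact RR ((Ymx i j)%:P * gpol j b) 'X^b + (if j == i then polact RR (gpol i b) 'X^(b.+1) else 0)).
  rewrite (ract_term _ _ LD) Ej iter_mulX -scalerAr linearZ /= -/RR; congr (_ *: _).
  have aux (T : {linear {poly K} -> {poly K}}) : polact T (gpol j b) ('X^b * ((if j == i then 'X else 0) + (Ymx i j)%:P)) =
    polact T ((Ymx i j)%:P * gpol j b) 'X^b + (if j == i then polact T (gpol i b) 'X^(b.+1) else 0).
    rewrite mulrDr linearD/= addrC; congr (_ + _).
      by rewrite ['X^b * _]mulrC !mul_polyC linearZ/= polactZ.
    by case: eqP => [->|_]; rewrite ?mulr0 ?raddf0// exprSr.
  exact: aux.
rewrite /Scm ractB ractZ E0 linearZ/= (ract_nfpol _ _ LD) ract1 -/RR; apply/eqP; rewrite subr_eq0; apply/eqP.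
rewrite ract_sum; under eq_bigr do rewrite ract_sum.
under eq_bigr do (under eq_bigr do rewrite term; rewrite -scaler_sumr big_split/= -polact_sum).
rewrite -scaler_sumr; congr (_ *: _).
transitivity (\sum_(b < r) (polact RR (\sum_j (Ymx i j)%:P * gpol j b) 'X^b + polact RR (gpol i b) 'X^(b.+1))); last first.
  by apply: eq_bigr => b _; congr (_ + _); rewrite -big_mkcond big_pred1_eq.
have split_l (F : nat -> {poly K}) : \sum_(b < r) F b = F 0 + \sum_(b < r.-1) F b.+1.
  by case: (r) hr => // s _; rewrite big_ord_recl.
have split_r (F : nat -> {poly K}) : \sum_(b < r) F b = \sum_(b < r.-1) F b + F r.-1.
  by case: (r) hr => // s _; rewrite big_ord_recr.
rewrite big_split/= (split_l (fun b => polact RR (\sum_j (Ymx i j)%:P * gpol j b) 'X^b)).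
rewrite (split_r (fun b => polact RR (gpol i b) 'X^(b.+1))) gpol_top prednK; last by lia.
rewrite polact_Xr -(gpol_zero i) polactD expr0 -addrA; congr (_ + _).
have Z : \sum_(b < r.-1) polact RR (\sum_j (Ymx i j)%:P * gpol j b.+1) 'X^(b.+1)
    + \sum_(b < r.-1) polact RR (gpol i b) 'X^(b.+1)
    + \sum_(b < r.-1) acoef b.+1 *: polact RR (gvec i 0) 'X^(b.+1) = 0.
  rewrite -!big_split/= big1// => b _; rewrite -polactZ -!polactD -mul_polyC.
  by rewrite [X in polact _ X](@gpol_pred i b.+1) ?polact0//=; have := ltn_ord b; lia.
rewrite [X in _ = _ + (_ + (polact _ X _ + _))]mulrC.
by rewrite -[LHS]add0r -[X in X + _ = _]Z; ring.
Qed.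

End CalogeroMoser.

(** * The differential ring of entire functions *)

Section Entire.
Variable R : realType.
Local Notation C := (R[i]).

Lemma cdiffM (f g : C -> C) z l m : cdiff f z l -> cdiff g z m ->
  cdiff (fun w => f w * g w) z (l * g z + f z * m).
Proof.
move=> H1 H2; have h1 := (cdiffP f z l).2 H1; have h2 := (cdiffP g z m).2 H2.
refine ((cdiffP _ _ _).1 _).
have := is_deriveM h1 h2; rewrite /GRing.scale /=.
by rewrite addrC [g z * l]mulrC.
Qed.

Lemma cdiffD (f g : C -> C) z l m : cdiff f z l -> cdiff g z m ->
  cdiff (fun w => f w + g w) z (l + m).
Proof. by move=> /cdiffP h1 /cdiffP h2; apply/cdiffP; exact: is_deriveD. Qed.

Record Ent := MkEnt { ev :> C -> C; entE : entire ev }.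

Lemma ent_eq (u v : Ent) : (forall x, u x = v x) -> u = v.
Proof.
case: u v => u hu [v hv] /= E; have E2 : u = v by apply/funext.
by subst v; congr MkEnt; exact: Prop_irrelevance.
Qed.

HB.instance Definition _ := gen_eqMixin Ent.
HB.instance Definition _ := gen_choiceMixin Ent.

Lemma entire_cst (c : C) : entire (fun=> c).
Proof. by move=> z; exact: cdf_cst. Qed.
Lemma entire_add (u v : Ent) : entire (fun x => u x + v x).
Proof. by move=> z; apply: cdfD; exact: entE. Qed.
Lemma entire_mul (u v : Ent) : entire (fun x => u x * v x).
Proof. by move=> z; apply: cdfM; exact: entE. Qed.
Lemma entire_opp (u : Ent) : entire (fun x => - u x).
Proof.
move=> z; have -> : (fun x => - u x) = (fun x => (fun=> -1 : C) x * u x).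
  by apply/funext => x; rewrite mulN1r.
by apply: cdfM; [exact: cdf_cst|exact: entE].
Qed.
Lemma entire_horner (p : {poly C}) : entire (horner p).
Proof.
elim/poly_ind: p => [|p c IH] z.
  have -> : horner (0 : {poly C}) = (fun=> 0) by apply/funext => w; rewrite horner0.
  exact: cdf_cst.
have -> : horner (p * 'X + c%:P) = (fun w => p.[w] * w + c).
  by apply/funext => w; rewrite hornerMXaddC.
apply: cdfD; last exact: cdf_cst.
by apply: cdfM; [exact: IH|exact: cdf_id].
Qed.

Definition ecst c := MkEnt (@entire_cst c).
Definition eadd u v := MkEnt (@entire_add u v).
Definition emul u v := MkEnt (@entire_mul u v).
Definition eopp u := MkEnt (@entire_opp u).
Definition iotaE (p : {poly C}) := MkEnt (@entire_horner p).

Definition De (u : Ent) : Ent := MkEnt (@entire_dn1 R u (@entE u)).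

Lemma De_cdiff (u : Ent) x : cdiff u x (De u x).
Proof. exact: (@dn_cdiff R u (@entE u) x). Qed.

Lemma De_eq (u v : Ent) : (forall x, cdiff u x (v x)) -> De u = v.
Proof. by move=> H; apply: ent_eq => x; apply: cdiff_uniq (H x); exact: De_cdiff. Qed.

Lemma De_emul u v : De (emul u v) = eadd (emul (De u) v) (emul u (De v)).
Proof. exact: (@De_eq (emul u v) (eadd (emul (De u) v) (emul u (De v))) (fun x => cdiffM (De_cdiff u x) (De_cdiff v x))). Qed.

Lemma De_eadd u v : De (eadd u v) = eadd (De u) (De v).
Proof. exact: (@De_eq (eadd u v) (eadd (De u) (De v)) (fun x => cdiffD (De_cdiff u x) (De_cdiff v x))). Qed.

Lemma eaddA : associative eadd. Proof. by move=> u v w; apply: ent_eq => x /=; rewrite addrA. Qed.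
Lemma eaddC : commutative eadd. Proof. by move=> u v; apply: ent_eq => x /=; rewrite addrC. Qed.
Lemma eadd0 : left_id (ecst 0) eadd. Proof. by move=> u; apply: ent_eq => x /=; rewrite add0r. Qed.
Lemma eaddN : left_inverse (ecst 0) eopp eadd. Proof. by move=> u; apply: ent_eq => x /=; rewrite addNr. Qed.
HB.instance Definition _ := GRing.isZmodule.Build Ent eaddA eaddC eadd0 eaddN.

Lemma emulA : associative emul. Proof. by move=> u v w; apply: ent_eq => x /=; rewrite mulrA. Qed.
Lemma emulC : commutative emul. Proof. by move=> u v; apply: ent_eq => x /=; rewrite mulrC. Qed.
Lemma emul1 : left_id (ecst 1) emul. Proof. by move=> u; apply: ent_eq => x /=; rewrite mul1r. Qed.
Lemma emulD : left_distributive emul eadd. Proof. by move=> u v w; apply: ent_eq => x /=; rewrite mulrDl. Qed.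
Lemma eone_neq0 : ecst 1 != 0 :> Ent.
Proof. by apply/eqP => /(congr1 (fun u : Ent => u 0)) /= /eqP; rewrite oner_eq0. Qed.
HB.instance Definition _ := GRing.Zmodule_isComNzRing.Build Ent emulA emulC emul1 emulD eone_neq0.

Definition escale (c : C) (u : Ent) : Ent := ecst c * u.
Lemma escaleA a b u : escale a (escale b u) = escale (a * b) u.
Proof. by apply: ent_eq => x /=; rewrite mulrA. Qed.
Lemma escale1 : left_id 1 escale. Proof. by move=> u; apply: ent_eq => x /=; rewrite mul1r. Qed.
Lemma escaleDr : right_distributive escale +%R.
Proof. by move=> c u v; apply: ent_eq => x /=; rewrite mulrDr. Qed.
Lemma escaleDl v : {morph escale^~ v : a b / a + b}.
Proof. by move=> a b; apply: ent_eq => x /=; rewrite mulrDl. Qed.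
HB.instance Definition _ := GRing.Zmodule_isLmodule.Build C Ent escaleA escale1 escaleDr escaleDl.

Lemma evD (u v : Ent) x : (u + v) x = u x + v x. Proof. by []. Qed.
Lemma evM (u v : Ent) x : (u * v) x = u x * v x. Proof. by []. Qed.
Lemma evB (u v : Ent) x : (u - v) x = u x - v x. Proof. by []. Qed.
Lemma evZ c (u : Ent) x : (c *: u) x = c * u x. Proof. by []. Qed.
Lemma ev0 x : (0 : Ent) x = 0. Proof. by []. Qed.
Lemma ev1 x : (1 : Ent) x = 1. Proof. by []. Qed.

Definition evat x (u : Ent) : C := u x.
Lemma evat_additive x : {morph evat x : u v / u - v}. Proof. by []. Qed.
HB.instance Definition _ x := GRing.isZmodMorphism.Build Ent C (evat x) (evat_additive x).
Lemma evat_multiplicative x : monoid_morphism (evat x). Proof. by split. Qed.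
HB.instance Definition _ x := GRing.isMonoidMorphism.Build Ent C (evat x) (evat_multiplicative x).

Lemma ev_sum I (s : seq I) (P : pred I) (F : I -> Ent) x :
  (\sum_(i <- s | P i) F i) x = \sum_(i <- s | P i) F i x.
Proof. exact: (raddf_sum (evat x)). Qed.

Lemma iota_is_additive : {morph iotaE : p q / p - q}.
Proof. by move=> p q; apply: ent_eq => x /=; rewrite hornerD hornerN. Qed.
HB.instance Definition _ := GRing.isZmodMorphism.Build {poly C} Ent iotaE iota_is_additive.
Lemma iota_is_multiplicative : monoid_morphism iotaE.
Proof. by split=> [|p q]; apply: ent_eq => x /=; rewrite ?hornerE ?hornerM. Qed.
HB.instance Definition _ := GRing.isMonoidMorphism.Build {poly C} Ent iotaE iota_is_multiplicative.

Lemma iotaC c : iotaE c%:P = ecst c.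
Proof. by apply: ent_eq => x /=; rewrite hornerC. Qed.
Lemma scaleE c (u : Ent) : c *: u = iotaE c%:P * u.
Proof. by rewrite iotaC. Qed.

Lemma DeM (u v : Ent) : De (u * v) = De u * v + u * De v.
Proof. exact: De_emul. Qed.

Lemma De_is_linear : linear De.
Proof.
move=> c u v; rewrite -[LHS]/(De (eadd (emul (ecst c) u) v)) De_eadd De_emul.
rewrite -[RHS]/(eadd (emul (ecst c) (De u)) (De v)); congr (eadd _ _).
have -> : De (ecst c) = ecst 0.
  apply: De_eq => x e e0; exists 1; first exact: ltr01.
  by move=> h _; rewrite /= mulr0 !subrr cnorm0 mulr_ge0 ?cnorm_ge0 ?ltW.
by apply: ent_eq => x /=; rewrite mul0r add0r.
Qed.
HB.instance Definition _ := GRing.isLinear.Build C Ent Ent *:%R De De_is_linear.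

Lemma cdiff_id (z : C) : cdiff id z 1.
Proof.
move=> e e0; exists 1; first exact: ltr01.
move=> h _; rewrite [X in cnorm X](_ : _ = 0); last by rewrite /=; ring.
by rewrite cnorm0 mulr_ge0 ?cnorm_ge0 ?ltW.
Qed.

Lemma De1 : De 1 = 0.
Proof. exact: (deriv_one DeM). Qed.

Lemma De_iota p : De (iotaE p) = iotaE p^`().
Proof.
elim/poly_ind: p => [|p c IH]; first by rewrite deriv0 !raddf0.
have DX : De (iotaE 'X) = 1.
  apply: De_eq => x e e0; have [d d0 hd] := cdiff_id x e0; exists d; first exact: d0.
  by move=> h /hd; rewrite /= !hornerX.
have -> : iotaE (p * 'X + c%:P) = iotaE p * iotaE 'X + c *: (1 : Ent).
  by rewrite rmorphD rmorphM scaleE mulr1.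
rewrite linearD linearZ /= De1 scaler0 addr0 DeM DX IH mulr1.
by rewrite derivD derivM derivX derivC addr0 mulr1 rmorphD rmorphM.
Qed.

Lemma entire_shift (l : C) (u : Ent) : entire (fun x => u (x + l)).
Proof.
move=> z; have -> : (fun x => u (x + l)) = (fun x => u (l + x)) by apply/funext => x; rewrite addrC.
by apply: cdf_shift; exact: entE.
Qed.
Definition sh l u := MkEnt (@entire_shift l u).

Lemma sh_is_linear l : linear (sh l).
Proof. by move=> c u v; apply: ent_eq. Qed.
HB.instance Definition _ l := GRing.isLinear.Build C Ent Ent *:%R (sh l) (sh_is_linear l).

Lemma De_sh l u : De (sh l u) = sh l (De u).
Proof.
apply: De_eq => x e e0; have [d d0 hd] := De_cdiff u (x + l) e0.
exists d; first exact: d0.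
by move=> h /hd; rewrite /= (addrAC x l h).
Qed.

Lemma iterDe_sh k l u : iter k De (sh l u) = sh l (iter k De u).
Proof. by elim: k => //= k ->; rewrite De_sh. Qed.

Definition Xe (u : Ent) : Ent := iotaE 'X * u.
Lemma Xe_is_linear : linear Xe.
Proof. by move=> c u v; rewrite /Xe mulrDr !scaleE mulrCA. Qed.
HB.instance Definition _ := GRing.isLinear.Build C Ent Ent *:%R Xe Xe_is_linear.

Lemma sh_Xe l u : sh l (Xe u) = Xe (sh l u) + l *: sh l u.
Proof. by apply: ent_eq => x /=; rewrite !hornerX mulrDl. Qed.

Lemma polact_Xe p u : polact Xe p u = iotaE p * u.
Proof.
elim/poly_ind: p => [|p c IH]; first by rewrite polact0 rmorph0 mul0r.
by rewrite polactD polactMX polactC IH scaleE rmorphD rmorphM /= /Xe; ring.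
Qed.

(** * The operator L_0 on entire functions and the action of flat *)

Variables (r : nat) (a : nat -> C).
Hypothesis hr : (1 < r)%N.

Definition L0e := Lop r a De Xe.
HB.instance Definition _ := GRing.Linear.on L0e.

Lemma De_Xe u : De (Xe u) = Xe (De u) + u.
Proof. by rewrite /Xe DeM De_iota derivX rmorph1 mul1r addrC. Qed.

Lemma L0e_De u : L0e (De u) = De (L0e u) + u.
Proof.
have Hi k : iter k De (De u) = De (iter k De u) by rewrite -iterSr.
have -> : De (L0e u) = De (iter r De u) - \sum_(1 <= k < r.-1) a k *: De (iter k De u) - De (Xe u).
  rewrite /L0e /Lop linearB linearB linear_sum /=; congr (_ - _ - _).
  by apply: eq_bigr => k _; rewrite linearZ.
rewrite /L0e /Lop De_Xe Hi; under eq_bigr do rewrite Hi.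
by rewrite opprD addrA subrK.
Qed.

(** A(d) - (A(d) - x) = x: this is why flat is an involution. *)
Lemma Lop_L0e u : Lop r a De L0e u = Xe u.
Proof.
rewrite {1}/Lop /L0e /Lop; set A := iter r De u; set B := \sum_(1 <= k < r.-1) _.
by rewrite opprB addrC subrK.
Qed.

Lemma L0e_sh l u : L0e (sh l u) = sh l (L0e u) + l *: sh l u.
Proof.
have -> : sh l (L0e u) = sh l (iter r De u)
    - \sum_(1 <= k < r.-1) a k *: sh l (iter k De u) - sh l (Xe u).
  rewrite /L0e /Lop linearB linearB linear_sum /=; congr (_ - _ - _).
  by apply: eq_bigr => k _; rewrite linearZ.
rewrite /L0e /Lop sh_Xe iterDe_sh; under eq_bigr do rewrite iterDe_sh.
by rewrite opprD addrA subrK.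
Qed.

(* [phi l f p] is the function [x |-> (delta_l o p(d_z)) f(x + z)]. *)
Definition phi l (f : Ent) (p : {poly C}) : Ent := sh l (polact De p f).
Lemma phi_is_linear l f : linear (phi l f).
Proof. by move=> c p q; rewrite /phi polactD polactZ linearP. Qed.
HB.instance Definition _ l f := GRing.isLinear.Build C {poly C} Ent *:%R (phi l f) (phi_is_linear l f).

Lemma phi_mulX l f p : phi l f (mulX p) = De (phi l f p).
Proof. by rewrite /phi /mulX mulrC polactMX De_sh. Qed.

Lemma L0e_pol p f : L0e f = 0 -> L0e (polact De p f) = polact De p^`() f.
Proof.
move=> Lf; elim/poly_ind: p => [|p c IH]; first by rewrite deriv0 !polact0 raddf0.
have -> : L0e (polact De (p * 'X + c%:P) f) = L0e (De (polact De p f)) + c *: L0e f.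
  by rewrite polactD polactMX polactC linearD linearZ.
rewrite Lf scaler0 addr0 L0e_De IH.
by rewrite derivD derivM derivX derivC addr0 mulr1 polactD polactMX.
Qed.

Lemma phi_dX l f p : L0e f = 0 -> phi l f (dX l p) = L0e (phi l f p).
Proof.
by move=> Lf; rewrite /phi L0e_sh L0e_pol// /dX polactD polactZ linearD linearZ addrC.
Qed.

(** The bispectral exchange for point functionals: w^flat acting on c(hat f) in x equals (c o w)(hat
    f), because [phi l f] carries X to d and [dX l] to L_0. *)
Lemma phi_ract l f w p : L0e f = 0 ->
  ract De L0e w (phi l f p) = phi l f (ract (@mulX C) (dX l) w p).
Proof.
move=> Lf; rewrite (@ract_intertwine C _ _ _ _ De L0e (phi l f))// => v; first exact: phi_mulX.
exact: phi_dX.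
Qed.

Definition wactE (w : {poly {poly C}}) (u : Ent) : Ent := \sum_(k < size w) iotaE w`_k * iter k De u.

Lemma wactEE n (w : {poly {poly C}}) u : (size w <= n)%N -> wactE w u = \sum_(k < n) iotaE w`_k * iter k De u.
Proof.
move=> pn; rewrite /wactE -(subnKC pn) big_split_ord /= [X in _ + X]big1 ?addr0// => i _.
by rewrite nth_default ?leq_addr// rmorph0 mul0r.
Qed.

Lemma wactED w1 w2 u : wactE (w1 + w2) u = wactE w1 u + wactE w2 u.
Proof.
rewrite (wactEE _ (size_polyD w1 w2)) (wactEE _ (leq_maxl (size w1) (size w2))).
rewrite (wactEE _ (leq_maxr (size w1) (size w2))) -big_split/=.
by apply: eq_bigr => i _; rewrite coefD rmorphD mulrDl.
Qed.

Lemma wactEZ p (w : {poly {poly C}}) u : wactE (p *: w) u = iotaE p * wactE w u.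
Proof.
rewrite (wactEE _ (size_scale_leq p w)) /wactE mulr_sumr; apply: eq_bigr => i _.
by rewrite coefZ rmorphM mulrA.
Qed.

Lemma wactE0 u : wactE 0 u = 0.
Proof. by rewrite /wactE size_poly0 big_ord0. Qed.

Lemma wactEB w1 w2 u : wactE (w1 - w2) u = wactE w1 u - wactE w2 u.
Proof. by rewrite wactED -[- w2]scaleN1r wactEZ rmorphN1 mulN1r. Qed.

Lemma wactE_sum I (s : seq I) (P : pred I) (F : I -> {poly {poly C}}) u :
  wactE (\sum_(i <- s | P i) F i) u = \sum_(i <- s | P i) wactE (F i) u.
Proof. by apply: (big_morph (fun p => wactE p u)) => [p q|]; rewrite ?wactED ?wactE0. Qed.

Lemma wactE1 u : wactE 1 u = u.
Proof. by rewrite /wactE size_poly1 big_ord1 coefC/= rmorph1 mul1r. Qed.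

Lemma wactE_nfD w u : wactE (nfD w) u = De (wactE w u).
Proof.
have s : (size (nfD w) <= (size w).+1)%N.
  rewrite (leq_trans (size_polyD _ _))// geq_max (leq_trans (size_polyMleq _ _)) ?size_polyX ?addn2//=.
  by rewrite (leq_trans (size_poly _ _)).
rewrite (wactEE _ s) /wactE linear_sum /=.
under [RHS]eq_bigr do rewrite DeM De_iota.
under [LHS]eq_bigr do rewrite coef_nfD rmorphD mulrDl.
rewrite !big_split/= big_ord_recl/= rmorph0 mul0r add0r addrC; congr (_ + _).
by rewrite big_ord_recr/= nth_default// deriv0 rmorph0 mul0r addr0.
Qed.

Lemma wactE_iter_nfD k w u : wactE (iter k (@nfD C) w) u = iter k De (wactE w u).
Proof. by elim: k => //= k IH; rewrite wactE_nfD IH. Qed.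

Lemma wactE_nfL w u : wactE (nfL r a w) u = L0e (wactE w u).
Proof.
rewrite /nfL !wactEB wactE_sum wactE_iter_nfD wactEZ /L0e /Lop; congr (_ - _ - _).
by apply: eq_bigr => k _; rewrite wactEZ wactE_iter_nfD scaleE.
Qed.

Lemma wactE_nfpol p w u : wactE (nfpol r a p w) u = polact L0e p (wactE w u).
Proof.
have H i : wactE (iter i (nfL r a) w) u = iter i L0e (wactE w u).
  by elim: i => //= i IH; rewrite wactE_nfL IH.
by rewrite /nfpol wactE_sum; apply: eq_bigr => i _; rewrite wactEZ H scaleE.
Qed.

Lemma flat_term g b h u : ract De L0e (g *: iter b (@nfD C) (nfpol r a h 1)) u =
  wactE (h *: iter b (@nfD C) (nfpol r a g 1)) u.
Proof.
rewrite (ract_term _ _ L0e_De) wactEZ wactE_iter_nfD wactE_nfpol wactE1 -polact_Xe.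
by rewrite /polact; apply: eq_bigr => i _; rewrite (eq_iter Lop_L0e).
Qed.

Section CMflat.
Variables (n' : nat) (lam gam : 'I_n'.+1 -> C).
Hypothesis lamI : injective lam.

Lemma flat_T u : ract De L0e (Tcm r a lam gam) u = wactE (Scm r a lam gam) u.
Proof.
rewrite /Tcm /Scm ractB wactEB; congr (_ - _).
  exact: (flat_term (tau0 r a lam gam) 0 (qpol lam)).
rewrite ract_sum wactE_sum; apply: eq_bigr => b _; rewrite ract_sum wactE_sum.
by apply: eq_bigr => j _; exact: flat_term.
Qed.

Lemma flat_S u : ract De L0e (Scm r a lam gam) u = wactE (Tcm r a lam gam) u.
Proof.
rewrite /Tcm /Scm ractB wactEB; congr (_ - _).
  exact: (flat_term (qpol lam) 0 (tau0 r a lam gam)).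
rewrite ract_sum wactE_sum; apply: eq_bigr => b _; rewrite ract_sum wactE_sum.
by apply: eq_bigr => j _; exact: flat_term.
Qed.

Lemma Tcm_kills i f : L0e f = 0 ->
  wactE (Tcm r a lam gam) (phi (lam i) f ('X + (gam i)%:P)) = 0.
Proof. by move=> Lf; rewrite -flat_S phi_ract// Scm_kills// linear0. Qed.

End CMflat.

End Entire.

(** * Translation of the notions of the theorem into the ring of entire functions *)

Section Links.
Variable R : realType.
Local Notation C := (R[i]).
Variables (r : nat) (a : nat -> C).
Local Notation De := (@De R).
Local Notation L := (L0e r a).

Lemma iterDe_dn k (u : Ent R) : ev (iter k De u) = dn k u.
Proof. by elim: k => [|k IH]; [reflexivity|rewrite iterS dnS -IH; reflexivity]. Qed.

Lemma L0_ev (u : Ent R) : L0 r a u = ev (L u).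
Proof.
apply/funext => x; rewrite /L0 /L0e /Lop !evB ev_sum -iterDe_dn /= hornerX.
by congr (_ - _ - _); apply: eq_bigr => k _; rewrite -iterDe_dn.
Qed.

Lemma iter_L0_ev i (u : Ent R) : iter i (L0 r a) u = ev (iter i L u).
Proof. by elim: i => //= i ->; rewrite L0_ev. Qed.

Lemma polyL0_ev p (u : Ent R) : polyL0 r a p u = ev (polact L p u).
Proof.
apply/funext => x; rewrite /polyL0 /polact ev_sum; apply: eq_bigr => i _.
by rewrite iter_L0_ev.
Qed.

Lemma wact_ev (W : weyl R) (u : Ent R) : wact W u = ev (wactE (Poly W) u).
Proof.
apply/funext => x; rewrite (wactEE _ (size_Poly W)) ev_sum; apply: eq_bigr => k _.
by rewrite coef_Poly evM -iterDe_dn.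
Qed.

Lemma wflat_ev (W : weyl R) (u : Ent R) :
  wflat_act r a W u = ev (ract De L (Poly W) u).
Proof.
apply/funext => x; rewrite (ractE _ _ _ (size_Poly W)) ev_sum; apply: eq_bigr => k _.
by rewrite coef_Poly polyL0_ev -iterDe_dn.
Qed.

Lemma kerL0_ev f : kerL0 r a f -> exists2 u : Ent R, f = ev u & L u = 0.
Proof.
move=> [ef Lf]; exists (MkEnt ef) => //; apply: ent_eq => x.
by rewrite ev0 -L0_ev Lf.
Qed.

Lemma ev_kerL0 (u : Ent R) : L u = 0 -> kerL0 r a u.
Proof. by move=> Lu; split=> [|x]; [exact: entE|rewrite L0_ev Lu]. Qed.

Lemma ev_phi l (u : Ent R) p x :
  phi l u p x = \sum_(j < size p) p`_j * dn j u (x + l).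
Proof.
rewrite /phi /= /polact ev_sum; apply: eq_bigr => j _; by rewrite evZ -iterDe_dn.
Qed.

Lemma dn_hat j (u : Ent R) x l : dn j (hat u x) l = dn j u (x + l).
Proof.
have -> : hat u x = ev (sh x u) by apply/funext => z; rewrite /hat /= addrC.
by rewrite -!iterDe_dn iterDe_sh /= addrC.
Qed.

Lemma dapply_phi (c : Selt R) (s : seq C) (u : Ent R) x : uniq s ->
  (forall l, c l != 0 -> l \in s) ->
  dapply c (hat u x) = (\sum_(l <- s) phi l u (c l)) x.
Proof.
move=> us cs; rewrite /dapply ev_sum (fsbig_fwiden s).
- apply: eq_bigr => l _; rewrite ev_phi; apply: eq_bigr => j _; by rewrite dn_hat.
- by move=> l /= cl; apply: cs.
- exact: us.
- move=> l /= [_ /negP]; rewrite negbK => /eqP cl.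
  by rewrite cl size_poly0 big_ord0.
Qed.

Lemma finS_seq (c : Selt R) : finS c -> exists2 s : seq C, uniq s & forall l, c l != 0 -> l \in s.
Proof.
move=> /finite_seqP[s E]; exists (undup s); first exact: undup_uniq.
move=> l cl; rewrite mem_undup; have : suppS c l by exact: cl.
by rewrite E.
Qed.

Lemma dapply_basicS l g (u : Ent R) x : dapply (basicS l g) (hat u x) = phi l u ('X + g%:P) x.
Proof.
have H m : basicS l g m != 0 -> m \in [:: l].
  by rewrite inE /basicS; case: (m == l); rewrite ?eqxx.
by rewrite (dapply_phi u x (s := [:: l]) _ H)// big_seq1 /basicS eqxx.
Qed.

Lemma wrmx_ev m (v : 'I_m -> C -> C) (f : 'I_m -> Ent R) x : (forall k, v k = ev (f k)) ->
  wrmx v x = map_mx (evat x) (Wr De f).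
Proof. by move=> E; apply/matrixP => i j; rewrite !mxE E -iterDe_dn. Qed.

Lemma wext_ev m (v : 'I_m -> C -> C) (f : 'I_m -> Ent R) (u : Ent R) : (forall k, v k = ev (f k)) ->
  forall k, wext v u k = ev (ext f u k).
Proof. by move=> E k; rewrite /wext /ext; case: unlift. Qed.

Lemma det_wrmx_ev m (v : 'I_m -> C -> C) (f : 'I_m -> Ent R) x : (forall k, v k = ev (f k)) ->
  \det (wrmx v x) = (\det (Wr De f)) x.
Proof. by move=> E; rewrite (wrmx_ev x E) det_map_mx. Qed.

Lemma Kbar_ev m kappa (v : 'I_m -> C -> C) (f : 'I_m -> Ent R) (u : Ent R) :
  (forall k, v k = ev (f k)) -> Kbar kappa v u = ev (kappa *: \det (Wr De (ext f u))).
Proof. by move=> E; apply/funext => x; rewrite /Kbar (det_wrmx_ev _ (wext_ev u E)). Qed.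

Lemma iotaE_inj : injective (@iotaE R).
Proof.
move=> p q E; apply/eqP; rewrite -subr_eq0; apply: contraT => nz.
have H x : (p - q).[x] = 0.
  by rewrite hornerD hornerN -[p.[x]]/(iotaE p x) -[q.[x]]/(iotaE q x) E subrr.
have := max_poly_roots nz (rs := [seq (n%:R : C) | n <- iota 0 (size (p - q)%R)]).
rewrite size_map size_iota ltnn; apply.
  by apply/allP => x _; rewrite rootE H.
by rewrite map_inj_uniq ?iota_uniq// => n m /eqP; rewrite eqr_nat => /eqP.
Qed.

End Links.

(** * Division by products of linear factors *)

Section Cancel.
Variable R : realType.
Local Notation C := (R[i]).
Local Notation De := (@De R).
Implicit Types (s : seq C) (E u v : Ent R).

Definition linprod s : {poly C} := \prod_(x <- s) ('X - x%:P).

Lemma linprod_cons x s : linprod (x :: s) = ('X - x%:P) * linprod s.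
Proof. by rewrite /linprod big_cons. Qed.

Lemma cancel_linear x v : iotaE ('X - x%:P) * v = 0 -> v = 0.
Proof.
move=> H; apply: ent_eq => z; congr (_ z).
apply: (@entire_eq R v (0 : Ent R) x); [exact: entE|exact: entE|move=> w wx].
have := congr1 (fun u : Ent R => u w) H; rewrite evM ev0 /= !hornerE => /eqP.
by rewrite mulf_eq0 subr_eq0 (negbTE wx) => /eqP.
Qed.

Lemma cancel_linearI x u v : iotaE ('X - x%:P) * u = iotaE ('X - x%:P) * v -> u = v.
Proof.
move=> H; apply/eqP; rewrite -subr_eq0; apply/eqP; apply: (@cancel_linear x).
by rewrite mulrBr H subrr.
Qed.

Lemma cancel_linprod s v : iotaE (linprod s) * v = 0 -> v = 0.
Proof.
elim: s => [|x s IH]; first by rewrite /linprod big_nil rmorph1 mul1r.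
by rewrite linprod_cons rmorphM -mulrA => /cancel_linear.
Qed.

Lemma cancel_linprodI s u v : iotaE (linprod s) * u = iotaE (linprod s) * v -> u = v.
Proof.
move=> H; apply/eqP; rewrite -subr_eq0; apply/eqP; apply: (@cancel_linprod s).
by rewrite mulrBr H subrr.
Qed.

Lemma linprod_deriv x s : (linprod (x :: s))^`() = linprod s + ('X - x%:P) * (linprod s)^`().
Proof. by rewrite linprod_cons derivM derivXsubC mul1r. Qed.

Lemma root_linprod x s : root (linprod s) x = (x \in s).
Proof. exact: root_prod_XsubC. Qed.

(** At a root x of t the equation reads t'(x) E(x) = 0 with t'(x) nonzero, so E is divisible by the
    corresponding linear factor; the quotient satisfies the same equation for the remaining
    roots. *)
Lemma logderiv_eq s E : uniq s -> iotaE (linprod s)^`() * E = iotaE (linprod s) * De E ->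
  exists c, E = c *: iotaE (linprod s).
Proof.
elim: s E => [|x s IH] E.
  rewrite /linprod big_nil derivC !(rmorph0, rmorph1) mul0r mul1r => _ H.
  exists (E 0); apply: ent_eq => z; rewrite evZ ev1 mulr1.
  apply: dn1_eq0_const; [exact: entE|move=> w].
  by have := congr1 (fun u : Ent R => u w) H.
move=> /= /andP[xs us] H.
have Ex : E x = 0.
  have := congr1 (fun u : Ent R => u x) H.
  rewrite !evM /= linprod_deriv linprod_cons !hornerE subrr !mul0r addr0 => /eqP.
  by rewrite mulf_eq0 -rootE root_linprod (negbTE xs) => /eqP.
have [g eg Eg] := entire_division (@entE R E) Ex.
pose F := MkEnt eg; have EF : E = iotaE ('X - x%:P) * F.
  by apply: ent_eq => z; rewrite evM /= !hornerE Eg.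
have [|c Fc] := IH F us; last first.
  by exists c; rewrite EF Fc linprod_cons rmorphM !scaleE mulrCA.
(* Once the product-rule terms common to both sides are removed, the linear factor occurs
   squared. *)
apply: (@cancel_linearI x); apply: (@cancel_linearI x).
move: H; rewrite EF DeM De_iota derivXsubC linprod_deriv linprod_cons.
move: ('X - x%:P) => p; rewrite !(rmorphD, rmorphM, rmorph1) mul1r => H.
apply: (@addrI _ (iotaE (linprod s) * (iotaE p * F))).
transitivity ((iotaE (linprod s) + iotaE p * iotaE (linprod s)^`()) * (iotaE p * F)); first by ring.
by rewrite H; ring.
Qed.

End Cancel.

(** * Independence of the functions c(hat f) *)

Section Flat.
Variable R : realType.
Local Notation C := (R[i]).
Variables (r : nat) (a : nat -> C) (x0 : C).
Local Notation De := (@De R).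
Local Notation L := (L0e r a).
Implicit Types (u v f : Ent R) (s : seq C).

(** Not the anti-automorphism. Vanishing of the whole jet at [x0] is preserved by d, by
    multiplications and by L_0, and suffices for independence, so no identity theorem for analytic
    functions is involved. *)
Definition flat u := forall k, (iter k De u) x0 = 0.

Lemma iterDe_linear k c u v : iter k De (c *: u + v) = c *: iter k De u + iter k De v.
Proof. exact: iter_linear. Qed.

Lemma flat0 : flat 0.
Proof.
move=> k; have -> : iter k De 0 = 0 :> Ent R; last by [].
by elim: k => //= k ->; rewrite linear0.
Qed.

Lemma flat_lin c u v : flat u -> flat v -> flat (c *: u + v).
Proof. by move=> hu hv k; rewrite iterDe_linear evD evZ hu hv mulr0 addr0. Qed.

Lemma flatZ c u : flat u -> flat (c *: u).
Proof. by move=> hu; rewrite -[_ *: _]addr0; apply: flat_lin flat0. Qed.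

Lemma flatD u v : flat u -> flat v -> flat (u + v).
Proof. by move=> hu hv; rewrite -[u]scale1r; exact: flat_lin. Qed.

Lemma flat_sum I (t : seq I) (P : pred I) (F : I -> Ent R) :
  (forall i, P i -> flat (F i)) -> flat (\sum_(i <- t | P i) F i).
Proof. by move=> H; apply: (big_ind flat) => //; [exact: flat0|exact: flatD]. Qed.

Lemma flat_De u : flat u -> flat (De u).
Proof. by move=> hu k; rewrite -iterSr hu. Qed.

Lemma flat_iterDe n u : flat u -> flat (iter n De u).
Proof. by move=> hu; elim: n => //= n; exact: flat_De. Qed.

Lemma flat_mul v u : flat u -> flat (v * u).
Proof.
move=> hu k; elim: k v u hu => [|k IH] v u hu.
  by have := hu 0; rewrite /= => ->; rewrite mulr0.
rewrite iterSr DeM -[De v * u]scale1r iterDe_linear evD evZ.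
by rewrite (IH _ _ hu) (IH _ _ (flat_De hu)) mulr0 addr0.
Qed.

Lemma flat_L u : flat u -> flat (L u).
Proof.
move=> hu; rewrite /L0e /Lop; apply: flatD; last first.
  by rewrite -scaleN1r; apply: flatZ; exact: flat_mul.
apply: flatD; first exact: flat_iterDe.
rewrite -scaleN1r; apply: flatZ; apply: flat_sum => k _; apply: flatZ; exact: flat_iterDe.
Qed.

Lemma flat_pol p u : flat u -> flat (polact L p u).
Proof.
move=> hu; apply: flat_sum => i _; apply: flatZ; elim: (nat_of_ord i) => //= n; exact: flat_L.
Qed.

(** Differentiating the equation m times keeps the leading coefficient, now in front of the
    derivative of order m + N; as it is nonzero at [x0], that derivative is determined by the lower
    ones. *)
Lemma flat_solution N (w : {poly {poly C}}) u : (size w <= N.+1)%N -> (w`_N).[x0] != 0 ->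
  wactE w u = 0 -> (forall k, (k < N)%N -> (iter k De u) x0 = 0) -> flat u.
Proof.
move=> sw w0 wu hu k.
have H m : (size (iter m (@nfD C) w) <= (m + N).+1)%N /\ (iter m (@nfD C) w)`_(m + N) = w`_N.
  elim: m => [|m [s e]]; first by split.
  split=> /=.
    apply/leq_sizeP => j jm; rewrite coef_nfD !nth_default ?deriv0 ?addr0 ?if_same//.
      by rewrite (leq_trans s)// ltnW.
    by rewrite (leq_trans s)//; case: j jm.
  by rewrite coef_nfD addSn /= e (nth_default 0 s) deriv0 addr0.
elim/ltn_ind: k => k IH; have [kN|Nk] := ltnP k N; first exact: hu.
have [s e] := H (k - N)%N; rewrite subnK// in s e.
have : wactE (iter (k - N) (@nfD C) w) u = 0.
  by rewrite wactE_iter_nfD wu; elim: (k - N)%N => //= n ->; rewrite linear0.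
rewrite (wactEE _ s) big_ord_recr /= e => /(congr1 (fun v : Ent R => v x0)).
rewrite evD ev_sum big1 ?add0r => [|i _]; last by rewrite evM IH ?mulr0.
by rewrite evM ev0 /= => /eqP; rewrite mulf_eq0 (negbTE w0) => /eqP.
Qed.

Variables (fE : 'I_r -> Ent R).
Hypothesis hr : (1 < r)%N.
Hypothesis fker : forall j, L (fE j) = 0.
Hypothesis fWr : \det (Wr De fE) = 1.

Lemma polact_phi l f p q : L f = 0 -> polact L q (phi l f p) = phi l f (polact (dX l) q p).
Proof.
move=> Lf; rewrite [RHS](@polact_intertwine C _ _ (dX l) L (phi l f))// => v; exact: phi_dX.
Qed.

(* Polynomials in [L] act on [\sum phi] through multiplication by the spectral parameter;
   a suitable one isolates the top jet at a single support point. *)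
Lemma phi_flat_eq0 s (c : 'I_r -> C -> {poly C}) : uniq s ->
  flat (\sum_j \sum_(l <- s) phi l (fE j) (c j l)) -> forall j l, l \in s -> c j l = 0.
Proof.
move=> us hflat j0 l0 l0s; apply/eqP; apply: contraT => nz.
pose e := \max_j size (c j l0); have r0 : (0 < #|'I_r|)%N by rewrite card_ord ltnW.
have ce j : (size (c j l0) <= e)%N by exact: (@leq_bigmax _ (fun j => size (c j l0))).
have [j1 E1] := @bigop.eq_bigmax _ (fun j => size (c j l0)) r0.
have e0 : (0 < e)%N by rewrite (leq_trans _ (ce j0))// size_poly_gt0.
have ed : e.-1.+1 = e by rewrite prednK.
pose d := \max_j \max_(l <- s) size (c j l).
have cd j l : l \in s -> (size (c j l) <= d)%N.
  move=> ls; apply: leq_trans (@leq_bigmax _ (fun j => \max_(l <- s) size (c j l)) j).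
  by rewrite (big_rem l ls)/= leq_maxl.
(* On symbols at l, [dX l] minus l is differentiation: the d-th powers kill every symbol away from
   l0, and the power e - 1 at l0 leaves a constant, nonzero for some j. *)
pose Q2 := \prod_(l <- s | l != l0) ('X - l%:P) ^+ d.
pose Q := ('X - l0%:P) ^+ e.-1 * Q2.
have killed j l : l \in s -> l != l0 -> polact (dX l) Q (c j l) = 0.
  move=> ls ll0; rewrite /Q /Q2 (big_rem l ls)/= ll0 mulrCA mulrC polactM polact_dX_exp.
  by rewrite derivn_poly0 ?cd// linear0.
pose k j := (c j l0)`_e.-1 *+ (e.-1)`!.
have top j : polact (dX l0) Q (c j l0) = (Q2.[l0] * k j)%:P.
  rewrite /Q mulrC polactM polact_dX_exp -polact_dX_const; congr (polact _ _ _).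
  apply/polyP => i; rewrite coef_derivn coefC; case: i => [|i].
    by rewrite addn0 ffactnn.
  by rewrite nth_default ?mul0rn//; apply: (leq_trans (ce j)); rewrite addnS -addSn ed leq_addr.
have := flat_pol Q hflat; rewrite linear_sum /=.
have -> : \sum_j polact L Q (\sum_(l <- s) phi l (fE j) (c j l)) =
   Q2.[l0] *: \sum_j k j *: sh l0 (fE j).
  rewrite scaler_sumr; apply: eq_bigr => j _; rewrite linear_sum (bigD1_seq l0)//=.
  rewrite big_seq_cond big1 ?addr0 => [|l /andP[ls ll0]].
    by rewrite polact_phi// top /phi polactC linearZ scalerA.
  by rewrite polact_phi// killed// linear0.
have Q20 : Q2.[l0] != 0.
  rewrite /Q2 horner_prod prodf_seq_neq0; apply/allP => l _; apply/implyP => ll0.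
  by rewrite horner_exp !hornerE expf_neq0// subr_eq0 eq_sym.
move=> /(flatZ (Q2.[l0])^-1); rewrite scalerA mulVf// scale1r => fl.
(* What remains is a constant combination of the shifted f_j with zero jet, hence a vector in the
   kernel of their Wronskian matrix at x0 + l0, of determinant 1. *)
pose v : 'cV[C]_r := \col_j k j.
have Mv : map_mx (evat (x0 + l0)) (Wr De fE) *m v = 0.
  apply/colP => i; rewrite !mxE -[RHS](fl i).
  have -> : iter i De (\sum_j k j *: sh l0 (fE j)) = \sum_j k j *: sh l0 (iter i De (fE j)).
    elim: (nat_of_ord i) => //= n ->; rewrite linear_sum; apply: eq_bigr => j _.
    by rewrite linearZ /= De_sh.
  by rewrite ev_sum; apply: eq_bigr => j _; rewrite !mxE mulrC.
have det1 : \det (map_mx (evat (x0 + l0)) (Wr De fE)) = 1 by rewrite det_map_mx fWr rmorph1.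
have v0 : v = 0.
  rewrite -[v]mul1mx -[1%:M]/(1%:M) -det1 -mul_adj_mx -mulmxA Mv mulmx0.
  by [].
have : k j1 = 0 by have := congr1 (fun w : 'cV_r => w j1 0) v0; rewrite !mxE.
move=> /eqP; rewrite /k -mulr_natr mulf_eq0 pnatr_eq0 -leqn0 leqNgt fact_gt0 orbF.
have -> : e.-1 = (size (c j1 l0)).-1 by rewrite /e E1.
rewrite -/(lead_coef _) lead_coef_eq0 -size_poly_eq0 -E1 -/e => /eqP ez.
by rewrite ez in e0.
Qed.

Lemma phi_eq0 s (c : C -> {poly C}) : uniq s ->
  (forall j, \sum_(l <- s) phi l (fE j) (c l) = 0) -> forall l, l \in s -> c l = 0.
Proof.
move=> us H l ls; have rr : (0 < r)%N by exact: ltnW.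
apply: (@phi_flat_eq0 s (fun=> c) us _ (Ordinal rr) l ls).
by rewrite big1 => [|j _]; [exact: flat0|exact: H].
Qed.

End Flat.

(** * Functionals annihilating the image of an operator *)

Section Annihilator.
Variable R : realType.
Local Notation C := (R[i]).
Local Notation De := (@De R).
Implicit Types (p t : {poly C}) (w T : {poly {poly C}}) (l : C).

Lemma ract_mulX l w p : ract (@mulX C) (dX l) w p =
  \sum_(k < size w) 'X^k * polact (dX l) w`_k p.
Proof. by apply: eq_bigr => k _; rewrite iter_mulX. Qed.

Lemma ract_mulX_one l w : (forall k, (w`_k).[l] = 0) -> ract (@mulX C) (dX l) w 1 = 0.
Proof.
move=> H; rewrite ract_mulX big1// => k _.
by rewrite -[1 : {poly C}]/(1%:P) polact_dX_const H mul0r mulr0.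
Qed.

(* With [d] the degree of [p], the coefficients of degree [N + d] and [N + d - 1] give
   [t(l) = 0] and [(d - 1) t'(l) = 0]. *)
Lemma annihilator_order N t T l p : is_top N t T -> (0 < N)%N ->
  ract (@mulX C) (dX l) T p = 0 -> p != 0 ->
  t.[l] = 0 /\ (t^`().[l] != 0 -> size p = 2).
Proof.
move=> [sT TN TN1] N0; rewrite (ractE (@mulX C) (dX l) _ sT) => H nz.
have [d sp] : exists d, size p = d.+1.
  by exists (size p).-1; rewrite prednK// lt0n size_poly_eq0.
have pd : p`_d != 0 by move: nz; rewrite -lead_coef_eq0 /lead_coef sp.
have Lk k := polact_dX_lead l T`_k (eq_leq sp).
have {}H i : \sum_(k < N.+1) ('X^k * polact (dX l) T`_k p)`_i = 0.
  rewrite -coef_sum (_ : \sum_(k < N.+1) 'X^k * polact (dX l) T`_k p = 0) ?coef0// -[RHS]H.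
  by apply: eq_bigr => k _; rewrite iter_mulX.
have tl : t.[l] = 0.
  have := H (d + N)%N; rewrite big_ord_recr/= big1 ?add0r => [|k _].
    rewrite coefXnM ltnNge leq_addl /= addnK; have [_ -> _] := Lk N.
    by rewrite TN => /eqP; rewrite mulf_eq0 (negbTE pd) orbF => /eqP.
  have [s _ _] := Lk k; rewrite coefXnM; case: ifP => // _.
  by rewrite nth_default// (leq_trans s)//; have := ltn_ord k; lia.
split=> // t'l; rewrite sp; congr _.+1.
have := H (d + N).-1; case: N N0 sT TN TN1 {H} => // N _ sT TN /= TN1.
rewrite addnS /= !big_ord_recr/= big1 ?add0r => [|k _]; last first.
  have [s _ _] := Lk k; rewrite coefXnM; case: ifP => // _.
  by rewrite nth_default// (leq_trans s)//; have := ltn_ord k; lia.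
rewrite coefXnM ltnNge leq_addl /= addnK; have [_ -> _] := Lk N.
rewrite TN1 hornerN coefXnM; have [_ _] := Lk N.+1; rewrite TN tl.
case: d sp pd Lk => [|d] sp pd Lk.
  move=> _; rewrite add0n ltnSn addr0 mulNr => /eqP.
  by rewrite oppr_eq0 mulf_eq0 (negbTE t'l) (negbTE pd).
move=> /(_ isT) /= E.
have -> : (d.+1 + N < N.+1)%N = false by lia.
have -> : (d.+1 + N - N.+1)%N = d by lia.
rewrite E mul0r add0r mulNr addrC -mulrBr => /eqP; rewrite mulf_eq0 (negbTE t'l) /=.
rewrite mulrSr addrK -mulr_natr mulf_eq0 (negbTE pd) pnatr_eq0 /=.
by move=> /eqP->.
Qed.

Section Exists.
Variables (m : nat) (f : 'I_m.+1 -> Ent R) (T : {poly {poly C}}) (t : {poly C}) (mu : C).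
Hypothesis Ttop : is_top m.+1 t T.
Hypothesis Tf : forall j, wactE T (f j) = 0.
Hypothesis tmu : t.[mu] = 0.
Hypothesis t'mu : t^`().[mu] != 0.
Hypothesis Wmu : (De (\det (Wr De f))) mu != 0.

(** The Wronskian vanishes at mu by Abel's formula, so its matrix is of no use. But w_m(mu) = 0
    makes row m free to be replaced by row m + 1, and the determinant becomes the derivative of the
    Wronskian, which is nonzero. *)
Lemma low_jets_eq0 w : (size w <= m.+3)%N -> (forall j, wactE w (f j) mu = 0) ->
  (w`_m.+2).[mu] = 0 -> (w`_m.+1).[mu] = 0 -> (w`_m).[mu] = 0 ->
  forall k, (w`_k).[mu] = 0.
Proof.
move=> sw wf w2 w1 w0 k.
pose v : 'rV[C]_m.+1 := \row_k (w`_k).[mu].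
pose M := map_mx (evat mu) (Wrlast De f).
have vM : v *m M = 0.
  apply/rowP => j; pose F k : C := (w`_k).[mu] * evat mu (iter k De (f j)).
  have Fz k' : (w`_k').[mu] = 0 -> F k' = 0 by move=> e; rewrite /F e mul0r.
  have FS : \sum_(k < m) F k = 0.
    have E : \sum_(k < m.+3) F k = \sum_(k < m) F k + F m + F m.+1 + F m.+2.
      by rewrite 3!big_ord_recr.
    have E0 : \sum_(k < m.+3) F k = 0.
      by rewrite -[RHS](wf j) (wactEE _ sw) ev_sum; apply: eq_bigr.
    by rewrite -[RHS]E0 E (Fz _ w2) (Fz _ w1) (Fz _ w0); ring.
  rewrite mxE [RHS]mxE -[RHS]addr0 -[X in X + 0]FS big_ord_recr; congr (_ + _).
    apply: eq_bigr => i _; rewrite !mxE /F /=; case: eqP => // /(congr1 val) /= e.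
    by move: (ltn_ord i); rewrite e ltnn.
  by rewrite mxE w0 mul0r.
have dM : \det M != 0 by rewrite det_map_mx -(deriv_det_Wr (@DeM R)).
have v0 : v = 0.
  apply/eqP; apply: contraNT dM => vn; apply/eqP/eqP/det0P; by exists v.
have [km|] := ltnP k m.+1.
  by have := congr1 (fun u : 'rV_m.+1 => u 0 (Ordinal km)) v0; rewrite !mxE.
rewrite leq_eqVlt => /predU1P[<- //|]; rewrite leq_eqVlt => /predU1P[<- //|km].
by rewrite nth_default ?horner0// (leq_trans sw).
Qed.

(** delta_mu o (d + g) o T is the evaluation at mu of w = d T + g T. Its coefficients of order m + 2
    and m + 1 are t and - t' + t' + g t, both zero at mu; [g] is chosen to cancel the one of order
    m, where T has coefficient - t'(mu). The others vanish because w kills all f_j. *)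
Lemma annihilator_exists : exists g, ract (@mulX C) (dX mu) T ('X + g%:P) = 0.
Proof.
case: (Ttop) => sT TN TN1; rewrite /= in TN1.
have Tm : (T`_m).[mu] != 0 by rewrite TN1 hornerN oppr_eq0.
pose g := - ((nfD T)`_m).[mu] / (T`_m).[mu].
exists g; pose w := nfD T + g%:P *: T.
have LD := dX_mulX mu.
have -> : ract (@mulX C) (dX mu) T ('X + g%:P) = ract (@mulX C) (dX mu) w 1.
  rewrite /w ractD (ract_nfD LD) ractZ polactC -linearD /=; congr (ract _ _ _ _).
  by rewrite /mulX mulr1 alg_polyC.
apply: ract_mulX_one; apply: low_jets_eq0.
- rewrite (leq_trans (size_polyD _ _))// geq_max.
  rewrite (leq_trans (size_scale_leq _ _)) ?(leq_trans sT)// andbT.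
  apply/leq_sizeP => j jm; rewrite coef_nfD !nth_default ?deriv0 ?addr0 ?if_same//.
    by rewrite (leq_trans sT)// ltnW.
  by rewrite (leq_trans sT)//; case: j jm.
- by move=> j; rewrite wactED wactEZ wactE_nfD Tf linear0 mulr0 addr0.
- rewrite coefD coefZ coef_nfD /= TN (nth_default 0 sT) deriv0 mulr0 !addr0 //.
- by rewrite coefD coefZ coef_nfD /= TN TN1 !hornerE tmu; ring.
- by rewrite coefD coefZ !hornerE /g mulfVK// subrr.
Qed.

End Exists.
End Annihilator.

Section Spaces.
Variable R : realType.
Local Notation C := (R[i]).
Variables (n : nat) (mu g : 'I_n -> C) (T : {poly {poly C}}) (N : nat).
Hypothesis muI : injective mu.
Hypothesis Ttop : is_top N (qCpoly mu) T.
Hypothesis N0 : (0 < N)%N.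
Hypothesis Tg : forall i, ract (@mulX C) (dX (mu i)) T ('X + (g i)%:P) = 0.

Lemma qCpoly_root l : (qCpoly mu).[l] = 0 -> exists i, l = mu i.
Proof.
rewrite /qCpoly horner_prod => /eqP; rewrite prodf_seq_eq0 => /hasP[i _ /=].
by rewrite !hornerE subr_eq0 => /eqP->; exists i.
Qed.

Lemma qCpoly_deriv i : (qCpoly mu)^`().[mu i] != 0.
Proof.
rewrite /qCpoly (bigD1 i)//= derivM derivXsubC mul1r !hornerE subrr mul0r addr0.
rewrite horner_prod; apply/prodf_neq0 => j ji.
by rewrite !hornerE subr_eq0 (inj_eq muI) eq_sym.
Qed.

Lemma Dspace_at (al : 'I_n -> C) i :
  \sum_(j < n) al j *: basicS (mu j) (g j) (mu i) = al i *: ('X + (g i)%:P).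
Proof.
rewrite (bigD1 i)//= big1 ?addr0 => [|j ji]; first by rewrite /basicS eqxx.
by rewrite /basicS (inj_eq muI) eq_sym (negbTE ji) scaler0.
Qed.

Lemma Dspace_off (al : 'I_n -> C) l : (forall i, l <> mu i) ->
  \sum_(j < n) al j *: basicS (mu j) (g j) l = 0.
Proof.
by move=> H; rewrite big1// => j _; rewrite /basicS; case: eqP => [/H//|_]; rewrite scaler0.
Qed.

(** At a simple root every nonzero annihilating symbol has degree exactly 1, so subtracting the
    multiple of X + g_i with the same coefficient of X leaves zero. *)
Lemma annihilator_Dspace :
  [set c | finS c /\ forall l, ract (@mulX C) (dX l) T (c l) = 0]%classic = Dspace mu g.
Proof.
apply/seteqP; split=> c /=.
  move=> [fc H]; exists (fun i => (c (mu i))`_1); apply/funext => l.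
  have [[i ->]|nl] := pselect (exists i, l = mu i); last first.
    rewrite Dspace_off => [|i li]; last by apply: nl; exists i.
    apply/eqP; apply: contrapT => /negP cl.
    have [tl _] := annihilator_order Ttop N0 (H l) cl.
    by apply: nl; exact: qCpoly_root.
  rewrite Dspace_at; apply/eqP; rewrite -subr_eq0; apply: contraT => nz.
  set al := (c (mu i))`_1 in nz *; set p := c (mu i) in al nz *.
  have Gp : ract (@mulX C) (dX (mu i)) T (p - al *: ('X + (g i)%:P)) = 0.
    by rewrite linearB linearZ /= Tg scaler0 subr0; exact: H.
  have [_ /(_ (qCpoly_deriv i)) s2] := annihilator_order Ttop N0 Gp nz.
  have := lead_coef_eq0 (p - al *: ('X + (g i)%:P)); rewrite (negbTE nz) /lead_coef s2 /=.
  by rewrite coefB coefZ coefD coefX coefC /= addr0 mulr1 subrr eqxx.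
move=> [al ->]; split.
  apply: (@sub_finite_set _ _ (range mu)); last by apply: finite_image; exact: finite_finset.
  move=> l /= cl; apply: contrapT => nl; case/eqP: cl; apply: Dspace_off => i li.
  by apply: nl; exists i.
move=> l; have [[i ->]|nl] := pselect (exists i, l = mu i).
  by rewrite Dspace_at linearZ /= Tg scaler0.
rewrite Dspace_off ?linear0// => i li; apply: nl; by exists i.
Qed.

End Spaces.

(** * A polynomial differential operator is determined by its action on entire functions *)

Section Uniqueness.
Variable R : realType.
Local Notation C := (R[i]).
Local Notation De := (@De R).

Lemma iterDe_iota k (p : {poly C}) : iter k De (iotaE p) = iotaE p^`(k).
Proof. by elim: k => [|k IH]; rewrite ?derivn0// iterS IH De_iota derivnS. Qed.

Lemma iotaE_eq0 (p : {poly C}) : iotaE p = 0 -> p = 0.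
Proof. by move=> H; apply: iotaE_inj; rewrite H rmorph0. Qed.

(** Testing on x^k isolates w_k: lower coefficients vanish by induction and higher derivatives of
    x^k are zero. *)
Lemma wactE_eq0 (w : {poly {poly C}}) : (forall u : Ent R, wactE w u = 0) -> w = 0.
Proof.
move=> H; apply/polyP => k; rewrite coef0; elim/ltn_ind: k => k IH.
have := H (iotaE 'X^k); rewrite (wactEE (n := maxn (size w) k.+1)) ?leq_maxl//.
have km : (k < maxn (size w) k.+1)%N by rewrite leq_max leqnn orbT.
rewrite (bigD1 (Ordinal km))//= big1 ?addr0 => [|i ik].
  rewrite iterDe_iota -rmorphM => /iotaE_eq0.
  rewrite derivnXn ?subnn// expr0 ffactnn => /eqP; rewrite mulrnAr mulr1 -(scaler_nat (R := C)).
  by rewrite scaler_eq0 pnatr_eq0 gtn_eqF ?fact_gt0 //= => /eqP.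
have [ltik|ltki|e] := ltngtP i k; last by case/eqP: ik; apply: val_inj.
  by rewrite IH// rmorph0 mul0r.
by rewrite iterDe_iota derivn_poly0 ?size_polyXn// rmorph0 mulr0.
Qed.

Lemma wactE_inj (w1 w2 : {poly {poly C}}) :
  (forall u : Ent R, wactE w1 u = wactE w2 u) -> w1 = w2.
Proof.
move=> H; apply/eqP; rewrite -subr_eq0; apply/eqP/wactE_eq0 => u.
by rewrite wactEB H subrr.
Qed.

End Uniqueness.

(** * Comparison of an explicit operator with the Wronskian operator of functions it kills *)

Section WronskianOperator.
Variable R : realType.
Local Notation C := (R[i]).
Local Notation De := (@De R).
Variables (N : nat) (f : 'I_N -> Ent R) (T : {poly {poly C}}) (t : {poly C}).
Hypothesis N0 : (0 < N)%N.
Hypothesis Ttop : is_top N t T.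
Hypothesis Tf : forall j, wactE T (f j) = 0.

Lemma logderiv_Wr : iotaE t^`() * \det (Wr De f) = iotaE t * De (\det (Wr De f)).
Proof.
case: N N0 f Ttop Tf => // m _ h [sT TN TN1] Th.
have rel j : \sum_(k < m.+2) iotaE T`_k * iter k De (h j) = 0 by rewrite -(wactEE _ sT).
have := det_Wrlast (t := fun k => iotaE T`_k) rel.
rewrite TN /= in TN1 *; rewrite TN1 rmorphN mulNr => /oppr_inj ->.
by rewrite (deriv_det_Wr (@DeM R)).
Qed.

Lemma det_Wr_ext_op u : iotaE t * \det (Wr De (ext f u)) = wactE T u * \det (Wr De f).
Proof.
case: Ttop => sT TN _; rewrite (wactEE _ sT) -TN.
apply: (det_Wr_ext (t := fun k => iotaE T`_k)) => j.
by rewrite -(wactEE _ sT).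
Qed.

Lemma Kbar_op s kappa (v : 'I_N -> C -> C) (u : Ent R) : (forall k, v k = ev (f k)) ->
  t = linprod s -> kappa *: \det (Wr De f) = iotaE t ->
  Kbar kappa v u = ev (wactE T u).
Proof.
move=> vE ts D; rewrite (Kbar_ev kappa u vE); congr ev.
apply: (@cancel_linprodI R s); rewrite -ts scaleE mulrCA det_Wr_ext_op.
by rewrite mulrCA -scaleE D mulrC.
Qed.

End WronskianOperator.

(** * The annihilator description of C^beta and the nonvanishing of the second Wronskian *)

Section Final.
Variable R : realType.
Local Notation C := (R[i]).
Local Notation De := (@De R).
Variables (r : nat) (a : nat -> C) (fb : 'I_r -> C -> C) (fE : 'I_r -> Ent R).
Hypothesis hr : (1 < r)%N.
Hypothesis fbE : forall j, fb j = ev (fE j).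
Hypothesis fker : forall j, L0e r a (fE j) = 0.
Hypothesis fWr : \det (Wr De fE) = 1.
Local Notation L := (L0e r a).

Section OneSpace.
Variables (n : nat) (lam gam : 'I_n -> C).

Definition phiE (k : 'I_#|{: 'I_n * 'I_r}|) : Ent R :=
  phi (lam (enum_val k).1) (fE (enum_val k).2) ('X + (gam (enum_val k).1)%:P).

Lemma phiN_ev k : phiN fb lam gam k = ev (phiE k).
Proof. by apply/funext => x; rewrite /phiN /phiE /= fbE dapply_basicS. Qed.

(** Any normal form representing the Wronskian operator equals T. Membership then says (c o T)(hat
    f) = 0 for all f in the kernel of L_0, which forces c o T = 0 by [phi_eq0]. *)
Lemma Cbeta_annihilator kappa (T : {poly {poly C}}) :
  (forall u : Ent R, Kbar kappa (phiN fb lam gam) u = ev (wactE T u)) ->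
  Cbeta a fb lam gam kappa =
  [set c | finS c /\ forall l, ract (@mulX C) (dX l) T (c l) = 0]%classic.
Proof.
move=> KT; have flatE (W : weyl R) (c : Selt R) s (f : Ent R) : uniq s ->
    (forall l, c l != 0 -> l \in s) -> L f = 0 ->
    wflat_act r a W (fun x => dapply c (hat f x)) =
    ev (\sum_(l <- s) phi l f (ract (@mulX C) (dX l) (Poly W) (c l))).
  move=> us cs Lf; have -> : (fun x => dapply c (hat f x)) = ev (\sum_(l <- s) phi l f (c l)).
    by apply/funext => x; exact: dapply_phi.
  rewrite wflat_ev linear_sum; congr ev; apply: eq_bigr => l _; exact: phi_ract.
apply/seteqP; split=> c /=.
  move=> [fc [W [WK Wc]]]; split=> // l; have [s us cs] := finS_seq fc.
  have WT : Poly W = T.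
    apply: wactE_inj => u; apply: ent_eq => x.
    by rewrite -wact_ev (WK _ (@entE R u)) KT.
  have [ls|ls] := boolP (l \in s); last first.
    have -> : c l = 0 by apply/eqP; apply: contraNT ls; exact: cs.
    by rewrite linear0.
  apply: (@phi_eq0 R r a 0 fE hr fker fWr s (fun l => ract (@mulX C) (dX l) T (c l)) us _ l ls) => j.
  have := Wc _ (ev_kerL0 (fker j)); rewrite (flatE _ _ s)// WT => E.
  by apply: ent_eq => x; rewrite E.
move=> [fc Gc]; split=> //; exists T; split.
  move=> u eu; rewrite -[u]/(ev (MkEnt eu)) KT wact_ev polyseqK.
  by [].
move=> f /kerL0_ev[u -> Lu]; have [s us cs] := finS_seq fc.
rewrite (flatE _ _ s)// polyseqK big1// => l _.
by rewrite Gc linear0.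
Qed.

End OneSpace.

(** A zero at x0 gives a nontrivial combination of the functions with vanishing derivatives of all
    orders below N at x0. It solves S u = 0 with leading coefficient nonzero at x0, so its whole jet
    vanishes, against [phi_flat_eq0]. *)
Lemma det_Wr_phi_neq0 n (mu g : 'I_n -> C) (S : {poly {poly C}}) (q : {poly C}) x0 :
  injective mu -> is_top #|{: 'I_n * 'I_r}| q S -> (forall k, wactE S (phiE mu g k) = 0) ->
  q.[x0] != 0 -> (\det (Wr De (phiE mu g))) x0 != 0.
Proof.
move=> muI [sS SN _] Sphi qx0; apply/eqP => D0.
have : \det (map_mx (evat x0) (Wr De (phiE mu g)))^T = 0.
  by rewrite det_tr det_map_mx; exact: D0.
move=> /eqP/det0P[v vn0 vM].
pose u := \sum_k v 0 k *: phiE mu g k.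
have uflat : flat x0 u.
  apply: (flat_solution (N := #|{: 'I_n * 'I_r}|) sS); first by rewrite SN.
    rewrite (wactEE _ sS) /u.
    under eq_bigr => i _.
      rewrite (_ : iter i De _ = \sum_k v 0 k *: iter i De (phiE mu g k)).
        rewrite mulr_sumr; over.
      elim: (nat_of_ord i) => //= m ->; rewrite linear_sum; apply: eq_bigr => k _.
      by rewrite linearZ.
    rewrite exchange_big big1// => k _.
    under eq_bigr do rewrite scaleE mulrCA.
    by rewrite -mulr_sumr -(wactEE _ sS) Sphi mulr0.
  move=> k kN; have := congr1 (fun w : 'rV_ _ => w 0 (Ordinal kN)) vM.
  rewrite !mxE => E; rewrite -[RHS]E.
  have -> : iter k De u = \sum_k' v 0 k' *: iter k De (phiE mu g k').
    rewrite /u; elim: (k) => //= m ->; rewrite linear_sum; apply: eq_bigr => k' _.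
    by rewrite linearZ.
  by rewrite ev_sum; apply: eq_bigr => k' _; rewrite !mxE.
pose c j l : {poly C} := \sum_i (if mu i == l then v 0 (enum_rank (i, j)) *: ('X + (g i)%:P) else 0).
have uE : u = \sum_j \sum_(l <- [seq mu i | i <- enum 'I_n]) phi l (fE j) (c j l).
  rewrite /u (reindex (@enum_rank _ : 'I_n * 'I_r -> _)) /=; last first.
    by apply: onW_bij; exact: enum_rank_bij.
  transitivity (\sum_(p : 'I_n * 'I_r)
    v 0 (enum_rank (p.1, p.2)) *: phi (mu p.1) (fE p.2) ('X + (g p.1)%:P)).
    by apply: eq_bigr => p _; rewrite /phiE enum_rankK -surjective_pairing.
  rewrite -(pair_bigA _ (fun i j => v 0 (enum_rank (i, j)) *:
     phi (mu i) (fE j) ('X + (g i)%:P))) /= exchange_big /=; apply: eq_bigr => j _.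
  rewrite big_map -big_enum /=; apply: eq_bigr => i _.
  rewrite /c (bigD1 i)//= eqxx big1 ?addr0 ?linearZ// => i' i'i.
  by rewrite (inj_eq muI) (negbTE i'i).
have us : uniq [seq mu i | i <- enum 'I_n] by rewrite map_inj_uniq ?enum_uniq.
rewrite uE in uflat; have c0 := phi_flat_eq0 hr fker fWr us uflat.
case/eqP: vn0; apply/rowP => k; rewrite mxE.
have := c0 (enum_val k).2 (mu (enum_val k).1); rewrite map_f ?mem_enum// => /(_ isT).
rewrite /c (bigD1 (enum_val k).1)//= eqxx big1 ?addr0 => [|i' i'i]; last first.
  by rewrite (inj_eq muI) (negbTE i'i).
rewrite -surjective_pairing enum_valK => /(congr1 (fun p : {poly C} => p`_1)).
by rewrite coefZ coefD coefX coefC /= addr0 mulr1 coef0.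
Qed.

End Final.

Lemma linprod_nth (R : realType) n (s : seq R[i]) : size s = n ->
  qCpoly (fun i : 'I_n => nth 0 s i) = linprod s.
Proof. by move=> <-; rewrite /qCpoly /linprod (big_nth 0) big_mkord. Qed.

Lemma linprod_lam (R : realType) n (lam : 'I_n -> R[i]) :
  qCpoly lam = linprod [seq lam i | i <- enum 'I_n].
Proof. by rewrite /qCpoly /linprod big_map -big_enum. Qed.

Lemma exists_nonroot (R : realType) (q : {poly R[i]}) : q != 0 -> exists x, q.[x] != 0.
Proof.
move=> q0; apply: contrapT => H; case/eqP: q0; apply: iotaE_eq0; apply: ent_eq => x.
by apply/eqP; apply: contrapT => /negP qx; apply: H; exists x.
Qed.

Theorem mainTheorem12 (R : realType) (r : nat) (a : nat -> R[i])
  (fb : 'I_r -> R[i] -> R[i])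
  (hr : (1 < r)%N)
  (hfb_ker : forall j, kerL0 r a (fb j))
  (hfb_span : forall g, kerL0 r a g ->
      exists al : 'I_r -> R[i], g = fun x => \sum_(j < r) al j * fb j x)
  (hfb_wr : forall x, \det (wrmx fb x) = 1)
  (n : nat) (lam gam : 'I_n -> R[i]) (kappa : R[i]) (tau : {poly R[i]})
  (hn : (0 < n)%N) (hlam : injective lam)
  (htau : is_tau (phiN fb lam gam) kappa tau)
  (hD0 : distinct_roots tau) :
  exists m (lam' gam' : 'I_m -> R[i]) (kappa' : R[i]),
    [/\ (0 < m)%N, injective lam',
        Cbeta a fb lam gam kappa = Dspace lam' gam' &
     [/\
        (* (1) tau_{C^beta} = q_C *)
        is_tau (phiN fb lam' gam') kappa' (qCpoly lam),
        (* C^beta in D_0 *)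
        inD0 fb (Cbeta a fb lam gam kappa),
        (* (2) Kbar_C^flat = Kbar_{C^beta} *)
        (exists W : weyl R,
           represents W (Kbar kappa (phiN fb lam gam)) /\
           forall u, entire u ->
             wflat_act r a W u = Kbar kappa' (phiN fb lam' gam') u)
      & (* (C^beta)^beta = C *)
        Cbeta a fb lam' gam' kappa' = Dspace lam gam]].
Proof.
case: n hn lam gam hlam htau => // n' _ lam gam hlam htau.
pose fE j : Ent R := MkEnt (hfb_ker j).1.
have fbE j : fb j = ev (fE j) by [].
have fker j : L0e r a (fE j) = 0.
  by apply: ent_eq => x; rewrite -L0_ev; exact: (hfb_ker j).2.
have fWr : \det (Wr (@De R) fE) = 1.
  by apply: ent_eq => x; rewrite -(det_wrmx_ev x fbE) hfb_wr.
pose T := Tcm r a lam gam; pose S := Scm r a lam gam.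
have hN : #|{: 'I_n'.+1 * 'I_r}| = (r * n'.+1)%N by rewrite card_prod !card_ord mulnC.
have N0 : (0 < #|{: 'I_n'.+1 * 'I_r}|)%N by rewrite hN muln_gt0 ltnW.
have Ttop : is_top #|{: 'I_n'.+1 * 'I_r}| (tau0 r a lam gam) T.
  by rewrite hN; exact: Tcm_top.
have Stop : is_top #|{: 'I_n'.+1 * 'I_r}| (qCpoly lam) S.
  by rewrite hN; exact: Scm_top.
have Tphi k : wactE T (phiE fE lam gam k) = 0 by apply: Tcm_kills.
have [s us taus] := hD0; case: htau => kappa0 [tau_monic tauE].
have DT : kappa *: \det (Wr (@De R) (phiE fE lam gam)) = iotaE tau.
  apply: ent_eq => x; rewrite evZ -(det_wrmx_ev x (phiN_ev fbE lam gam)).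
  exact: tauE.
(* Abel's formula for T and kappa Wr = tau give tau' tau_0 = tau tau_0'; as tau has simple roots,
   tau_0 is a multiple of tau, and both are monic. *)
have tauE0 : tau0 r a lam gam = tau.
  have [c E] : exists c, iotaE (tau0 r a lam gam) = c *: iotaE (linprod s).
    apply: (logderiv_eq us); rewrite De_iota -[linprod s]/(\prod_(x <- s) _) -taus.
    have D := logderiv_Wr N0 Ttop Tphi.
    rewrite -(De_iota tau) -DT linearZ /= !scaleE; move: D.
    set t' := iotaE _^`(); set W := \det _; set t := iotaE (tau0 _ _ _ _); set k := iotaE _ => D.
    by transitivity (k * (t * De W)); [ring|rewrite -D; ring].
  have {}E : tau0 r a lam gam = c *: tau.
    apply: iotaE_inj; rewrite E taus -mul_polyC rmorphM scaleE.
    by [].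
  have := tau0_monic r a lam gam; rewrite E qualifE /= lead_coefZ (monicP tau_monic) mulr1.
  by move=> /eqP ->; rewrite scale1r.
rewrite tauE0 in Ttop.
have ss : size s = n'.+1.
  have := size_tau0 r a lam gam; rewrite tauE0 taus size_prod_XsubC.
  by move=> /succn_inj.
pose mu (i : 'I_n'.+1) := nth 0 s i.
have muI : injective mu.
  by move=> i j /eqP; rewrite /mu nth_uniq ?ss// => /eqP e; apply: val_inj.
have taumu : tau = qCpoly mu by rewrite taus -[LHS]/(linprod s) (linprod_nth ss).
rewrite taumu in Ttop DT.
have Tg_ex i : exists g, ract (@mulX R[i]) (dX (mu i)) T ('X + g%:P) = 0.
  have tmu : (qCpoly mu).[mu i] = 0 by apply/eqP; rewrite /qCpoly (bigD1 i)//= !hornerE subrr mul0r.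
  (* The Wronskian is tau up to a nonzero factor and mu_i is a simple root of tau. *)
  have Wmu : (De (\det (Wr (@De R) (phiE fE lam gam)))) (mu i) != 0.
    have := congr1 (fun u => (De u) (mu i)) DT; rewrite linearZ De_iota /= => E.
    have := qCpoly_deriv muI i; rewrite -E; apply: contra => /eqP ->.
    by rewrite mulr0.
  move: (phiE fE lam gam) Tphi Ttop Wmu N0; case: #|_| => // m f Tf Tt Wmu _.
  exact: (annihilator_exists Tt Tf tmu (qCpoly_deriv muI i) Wmu).
have [g Tg] := choice Tg_ex.
have KT (u : Ent R) : Kbar kappa (phiN fb lam gam) u = ev (wactE T u).
  apply: (Kbar_op Ttop Tphi (s := s) _ (phiN_ev fbE lam gam) _ DT).
  by rewrite -taumu taus.
have CbE : Cbeta a fb lam gam kappa = Dspace mu g.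
  by rewrite (Cbeta_annihilator hr fker fWr KT) (annihilator_Dspace muI Ttop N0 Tg).
(* S = T^flat, so S applied to c(hat f) is (c o T)(hat f), and c o T = 0 by the choice of [g]. *)
have Sphi k : wactE S (phiE fE mu g k) = 0.
  by rewrite -flat_T /phiE phi_ract// Tg linear0.
have [c Dc] : exists c, \det (Wr (@De R) (phiE fE mu g)) = c *: iotaE (linprod [seq lam i | i <- enum 'I_n'.+1]).
  apply: logderiv_eq; first by rewrite map_inj_uniq ?enum_uniq.
  by rewrite -linprod_lam; exact: (logderiv_Wr N0 Stop Sphi).
rewrite -linprod_lam in Dc.
have q_monic : qCpoly lam \is monic by apply: monic_prod => i _; exact: monicXsubC.
have c0 : c != 0.
  have [x0 qx0] := exists_nonroot (monic_neq0 q_monic).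
  have := det_Wr_phi_neq0 hr fker fWr muI Stop Sphi qx0.
  by rewrite Dc evZ; apply: contra => /eqP->; rewrite mul0r.
have DS : c^-1 *: \det (Wr (@De R) (phiE fE mu g)) = iotaE (qCpoly lam).
  by rewrite Dc scalerA mulVf// scale1r.
have KS (u : Ent R) : Kbar c^-1 (phiN fb mu g) u = ev (wactE S u).
  apply: (Kbar_op Stop Sphi (s := [seq lam i | i <- enum 'I_n'.+1]) _ (phiN_ev fbE mu g) _ DS).
  exact: linprod_lam.
have tauS : is_tau (phiN fb mu g) c^-1 (qCpoly lam).
  split; first by rewrite invr_eq0.
  split=> // x; rewrite (det_wrmx_ev x (phiN_ev fbE mu g)) -evZ DS.
  by [].
exists n'.+1, mu, g, c^-1; split=> //; split=> //.
- exists n'.+1, mu, g, c^-1, (qCpoly lam); split=> //.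
  exists [seq lam i | i <- enum 'I_n'.+1]; first by rewrite map_inj_uniq ?enum_uniq.
  exact: linprod_lam.
- exists T; split=> [u eu|u eu].
    by rewrite -[u]/(ev (MkEnt eu)) KT wact_ev polyseqK.
  by rewrite -[u]/(ev (MkEnt eu)) KS wflat_ev polyseqK flat_T.
(* The same description with S in place of T: its leading coefficient q has the simple roots lam_i,
   and the original functionals annihilate its image. *)
- rewrite (Cbeta_annihilator hr fker fWr KS).
  apply: (annihilator_Dspace hlam Stop N0); exact: Scm_kills.
Qed.
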